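(* Let $F=\alpha+|\beta|$ be a complex Randers solution of the generalized Zermelo navigation problem with data $(h,\|u\|_h,W)$ on a domain $D\subset\mathbb{C}^n$, and let $a$ be the associated Hermitian metric. Then $h$ is Kähler and $F$ is locally projectively flat if and only if $h$ is locally projectively flat and $F$ is complex Berwald. Moreover, any of these assertions implies that $\tilde\varepsilon=\|u\|_h^2-\|W\|_h^2$ is constant, that $h$, $a$ and $F$ are projectively related, and that $\mathcal{K}_F=\mathcal{K}_a=\mathcal{K}_h=0$.
   Context: On a complex manifold $M$ (here $M=D$) with local coordinates $z=(z^k)$, $(z,\eta)$ are the induced coordinates on the holomorphic tangent bundle $T'M$; summation convention; $\dot\partial_k=\partial/\partial\eta^k$, $\dot\partial_{\bar k}=\partial/\partial\bar\eta^k$; barred indices denote conjugates. Complex Finsler metric: continuous $F:T'M\to\mathbb{R}_{\ge0}$, smooth off the zero section, vanishing only there, $F(z,\lambda\eta)=|\lambda|F(z,\eta)$ for $\lambda\in\mathbb{C}$, with $g_{i\bar j}=\frac{\partial^2F^2}{\partial\eta^i\partial\bar\eta^j}$ positive definite; for $F=\alpha+|\beta|$ the derived objects are taken at points where $\beta\neq0$. Associated objects: $N^i_j=g^{\bar m i}\frac{\partial g_{l\bar m}}{\partial z^j}\eta^l$, $L^i_{jk}=\dot\partial_jN^i_k$, spray coefficients $G^i=\frac12N^i_j\eta^j$, $\theta^{*i}=g^{\bar mi}g_{h\bar p}(L^{\bar p}_{\bar j\bar m}-L^{\bar p}_{\bar m\bar j})\eta^h\bar\eta^j$ (with $L^{\bar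 p}_{\bar j\bar m}=\overline{L^p_{jm}}$), and holomorphic curvature in direction $\eta$: $\mathcal{K}_F(z,\eta)=-\frac{4}{F^4}g_{k\bar m}\frac{\partial G^k}{\partial\bar z^h}\bar\eta^h\bar\eta^m$. A Hermitian metric $h_{i\bar j}(z)$ is regarded as the complex Finsler metric $\sqrt{h_{i\bar j}\eta^i\bar\eta^j}$. $F$ is generalized Berwald if $\dot\partial_{\bar h}G^i=0$; weakly Kähler if $g_{i\bar l}(L^i_{jk}-L^i_{kj})\eta^j\bar\eta^l=0$; complex Berwald if it is generalized Berwald and weakly Kähler. For Hermitian metrics, Kähler has the usual meaning. Two complex Finsler metrics $F,\tilde F$ on $M$ are projectively related if they have the same complex geodesics as point sets, equivalently $\tilde G^i=G^i+\frac12(\tilde\theta^{*i}-\theta^{*i})+P\eta^i$ for some smooth complex-valued function $P$. A complex Finsler metric $\tilde F$ is locally Minkowski if around every point there are local charts in which $\tilde g_{i\bar j}$ depends only on $\eta$; $F$ is locally projectively flat if it is projectively related to a locally Minkowski metric. Complex Randers solution of the generalized Zermelo navigation problem: the data are a Hermitian metric $h$, a smooth section $W=W^i\frac{\partial}{\partial z^i}$ of $T'M$, and a smooth function $\|u\|_h$ on $M$ with $0<\|W\|_h<\|u\|_h\le1$, where $\|\eta\|_h=\sqrt{h_{i\bar j}\eta^i\bar\eta^j}$. Put $W_i=h_{i\bar j}\bar W^j$ and $\tilde\varepsilon=\|u\|_h^2-\|W\|_h^2$. The solution (case $\cos\varphi=-1$) is $F=\alpha+|\beta|$ with $\alpha=\sqrt{a_{i\bar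 j}\eta^i\bar\eta^j}$, $\beta=b_i\eta^i$, $$a_{i\bar j}=\frac{h_{i\bar j}}{\tilde\varepsilon}+\frac{W_i\overline{W_j}}{\tilde\varepsilon^2},\qquad b_i=\frac{W_i}{\tilde\varepsilon}.$$
   Formalization: The formal theorem assumes n ≥ 2; for n = 1 the claim fails: with h = 1, ||u|| = 1, W = (1+z)/4 on the unit disc both assertions hold automatically, but ε̃ = 1 − |1+z|²/16 is not constant and K_a ≠ 0. *)

(* Defs.v *)
From HB Require Import structures.
From mathcomp Require Import all_boot all_order all_algebra.
From mathcomp Require Import complex.
From mathcomp Require Import all_classical all_reals all_analysis.

Set Implicit Arguments.
Unset Strict Implicit.
Unset Printing Implicit Defensive.

Import Order.TTheory GRing.Theory Num.Theory.
Import numFieldNormedType.Exports.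

Local Open Scope classical_set_scope.
Local Open Scope ring_scope.
Local Open Scope complex_scope.

(* The library puts the topology of the field [R[i]] only on the alias
   [R[i]^o]; we transfer it, so that [R[i]] and ['rV[R[i]]_m] carry their
   usual topologies. *)
HB.instance Definition _ (R : realType) := NormedModule.copy R[i] R[i]^o.

Section RealDifferentiation.
Context {R : realType}.
Local Notation C := R[i].

Definition curve_derivable (c : R -> C) : Prop :=
  derivable (fun t => complex.Re (c t)) 0 1 /\
  derivable (fun t => complex.Im (c t)) 0 1.

Definition curve_derive (c : R -> C) : C :=
  ('D_1 (fun t => complex.Re (c t)) 0) +i* ('D_1 (fun t => complex.Im (c t)) 0).

Context {m : nat}.
Implicit Types (U : set 'rV[C]_m) (f : 'rV[C]_m -> C) (v z : 'rV[C]_m).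

(* [C^m] is seen as a real vector space: the parameter [t] is real. *)
Definition ddir v f z : C := curve_derive (fun t => f (z + t%:C *: v)).

Definition dderivable v f z : Prop :=
  curve_derivable (fun t => f (z + t%:C *: v)).

Fixpoint Ck_on (k : nat) U f : Prop :=
  (forall z, U z -> {for z, continuous f}) /\
  match k with
  | 0 => True
  | k'.+1 => forall v,
      (forall z, U z -> dderivable v f z) /\ Ck_on k' U (ddir v f)
  end.

(* C^infinity in the real sense; only meant for open [U] *)
Definition smooth_on U f : Prop := forall k, Ck_on k U f.

(* Wirtinger derivatives d/dz^k and d/d(conj z^k) *)
Definition dz (k : 'I_m) f z : C :=
  2^-1 * (ddir (delta_mx 0 k) f z - 'i * ddir ('i *: delta_mx 0 k) f z).

Definition dzb (k : 'I_m) f z : C :=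
  2^-1 * (ddir (delta_mx 0 k) f z + 'i * ddir ('i *: delta_mx 0 k) f z).

Definition holomorphic_on U f : Prop :=
  smooth_on U f /\ forall z, U z -> forall k, dzb k f z = 0.

End RealDifferentiation.

Section ComplexFinsler.
Context {R : realType} {n : nat}.
Local Notation C := R[i].
Local Notation V := 'rV[C]_n.

Implicit Types (D : set V) (A : V -> set V) (F : V -> V -> R) (h : V -> 'M[C]_n).
Implicit Types (z eta : V).

(* Regions of the holomorphic tangent bundle [D x C^n] are given by their
   fibres; smoothness there is joint, in the coordinates [(z, eta)]. *)
Definition total A : set 'rV[C]_(n + n) :=
  [set p | A (lsubmx p) (rsubmx p)].

Definition smooth_on_bundle A (f : V -> V -> C) : Prop :=
  smooth_on (total A) (fun p => f (lsubmx p) (rsubmx p)).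

Definition bundle D : V -> set V := fun z _ => D z.

Definition slit D : V -> set V := fun z eta => D z /\ eta != 0.

Definition hform (H : 'M[C]_n) eta : C :=
  \sum_i \sum_j H i j * eta 0 i * (eta 0 j)^*.

Definition posdef (H : 'M[C]_n) : Prop :=
  forall eta, eta != 0 -> 0 < hform H eta.

(* [fund F z eta i j] is g_{i \bar j} *)
Definition fund F z eta : 'M[C]_n :=
  \matrix_(i, j)
    dz i (fun eta1 => dzb j (fun eta2 => (F z eta2 ^+ 2)%:C) eta1) eta.

(* [ginv F z eta m i] is g^{\bar m i}: sum_i g^{\bar m i} g_{i \bar j} = delta *)
Definition ginv F z eta : 'M[C]_n := invmx (fund F z eta).

Record complex_finsler D F : Prop := {
  finsler_ge0 : forall z eta, D z -> 0 <= F z eta;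
  finsler_eq0 : forall z eta, D z -> (F z eta = 0 <-> eta = 0);
  finsler_cont : forall p, total (bundle D) p ->
    {for p, continuous (fun p => F (lsubmx p) (rsubmx p))};
  finsler_smooth : smooth_on_bundle (slit D) (fun z eta => (F z eta)%:C);
  finsler_homog : forall z eta (lam : C), D z ->
    F z (lam *: eta) = Normc.normc lam * F z eta;
  finsler_posdef : forall z eta, D z -> eta != 0 -> posdef (fund F z eta)
}.

Definition nonlin_conn F (i j : 'I_n) z eta : C :=
  \sum_m \sum_l
    ginv F z eta m i * dz j (fun z1 => fund F z1 eta l m) z * eta 0 l.

(* L^i_{jk} *)
Definition conn_coef F (i j k : 'I_n) z eta : C :=
  dz j (fun eta1 => nonlin_conn F i k z eta1) eta.

Definition spray F (i : 'I_n) z eta : C :=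
  2^-1 * \sum_j nonlin_conn F i j z eta * eta 0 j.

Definition theta F (i : 'I_n) z eta : C :=
  \sum_m \sum_r \sum_p \sum_j
    ginv F z eta m i * fund F z eta r p
    * ((conn_coef F p j m z eta)^* - (conn_coef F p m j z eta)^*)
    * eta 0 r * (eta 0 j)^*.

Definition hol_curv F z eta : C :=
  - (4 / (F z eta ^+ 4)%:C) *
  \sum_k \sum_m \sum_r
    fund F z eta k m * dzb r (fun z1 => spray F k z1 eta) z
    * (eta 0 r)^* * (eta 0 m)^*.

(* Below, [A] is the open region of the tangent bundle where the objects
   derived from [F] are taken: [slit D] for a genuine complex Finsler metric,
   the complement of the zeros of beta for [alpha + |beta|]. *)

Definition generalized_berwald A F : Prop :=
  forall z eta, A z eta -> forall i r,
    dzb r (fun eta1 => spray F i z eta1) eta = 0.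

Definition weakly_kahler A F : Prop :=
  forall z eta, A z eta -> forall k,
    \sum_i \sum_l \sum_j
      fund F z eta i l * (conn_coef F i j k z eta - conn_coef F i k j z eta)
      * eta 0 j * (eta 0 l)^* = 0.

Definition complex_berwald A F : Prop :=
  generalized_berwald A F /\ weakly_kahler A F.

Definition proj_related (A1 : V -> set V) (F1 : V -> V -> R)
    (A2 : V -> set V) (F2 : V -> V -> R) : Prop :=
  let A := fun z => A1 z `&` A2 z in
  exists P : V -> V -> C, smooth_on_bundle A P /\
    forall z eta, A z eta -> forall i,
      spray F2 i z eta =
        spray F1 i z eta + 2^-1 * (theta F2 i z eta - theta F1 i z eta)
        + P z eta * eta 0 i.

Record local_chart D (U U' : set V) (phi psi : V -> V) : Prop := {
  chart_open : open U;
  chart_sub : U `<=` D;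
  chart_open' : open U';
  chart_to : forall z, U z -> U' (phi z);
  chart_from : forall w, U' w -> U (psi w);
  chartK : forall z, U z -> psi (phi z) = z;
  chartVK : forall w, U' w -> phi (psi w) = w;
  chart_holo : forall i, holomorphic_on U (fun z => phi z 0 i);
  chart_holo' : forall i, holomorphic_on U' (fun w => psi w 0 i)
}.

(* [F] in the coordinates [(w, zeta)] induced on the tangent bundle by a chart
   whose inverse is [psi] *)
Definition in_chart (psi : V -> V) F : V -> V -> R := fun w zeta =>
  F (psi w) (\row_i \sum_j dz j (fun w1 => psi w1 0 i) w * zeta 0 j).

Definition locally_minkowski D F : Prop :=
  forall z0, D z0 -> exists U U' phi psi,
    [/\ local_chart D U U' phi psi, U z0 &
      forall w w' zeta, U' w -> U' w' -> zeta != 0 ->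
        fund (in_chart psi F) w zeta = fund (in_chart psi F) w' zeta].

Definition loc_proj_flat D A F : Prop :=
  exists F0, [/\ complex_finsler D F0, locally_minkowski D F0 &
    proj_related A F (slit D) F0].

Record hermitian_metric D h : Prop := {
  hermitian_smooth : forall i j, smooth_on D (fun z => h z i j);
  hermitian_sym : forall z, D z -> forall i j, h z j i = (h z i j)^*;
  hermitian_posdef : forall z, D z -> posdef (h z)
}.

Definition herm_norm h : V -> V -> R := fun z eta =>
  Num.sqrt (complex.Re (hform (h z) eta)).

(* The components of the exterior derivative of the fundamental form
   i h_{i \bar j} dz^i /\ d\bar z^j vanish, in types (2,1) and (1,2). *)
Definition kahler D h : Prop :=
  forall z, D z -> forall i j k,
    dz k (fun z1 => h z1 i j) z - dz i (fun z1 => h z1 k j) z = 0 /\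
    dzb k (fun z1 => h z1 i j) z - dzb j (fun z1 => h z1 i k) z = 0.

Implicit Types (u : V -> R) (W : V -> V).

(* [u] is the function ||u||_h *)
Record zermelo_data D h u W : Prop := {
  zermelo_hermitian : hermitian_metric D h;
  zermelo_smooth_u : smooth_on D (fun z => (u z)%:C);
  zermelo_smooth_W : forall i, smooth_on D (fun z => W z 0 i);
  zermelo_W_gt0 : forall z, D z -> 0 < herm_norm h z (W z);
  zermelo_W_lt : forall z, D z -> herm_norm h z (W z) < u z;
  zermelo_u_le1 : forall z, D z -> u z <= 1
}.

Definition zermelo_low h W z (i : 'I_n) : C :=
  \sum_j h z i j * (W z 0 j)^*.

Definition zermelo_eps h u W z : R := u z ^+ 2 - herm_norm h z (W z) ^+ 2.

Definition zermelo_a h u W : V -> 'M[C]_n := fun z =>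
  \matrix_(i, j)
    (h z i j / (zermelo_eps h u W z)%:C +
     zermelo_low h W z i * (zermelo_low h W z j)^*
       / (zermelo_eps h u W z ^+ 2)%:C).

Definition zermelo_beta h u W z eta : C :=
  \sum_i zermelo_low h W z i / (zermelo_eps h u W z)%:C * eta 0 i.

Definition zermelo_randers h u W : V -> V -> R := fun z eta =>
  herm_norm (zermelo_a h u W) z eta + Normc.normc (zermelo_beta h u W z eta).

Definition beta_neq0 D h u W : V -> set V := fun z eta =>
  D z /\ zermelo_beta h u W z eta != 0.

End ComplexFinsler.

(* Main.v *)
Require Import Defs.

From HB Require Import structures.
From mathcomp Require Import all_boot all_order all_algebra.
From mathcomp Require Import complex.
From mathcomp Require Import all_classical all_reals all_analysis.
From mathcomp Require Import ring lra.

Set Implicit Arguments.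
Unset Strict Implicit.
Unset Printing Implicit Defensive.

Import Order.TTheory GRing.Theory Num.Theory.
Import numFieldNormedType.Exports.

Local Open Scope classical_set_scope.
Local Open Scope ring_scope.
Local Open Scope complex_scope.

Local Notation "x ^*" := (conjc x) : ring_scope.

(* Proof idea. Write L = F^2, and let delta_j be the horizontal derivatives
   d/dz^j - Gamma^i_{lj} eta^l d/deta^i of the Chern connection Gamma of h.

   A metric projectively related to a locally Minkowski one, F0, is complex
   Berwald: replacing eta by i eta reverses the sign of the sprays but not of
   the torsion vectors theta, and pairing the sprays with the differential of L
   shows that the projective factor is holomorphic along the fibres.

   The heart of the proof is that delta_j annihilates L when h is Kaehler and
   F = alpha + |beta| is complex Berwald. Let C^p_m be the fibre derivative of
   the spray G^p along eta^m; it is holomorphic in eta, and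
   d_m L = L_p C^p_m because F is weakly Kaehler. Put EH = h / eps,
   so that alpha^2 = EH + |beta|^2, and let T, V be the derivatives of EH and
   |beta|^2 along d_m - C^p_m d/deta^p. Eliminating the square roots gives
   |beta|^2 (T^2 + 2 T V) = EH V^2, a cubic identity in conj eta whose
   coefficients are holomorphic in eta; it can therefore be polarized, and
   evaluating it on a plane spanned by a zero of conj beta and another vector
   gives T = V = 0. Then T = 0 says C = Gamma eta + sigma eta with
   sigma = - d log eps; Euler's relation for G forces sigma = 0 as n >= 2, so
   eps is constant, and V = 0 says that beta conj(beta) is parallel. Hence F, a
   and h have the same connection Gamma.

   Finally the holomorphic connection of F0 differs from Gamma by a symmetric
   projective term f_l delta^i_j + f_j delta^i_l, so the curvature of h is the
   antiholomorphic derivative of this term. Its Kaehler symmetries and the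
   parallel nonzero tensor beta conj(beta) force it to vanish. *)

(** * Smooth functions and Wirtinger derivatives *)

(** Two features shape the development. The objects derived from [F] are taken where beta is
    nonzero, those of [h], [a] and [F0] off the zero section; so sprays are studied over an
    arbitrary open, scale-invariant region [A] of the tangent bundle, and regions are compared by
    inclusion. Moreover the definitions differentiate in [z] and in [eta] separately; both become
    derivatives on one space of dimension [n + n], where Schwarz's theorem exchanges them.

    Square roots block polarization: alpha and |beta| are not polynomial in conj eta. Multiplying
    the first-order relation by its image under alpha -> -alpha leaves only their squares, at the
    price of a cubic identity whose factors must be separated again; hence the generic open set of
    directions.

    Coefficients that depend on [z] alone can be read off at a single direction. This glues the
    chart connections of [F0] into a global one, and carries the relation between [F0] and [F],
    known where beta is nonzero, over to [h] on the whole slit bundle. *)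

Section Topology.
Context {R : realType}.
Local Notation C := R[i].

(** A real-valued norm equivalent to the modulus. The norm of [R[i]] takes values in [R[i]]; this
    one splits into real and imaginary parts without square roots, which suits componentwise
    estimates. *)
Definition abs1 (c : C) : R := `|complex.Re c| + `|complex.Im c|.

Lemma abs1_ge0 c : 0 <= abs1 c.
Proof. by rewrite addr_ge0. Qed.

Lemma abs1D c d : abs1 (c + d) <= abs1 c + abs1 d.
Proof.
case: c d => [a b] [a' b']; rewrite /abs1 /= addrACA.
by apply: lerD; apply: ler_normD.
Qed.

Lemma abs1_real (t : R) : abs1 t%:C = `|t|.
Proof. by rewrite /abs1 /= normr0 addr0. Qed.

Lemma abs1N c : abs1 (- c) = abs1 c.
Proof. by case: c => a b; rewrite /abs1 /= !normrN. Qed.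

Lemma nbhs_abs1P (c : C) (U : set C) :
  nbhs c U <-> exists2 e : R, 0 < e & forall w, abs1 (w - c) < e -> U w.
Proof.
have normE (w : C) : `|w| = (Normc.normc w)%:C by [].
split.
  move=> /nbhs_ballP [[e e']]; rewrite /= ltcE /= => /andP[/eqP -> e0] sU.
  exists e => // w we; apply: sU.
  rewrite -ball_normE /= normE; rewrite ltcR; apply: le_lt_trans we.
  rewrite -[c - w]opprB normcN.
  case: (w - c) => x y; rewrite /abs1 /Normc.normc /=.
  rewrite -[leRHS]ger0_norm ?addr_ge0// -sqrtr_sqr ler_wsqrtr//.
  by rewrite sqrrD !real_normK ?num_real// lerD2r lerDl mulrn_wge0 ?mulr_ge0.
move=> [e e0 sU]; apply/nbhs_ballP; exists (e / 2)%:C => /=.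
  by rewrite ltcR divr_gt0.
move=> w; rewrite -ball_normE /= normE ltcR => we; apply: sU.
(* The converse comparison is [abs1 <= 2 * normc], hence the radius [e / 2]. *)
apply: (@le_lt_trans _ _ (2 * Normc.normc (c - w))); last first.
  by rewrite mulrC -ltr_pdivlMr.
rewrite -[c - w]opprB normcN.
case: (w - c) => x y; rewrite /abs1 /Normc.normc /=.
rewrite mulr2n mulrDl mul1r; apply: lerD; rewrite -[leLHS]sqrtr_sqr ler_wsqrtr//.
  by rewrite lerDl sqr_ge0.
by rewrite lerDr sqr_ge0.
Qed.

Context {m : nat}.
Implicit Types (z w v : 'rV[C]_m) (U : set 'rV[C]_m).

Definition vabs1 w : R := \sum_k abs1 (w 0 k).

Lemma vabs1_ge0 w : 0 <= vabs1 w.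
Proof. by rewrite sumr_ge0// => k _; apply: abs1_ge0. Qed.

Lemma vabs1D w v : vabs1 (w + v) <= vabs1 w + vabs1 v.
Proof.
rewrite /vabs1 -big_split /=; apply: ler_sum => k _.
by rewrite mxE abs1D.
Qed.

Lemma vabs10 : vabs1 0 = 0.
Proof. by rewrite /vabs1 big1// => k _; rewrite mxE /abs1 /= normr0 addr0. Qed.

Lemma vabs1Z (t : R) w : vabs1 (t%:C *: w) = `|t| * vabs1 w.
Proof.
rewrite /vabs1 mulr_sumr; apply: eq_bigr => k _; rewrite mxE.
case: (w 0 k) => a b; rewrite /abs1 /= !mul0r subr0 addr0 mulrDr !normrM.
by [].
Qed.

Lemma abs1_coord w k : abs1 (w 0 k) <= vabs1 w.
Proof.
rewrite /vabs1 (bigD1 k)//= lerDl sumr_ge0// => j _; exact: abs1_ge0.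
Qed.

Lemma nbhs_vabs1P z U :
  nbhs z U <-> exists2 e : R, 0 < e & forall w, vabs1 (w - z) < e -> U w.
Proof.
split.
  move=> [P Pz sU].
  have /choice [e he] : forall k : 'I_m, exists e : R,
      0 < e /\ forall c, abs1 (c - z 0 k) < e -> P 0 k c.
    by move=> k; have [e e0 ?] := (nbhs_abs1P _ _).1 (Pz 0 k); exists e.
  exists (\big[Num.min/1]_k e k).
    by elim/big_ind : _ => // [x y x0 y0|k _]; [rewrite lt_min x0|case: (he k)].
  move=> w we; apply: sU => i k; rewrite ord1; apply: (he k).2.
  have -> : w 0 k - z 0 k = (w - z) 0 k by rewrite !mxE.
  apply: le_lt_trans (abs1_coord _ _) _; apply: lt_le_trans we _.
  exact: bigmin_le_cond.
move=> [e e0 sU].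
(* With [m.+1] in the denominator the [m] coordinates add up to strictly less than [e], also when
   [m = 0]. *)
exists (fun i k => [set c | abs1 (c - z i k) < e / m.+1%:R]).
  move=> i k; apply/nbhs_abs1P; exists (e / m.+1%:R) => //.
  by rewrite divr_gt0.
move=> w hw; apply: sU.
apply: (@le_lt_trans _ _ (\sum_(k < m) e / m.+1%:R)).
  by apply: ler_sum => k _; have := hw 0 k; rewrite !mxE => /ltW.
rewrite sumr_const card_ord -[_ *+ m]mulr_natr mulrAC ltr_pdivrMr//.
by rewrite ltr_pM2l// ltr_nat.
Qed.

Lemma continuous_vabs1P (f : 'rV[C]_m -> C) z :
  {for z, continuous f} <->
  forall e : R, 0 < e -> exists2 d : R, 0 < d &
    forall w, vabs1 (w - z) < d -> abs1 (f w - f z) < e.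
Proof.
split.
  move=> cf e e0.
  have : nbhs (f z) [set c | abs1 (c - f z) < e] by apply/nbhs_abs1P; exists e.
  by move=> /cf /nbhs_vabs1P.
move=> H U /nbhs_abs1P [e e0 sU].
have [d d0 hd] := H e e0.
by apply/nbhs_vabs1P; exists d => // w wd; apply/sU/hd.
Qed.

Lemma open_vabs1P U :
  open U <-> forall z, U z ->
    exists2 e : R, 0 < e & forall w, vabs1 (w - z) < e -> U w.
Proof.
rewrite openE; split=> H z Uz; first by apply/nbhs_vabs1P/H.
by apply/nbhs_vabs1P/H.
Qed.

End Topology.

Section RealDerive.
Context {R : realType}.
Implicit Types (f g : R -> R) (x a b : R).

Lemma is_derive_addf f g x a b : is_derive x 1 f a -> is_derive x 1 g b ->
  is_derive x 1 (fun t => f t + g t) (a + b).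
Proof. exact: is_deriveD. Qed.

Lemma is_derive_oppf f x a : is_derive x 1 f a ->
  is_derive x 1 (fun t => - f t) (- a).
Proof. exact: is_deriveN. Qed.

Lemma is_derive_mulf f g x a b : is_derive x 1 f a -> is_derive x 1 g b ->
  is_derive x 1 (fun t => f t * g t) (f x * b + g x * a).
Proof. exact: is_deriveM. Qed.

Lemma is_derive_invf f x a : f x != 0 -> is_derive x 1 f a ->
  is_derive x 1 (fun t => (f t)^-1) (- (f x) ^- 2 * a).
Proof. exact: is_deriveV. Qed.

Lemma is_derive_sqrtf f x a : 0 < f x -> is_derive x 1 f a ->
  is_derive x 1 (fun t => Num.sqrt (f t)) ((2 * Num.sqrt (f x))^-1 * a).
Proof. by move=> fx df; apply: is_derive1_comp; apply: is_derive1_sqrt. Qed.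

Lemma is_derive_eqf f x a b : is_derive x 1 f a -> a = b -> is_derive x 1 f b.
Proof. by move=> df <-. Qed.

End RealDerive.

Section CurveDerivative.
Context {R : realType}.
Local Notation C := R[i].
Implicit Types (c d : R -> C) (k l : C).

(** Relational form of [curve_derivable] and [curve_derive]: existence and value of the derivative
    travel together through the calculus rules. *)
Definition is_cderive c l : Prop :=
  is_derive (0 : R) 1 (fun t => complex.Re (c t)) (complex.Re l) /\
  is_derive (0 : R) 1 (fun t => complex.Im (c t)) (complex.Im l).

Lemma is_cderiveP c : curve_derivable c -> is_cderive c (curve_derive c).
Proof. by move=> [d1 d2]; split; apply: derivableP. Qed.

Lemma is_cderive_derivable c l : is_cderive c l -> curve_derivable c.
Proof. by move=> [d1 d2]; split; apply: ex_derive. Qed.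

Lemma is_cderive_val c l : is_cderive c l -> curve_derive c = l.
Proof.
by case: l => x y [/= d1 d2]; rewrite /curve_derive !derive_val.
Qed.

Lemma is_cderive_cst k : is_cderive (fun=> k) 0.
Proof. by split; apply: is_derive_cst. Qed.

Lemma is_cderiveD c d k l : is_cderive c k -> is_cderive d l ->
  is_cderive (fun t => c t + d t) (k + l).
Proof.
move=> [c1 c2] [d1 d2].
have ReD (x y : C) : complex.Re (x + y) = complex.Re x + complex.Re y.
  by case: x y => [? ?] [].
have ImD (x y : C) : complex.Im (x + y) = complex.Im x + complex.Im y.
  by case: x y => [? ?] [].
by split; under eq_fun do rewrite ?ReD ?ImD; rewrite ?ReD ?ImD;
  apply: is_derive_addf.
Qed.

Lemma is_cderiveM c d k l : is_cderive c k -> is_cderive d l ->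
  is_cderive (fun t => c t * d t) (k * d 0 + c 0 * l).
Proof.
move=> [c1 c2] [d1 d2].
have ReM (x y : C) : complex.Re (x * y) =
  complex.Re x * complex.Re y + - (complex.Im x * complex.Im y).
  by case: x y => [? ?] [].
have ImM (x y : C) : complex.Im (x * y) =
  complex.Re x * complex.Im y + complex.Im x * complex.Re y.
  by case: x y => [? ?] [].
split; under eq_fun do rewrite ?ReM ?ImM.
  apply: (is_derive_eqf (is_derive_addf (is_derive_mulf c1 d1)
      (is_derive_oppf (is_derive_mulf c2 d2)))).
  by move: (c 0) (d 0) k l {c1 c2 d1 d2}=> [? ?] [? ?] [? ?] [? ?] /=; ring.
apply: (is_derive_eqf (is_derive_addf (is_derive_mulf c1 d2) (is_derive_mulf c2 d1))).
by move: (c 0) (d 0) k l {c1 c2 d1 d2}=> [? ?] [? ?] [? ?] [? ?] /=; ring.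
Qed.

Lemma is_cderive_conj c k : is_cderive c k ->
  is_cderive (fun t => (c t)^*) (k^*).
Proof.
move=> [c1 c2].
have ReJ (x : C) : complex.Re (x^*) = complex.Re x by case: x.
have ImJ (x : C) : complex.Im (x^*) = - complex.Im x by case: x.
split; under eq_fun do rewrite ?ReJ ?ImJ; rewrite ?ReJ ?ImJ //.
exact: is_derive_oppf.
Qed.

Lemma is_cderiveV c k : c 0 != 0 -> is_cderive c k ->
  is_cderive (fun t => (c t)^-1) (- (k / c 0 ^+ 2)).
Proof.
move=> c0 [c1 c2].
pose n2 (x : C) := complex.Re x * complex.Re x + complex.Im x * complex.Im x.
have ReV (x : C) : complex.Re x^-1 = complex.Re x * (n2 x)^-1 by case: x.
have ImV (x : C) : complex.Im x^-1 = - (complex.Im x * (n2 x)^-1) by case: x.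
have n20 : n2 (c 0) != 0.
  move: c0; rewrite /n2; case: (c 0) => x y; rewrite eq_complex /=.
  by rewrite -!expr2 paddr_eq0 ?sqr_ge0// !sqrf_eq0.
have dn2 : is_derive (0 : R) 1 (fun t => n2 (c t))
    (2 * complex.Re (c 0) * complex.Re k + 2 * complex.Im (c 0) * complex.Im k).
  apply: (is_derive_eqf (is_derive_addf (is_derive_mulf c1 c1) (is_derive_mulf c2 c2))).
  by ring.
have dV := @is_derive_invf _ (fun t => n2 (c t)) 0 _ n20 dn2.
have c02 : c 0 ^+ 2 != 0 by rewrite expf_eq0.
have : is_cderive (fun t => (c t)^-1)
  ((complex.Re (c 0) * (- n2 (c 0) ^- 2 * (2 * complex.Re (c 0) * complex.Re k
     + 2 * complex.Im (c 0) * complex.Im k)) + (n2 (c 0))^-1 * complex.Re k)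
  +i* (- (complex.Im (c 0) * (- n2 (c 0) ^- 2 * (2 * complex.Re (c 0) *
     complex.Re k + 2 * complex.Im (c 0) * complex.Im k)) + (n2 (c 0))^-1 *
     complex.Im k))).
  split; under eq_fun do rewrite ?ReV ?ImV.
    exact: is_derive_mulf.
  by apply: is_derive_oppf; apply: is_derive_mulf.
congr is_cderive.
apply: (mulIf c02); rewrite [RHS]mulNr [in RHS]divfK//.
move: c0 n20 {c02 dn2 dV c1 c2}; rewrite /n2.
case: (c 0) k => [a b] [a' b'] /= _ n20.
apply/eqP; rewrite eq_complex /=; apply/andP; split; apply/eqP; by field.
Qed.

Lemma is_cderive_sqrt (f : R -> R) k : 0 < f 0 ->
  is_cderive (fun t => (f t)%:C) k ->
  is_cderive (fun t => (Num.sqrt (f t))%:C) (k / (2 * (Num.sqrt (f 0))%:C)).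
Proof.
move=> f0 [/= d1 d2].
have s0 : Num.sqrt (f 0) != 0 by rewrite gt_eqF// sqrtr_gt0.
(* The curve is real, hence so is its derivative. *)
have Imk : complex.Im k = 0 by rewrite -(@derive_val _ _ _ _ _ _ _ d2) derive_cst.
have -> : k / (2 * (Num.sqrt (f 0))%:C) =
    ((2 * Num.sqrt (f 0))^-1 * complex.Re k)%:C.
  case: k Imk {d1 d2} => x y /= ->; rewrite rmorphM/= fmorphV rmorphM /= mulrC.
  by rewrite rmorph_nat.
split => /=; last exact: is_derive_cst.
exact: is_derive_sqrtf.
Qed.

End CurveDerivative.

Section RealCriterion.
Context {R : realType}.
Implicit Types (f : R -> R) (a : R).

(** The error bound is free of division, so that contributions of several directions can be added;
    the chain rule [rdir_chain] rests on this form. *)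
Lemma is_derive0P f a : is_derive (0 : R) 1 f a <->
  forall e : R, 0 < e -> exists2 d : R, 0 < d &
    forall t, `|t| < d -> `|f t - f 0 - a * t| <= e * `|t|.
Proof.
have E b t : t != 0 -> `|f t - f 0 - b * t| =
    `|b - t^-1 *: ((f \o shift 0) (t *: 1) - f 0)| * `|t|.
  move=> t0; rewrite -normrM /= addr0 [t *: 1]mulr1 distrC mulrBl.
  by rewrite [_ *: _]mulrC [_ / t * t]divfK.
split.
  move=> [df <-] e e0.
  have : \forall t \near (0 : R)^',
      `|'D_1 f 0 - t^-1 *: ((f \o shift 0) (t *: 1) - f 0)| < e.
    by apply: cvgr_dist_lt e0; exact: df.
  move=> /nbhs_ballP [d /= d0 hd].
  exists d => // t td; have [->|t0] := eqVneq t 0.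
    by rewrite subrr mulr0 subr0 normr0 mulr0.
  have := hd t; rewrite /ball /= sub0r normrN => /(_ td t0) H.
  by rewrite E//; apply: ler_wpM2r => //; exact: ltW.
move=> H.
have cv : (fun h : R => h^-1 *: ((f \o shift 0) (h *: 1) - f 0)) @ 0^' --> a.
  apply/cvgrPdist_le => e e0.
  have [d d0 hd] := H e e0.
  apply/nbhs_ballP; exists d => //= t.
  rewrite /ball /= sub0r normrN => td t0.
  have := hd t td; rewrite E// ler_pM2r//.
  by rewrite normr_gt0.
apply: DeriveDef; first by apply/cvg_ex; exists a.
exact: cvg_lim cv.
Qed.

End RealCriterion.

(** * Mean value theorem, chain rule and Schwarz's theorem along real directions *)

Section DirectionalDerivative.
Context {R : realType} {m : nat}.
Local Notation C := R[i].
Local Notation V := 'rV[C]_m.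
Implicit Types (g : V -> R) (v w y z : V) (s t : R).

Definition rdir v g z : R := 'D_1 (fun t => g (z + t%:C *: v)) 0.

Definition rdderivable v g z : Prop := derivable (fun t => g (z + t%:C *: v)) 0 1.

Lemma rdirP v g z : rdderivable v g z ->
  is_derive (0 : R) 1 (fun t => g (z + t%:C *: v)) (rdir v g z).
Proof. exact: derivableP. Qed.

Lemma rdir_shift v g z s : rdderivable v g (z + s%:C *: v) ->
  is_derive s 1 (fun t => g (z + t%:C *: v)) (rdir v g (z + s%:C *: v)).
Proof.
move=> /rdirP dg.
have -> : (fun t => g (z + t%:C *: v)) =
    (fun t => g (z + s%:C *: v + t%:C *: v)) \o shift (- s).
  apply/funext => t /=; congr g.
  by rewrite -addrA -scalerDl -rmorphD /= [s + _]addrC subrK.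
rewrite -[rdir _ _ _]mulr1; apply: is_derive1_comp; last exact: is_derive_shift.
by rewrite /= subrr.
Qed.

Lemma rdir_MVT v g z s : (forall t, `|t| <= `|s| -> rdderivable v g (z + t%:C *: v)) ->
  exists2 t, `|t| <= `|s| & g (z + s%:C *: v) - g z = s * rdir v g (z + t%:C *: v).
Proof.
move=> dg.
have [s0|s0] := leP 0 s.
  have [t||t] := @MVT_segment _ (fun t => g (z + t%:C *: v))
      (fun t => rdir v g (z + t%:C *: v)) 0 s s0.
  - rewrite in_itv /= => /andP[t0 ts]; apply: rdir_shift; apply: dg.
    by rewrite !ger0_norm// ltW.
  - apply: derivable_within_continuous => t; rewrite in_itv /= => /andP[t0 ts].
    by apply: ex_derive; apply: rdir_shift; apply: dg; rewrite !ger0_norm.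
  - rewrite in_itv /= => /andP[t0 ts]; rewrite scale0r addr0 subr0 mulrC => H.
    by exists t => //; rewrite !ger0_norm.
have [t||t] := @MVT_segment _ (fun t => g (z + t%:C *: v))
    (fun t => rdir v g (z + t%:C *: v)) s 0 (ltW s0).
- rewrite in_itv /= => /andP[t0 ts]; apply: rdir_shift; apply: dg.
  by rewrite !ler0_norm ?lerN2 ?ltW.
- apply: derivable_within_continuous => t; rewrite in_itv /= => /andP[t0 ts].
  apply: ex_derive; apply: rdir_shift; apply: dg.
  by rewrite !ler0_norm ?lerN2// ltW.
- rewrite in_itv /= => /andP[t0 ts]; rewrite scale0r addr0 sub0r mulrC => H.
  exists t; first by rewrite !ler0_norm ?lerN2// ltW.
  by apply: oppr_inj; rewrite opprB H mulNr.
Qed.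

Lemma vabs1_step v y z s : vabs1 (y + s%:C *: v - z) <= vabs1 (y - z) + `|s| * vabs1 v.
Proof. by rewrite addrAC -vabs1Z vabs1D. Qed.

(** The classical sufficient condition for differentiability, one direction at a time: the partial
    derivative exists near [z] and is continuous at [z]. *)
Definition rC1 v g z : Prop := forall e : R, 0 < e -> exists2 d : R, 0 < d &
  forall w, vabs1 (w - z) < d ->
    rdderivable v g w /\ `|rdir v g w - rdir v g z| < e.

(** Continuous partial derivatives give a first-order expansion: move along one direction at a time
    and apply the mean value theorem to each move. The bound is uniform in the base point [y]
    because the induction continues from a displaced point. *)
Lemma rdir_expansion (I : Type) (r : seq I) (v : I -> V) g z :
  (forall i, rC1 (v i) g z) ->
  forall e : R, 0 < e -> exists2 d : R, 0 < d &
    forall y (s : I -> R), vabs1 (y - z) < d -> \sum_(i <- r) `|s i| < d ->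
      `|g (y + \sum_(i <- r) (s i)%:C *: v i) - g y
        - \sum_(i <- r) s i * rdir (v i) g z| <= e * \sum_(i <- r) `|s i|.
Proof.
move=> C1 e e0; elim: r => [|i r [d1 d10 hd1]].
  by exists 1 => // y s _ _; rewrite !big_nil addr0 subrr subr0 normr0 mulr0.
have [d2 d20 hd2] := C1 i e e0.
pose M := vabs1 (v i); have M0 : 0 <= M := vabs1_ge0 _.
have M1 : 0 < 1 + M by rewrite ltr_wpDr.
have m0 : 0 < Num.min d1 d2 by rewrite lt_min d10.
(* A base point within [d0] of [z], followed by a move of parameter less than [d0] along a vector of
   size [M], stays within [d0 * (1 + M)] of [z], half the smaller of the two radii. *)
pose d0 := Num.min d1 d2 / (2 * (1 + M)).
have d0M : 2 * d0 + 2 * (d0 * M) = Num.min d1 d2.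
  by rewrite /d0; field; rewrite gt_eqF.
have d00 : 0 < d0 by rewrite divr_gt0// mulr_gt0.
exists d0 => // y s; rewrite !big_cons; set S := \sum_(_ <- r) `|_|.
have S0 : 0 <= S by rewrite sumr_ge0.
move=> yd sd.
have near_z t : `|t| <= `|s i| -> vabs1 (y + t%:C *: v i - z) < Num.min d1 d2.
  move=> ts; apply: le_lt_trans (vabs1_step _ _ _ _) _; rewrite -/M.
  have : `|t| * M <= d0 * M by rewrite ler_wpM2r//; lra.
  have : 0 <= d0 * M by rewrite mulr_ge0// ltW.
  by move: d0M yd sd; set a := Num.min _ _; set b := vabs1 _ => *; lra.
have near1 t : `|t| <= `|s i| -> vabs1 (y + t%:C *: v i - z) < d1.
  by move=> /near_z; rewrite lt_min => /andP[].
have near2 t : `|t| <= `|s i| -> vabs1 (y + t%:C *: v i - z) < d2.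
  by move=> /near_z; rewrite lt_min => /andP[].
have [t ts Et] := @rdir_MVT (v i) g y (s i) (fun t ts => (hd2 _ (near2 t ts)).1).
have Sd1 : S < d1.
  have : 0 <= d0 * M by rewrite mulr_ge0// ltW.
  have : Num.min d1 d2 <= d1 by rewrite ge_min lexx.
  have : 0 <= `|s i| by [].
  by move: d0M sd; set a := Num.min _ _ => *; lra.
have := hd1 (y + (s i)%:C *: v i) s (near1 _ (lexx _)) Sd1; rewrite -/S.
have := (hd2 _ (near2 t ts)).2 => /ltW dt.
set A := g _; set B := \sum_(_ <- _) (_ * _) => H.
rewrite [y + _]addrA [in X in g X](_ : y + _ + _ = y + (s i)%:C *: v i + \sum_(j <- r) (s j)%:C *: v j) //.
rewrite -/A.
have -> : A - g y - (s i * rdir (v i) g z + B) =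
  (A - g (y + (s i)%:C *: v i) - B) +
  s i * (rdir (v i) g (y + t%:C *: v i) - rdir (v i) g z).
  by rewrite mulrBr -Et; ring.
apply: le_trans (ler_normD _ _) _; rewrite normrM mulrDr addrC.
by apply: lerD => //; rewrite mulrC ler_wpM2r.
Qed.

(** After subtraction of the linear part, [rdir_expansion] bounds the remainder by a small multiple
    of the sum of the [|s i t|], and this sum is O(t) because each [s i] vanishes at 0 and is
    differentiable there. *)
Lemma rdir_chain (I : finType) (v : I -> V) (s : I -> R -> R) (l : I -> R) g z :
  (forall i, rC1 (v i) g z) ->
  (forall i, s i 0 = 0) -> (forall i, is_derive (0 : R) 1 (s i) (l i)) ->
  is_derive (0 : R) 1 (fun t => g (z + \sum_i (s i t)%:C *: v i))
    (\sum_i l i * rdir (v i) g z).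
Proof.
move=> C1 s0 ds.
pose h t := g (z + \sum_i (s i t)%:C *: v i) - \sum_i s i t * rdir (v i) g z.
have dh : is_derive (0 : R) 1 h 0.
  (* Near 0 one has [|s i t| <= (|l i| + 1) * |t|], so [K] bounds the sum of the coefficients. *)
  pose K := \sum_i (`|l i| + 1).
  have K0 : 0 <= K by rewrite sumr_ge0// => i _; rewrite addr_ge0.
  have Ks (e : R) : 0 < e -> exists2 d : R, 0 < d & forall t, `|t| < d ->
      \sum_i `|s i t| <= K * `|t| /\ `|t| < e.
    move=> e0.
    have /choice [d hd] : forall i, exists d : R, 0 < d /\
        forall t, `|t| < d -> `|s i t| <= (`|l i| + 1) * `|t|.
      move=> i; have [d d0 hd] := (is_derive0P _ _).1 (ds i) 1 ltr01.
      exists d; split => // t /hd; rewrite s0 subr0 mul1r => H.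
      rewrite mulrDl mul1r -normrM addrC.
      have -> : s i t = (s i t - l i * t) + l i * t by rewrite subrK.
      by apply: le_trans (ler_normD _ _) _; rewrite lerD2r.
    exists (Num.min e (\big[Num.min/1]_i d i)).
      rewrite lt_min e0 /=; elim/big_ind : _ => // [x y x0 y0|k _].
        by rewrite lt_min x0.
      by case: (hd k).
    move=> t; rewrite lt_min => /andP[te td]; split => //.
    rewrite mulr_suml; apply: ler_sum => i _; apply: (hd i).2.
    by apply: lt_le_trans td _; apply: bigmin_le_cond.
  apply/is_derive0P => e e0.
  have K1 : 0 < K + 1 by rewrite ltr_wpDl.
  have [d d0 hd] := rdir_expansion (index_enum I) C1 (divr_gt0 e0 K1).
  have [d1 d10 hd1] := Ks (d / (K + 1)) (divr_gt0 d0 K1).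
  exists d1 => // t /hd1 [sK td].
  have td' : (K + 1) * `|t| < d by rewrite mulrC -ltr_pdivlMr.
  have sd : \sum_i `|s i t| < d.
    apply: le_lt_trans sK (le_lt_trans _ td').
    by rewrite ler_wpM2r// lerDl.
  have := hd z (fun i => s i t); rewrite subrr vabs10 => /(_ d0 sd) H.
  rewrite mul0r subr0 /h.
  have -> : g (z + \sum_i (s i 0)%:C *: v i) = g z.
    by rewrite big1 ?addr0// => i _; rewrite s0 scale0r.
  have -> : \sum_i s i 0 * rdir (v i) g z = 0.
    by rewrite big1// => i _; rewrite s0 mul0r.
  rewrite subr0 addrAC; apply: le_trans H _.
  rewrite mulrAC ler_pdivrMr// -mulrA ler_wpM2l ?(ltW e0)//.
  apply: le_trans sK _; rewrite mulrC ler_wpM2l// lerDl.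
  by [].
have -> : (fun t => g (z + \sum_i (s i t)%:C *: v i)) =
    (fun t => h t + \sum_i s i t * rdir (v i) g z).
  by apply/funext => t; rewrite subrK.
rewrite -[X in is_derive _ _ _ X]add0r; apply: is_derive_addf => //.
elim: (index_enum I) => [|i r IH].
  rewrite big_nil; under eq_fun do rewrite big_nil; exact: is_derive_cst.
rewrite big_cons; under eq_fun do rewrite big_cons.
apply: is_derive_addf => //.
apply: (is_derive_eqf (is_derive_mulf (ds i) (is_derive_cst _ _ _))).
by rewrite mulr0 add0r mulrC.
Qed.

#[local] Opaque rdir.

Lemma half_dist_absurd (a b x : R) :
  `|x - a| < `|a - b| / 2 -> `|x - b| < `|a - b| / 2 -> False.
Proof.
move=> H1 H2; have := ltrD H1 H2; rewrite -splitr ltNge => /negP; apply.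
rewrite [X in _ <= X + _]distrC; apply: le_trans (ler_normD _ _).
by rewrite addrA subrK.
Qed.

(** Two applications of the mean value theorem to the second difference. Its symmetry in [v] and [w]
    is what makes mixed derivatives comparable. *)
Lemma double_MVT v w g z (d : R) :
  (forall y, vabs1 (y - z) < d -> [/\ rdderivable v g y & rdderivable w (rdir v g) y]) ->
  forall t, 0 <= t -> t * (vabs1 v + vabs1 w) < d ->
  exists2 p, vabs1 (p - z) <= t * (vabs1 v + vabs1 w) &
    g (z + t%:C *: v + t%:C *: w) - g (z + t%:C *: v) - (g (z + t%:C *: w) - g z)
    = t * (t * rdir w (rdir v g) p).
Proof.
move=> dg t t0 td.
have small s s' : `|s| <= `|t| -> `|s'| <= `|t| ->
    vabs1 (z + s%:C *: v + s'%:C *: w - z) <= t * (vabs1 v + vabs1 w).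
  rewrite (ger0_norm t0) => st s't; rewrite addrC addrA addKr.
  apply: le_trans (vabs1D _ _) _; rewrite !vabs1Z mulrDr.
  by apply: lerD; apply: ler_wpM2r => //; apply: vabs1_ge0.
have small' s : `|s| <= `|t| -> vabs1 (z + s%:C *: v - z) < d.
  move=> st; apply: le_lt_trans td.
  have := small s 0 st; rewrite normr0 => /(_ (normr_ge0 _)).
  by rewrite scale0r addr0.
pose phi y := g (y + t%:C *: w) - g y.
have dphi y : vabs1 (y - z) < d -> vabs1 (y + t%:C *: w - z) < d ->
    is_derive (0 : R) 1 (fun s => phi (y + s%:C *: v))
      (rdir v g (y + t%:C *: w) - rdir v g y).
  move=> /dg [/rdirP d1 _] /dg [/rdirP d2 _].
  have -> : (fun s => phi (y + s%:C *: v)) = (fun s =>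
      g (y + t%:C *: w + s%:C *: v) + - g (y + s%:C *: v)).
    by apply/funext => s; rewrite /phi addrAC.
  exact: is_derive_addf d2 (is_derive_oppf d1).
have near_s s : `|s| <= `|t| -> is_derive (0 : R) 1
      (fun s' => phi (z + s%:C *: v + s'%:C *: v))
      (rdir v g (z + s%:C *: v + t%:C *: w) - rdir v g (z + s%:C *: v)).
  move=> st; apply: dphi; first exact: small'.
  exact: le_lt_trans (small _ _ st (lexx _)) td.
have [s st E] := @rdir_MVT v phi z t (fun s st => @ex_derive _ _ _ _ _ _ _ (near_s s st)).
have [s' s't E'] := @rdir_MVT w (rdir v g) (z + s%:C *: v) t
  (fun s' s't => (dg _ (le_lt_trans (small _ _ st s't) td)).2).
exists (z + s%:C *: v + s'%:C *: w); first exact: small.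
move: E; rewrite /phi => ->; congr (_ * _); rewrite -E'.
exact: (@derive_val _ _ _ _ _ _ _ (near_s s st)).
Qed.

(** Schwarz's theorem: the symmetric second difference equates the two mixed derivatives at points
    [p] and [q] arbitrarily close to [z], and their continuity at [z] excludes different limits. *)
Lemma rdir_comm v w g z (d : R) : 0 < d ->
  (forall y, vabs1 (y - z) < d ->
    [/\ rdderivable v g y, rdderivable w g y, rdderivable w (rdir v g) y &
        rdderivable v (rdir w g) y]) ->
  (forall e : R, 0 < e -> exists2 d : R, 0 < d & forall y, vabs1 (y - z) < d ->
     `|rdir w (rdir v g) y - rdir w (rdir v g) z| < e) ->
  (forall e : R, 0 < e -> exists2 d : R, 0 < d & forall y, vabs1 (y - z) < d ->
     `|rdir v (rdir w g) y - rdir v (rdir w g) z| < e) ->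
  rdir w (rdir v g) z = rdir v (rdir w g) z.
Proof.
move=> d0 dg c1 c2; apply/eqP; rewrite -subr_eq0 -normr_le0 leNgt.
set a := rdir w (rdir v g) z; set b := rdir v (rdir w g) z.
apply/negP => ab0.
have [d1 d10 h1] := c1 _ (divr_gt0 ab0 (ltr0n _ 2)).
have [d2 d20 h2] := c2 _ (divr_gt0 ab0 (ltr0n _ 2)).
pose M := vabs1 v + vabs1 w.
have M0 : 0 <= M by rewrite addr_ge0// vabs1_ge0.
pose D := Num.min d (Num.min d1 d2).
have D0 : 0 < D by rewrite !lt_min d0 d10.
have M1 : 0 < M + 1 by rewrite ltr_wpDl.
pose t := D / (M + 1).
have t0 : 0 < t by rewrite divr_gt0.
have tM : t * M < D.
  by rewrite -mulrA mulrC -[ltRHS]mul1r ltr_pM2r// mulrC ltr_pdivrMr// mul1r ltrDl.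
have [td td12] : t * M < d /\ t * M < Num.min d1 d2.
  by move: tM; rewrite lt_min => /andP[].
have [td1 td2] : t * M < d1 /\ t * M < d2 by move: td12; rewrite lt_min => /andP[].
have [p pz Ep] := @double_MVT v w g z d
  (fun y yd => let: And4 a _ c _ := dg y yd in conj a c) t (ltW t0) td.
have [q qz Eq] := @double_MVT w v g z d
  (fun y yd => let: And4 _ a _ c := dg y yd in conj a c) t (ltW t0)
  (eq_ind _ (fun x => t * x < d) td _ (addrC _ _)).
have tn0 : t != 0 by rewrite gt_eqF.
have Epq : rdir w (rdir v g) p = rdir v (rdir w g) q.
  apply: (mulfI tn0); apply: (mulfI tn0).
  apply: etrans (esym Ep) _; apply: etrans _ Eq.
  move: (t%:C *: v) (t%:C *: w) => a' b'.
  rewrite (addrAC z b' a').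
  by move: (g _) (g _) (g _) (g _) => x1 x2 x3 x4; ring.
have := h1 p (le_lt_trans pz td1); have := h2 q _.
rewrite [vabs1 w + _]addrC in qz; move/(_ (le_lt_trans qz td2)).
by rewrite -Epq => H2 H1; exact: half_dist_absurd H1 H2.
Qed.

End DirectionalDerivative.

(** * Closure properties of functions of class C^k *)

Section Smoothness.
Context {R : realType} {m : nat}.
Local Notation C := R[i].
Local Notation V := 'rV[C]_m.
Implicit Types (U : set V) (f g : V -> C) (v w z : V) (k : nat).

Definition is_ddir v f z l : Prop := is_cderive (fun t => f (z + t%:C *: v)) l.

Lemma is_ddirP v f z : dderivable v f z -> is_ddir v f z (ddir v f z).
Proof. exact: is_cderiveP. Qed.

Lemma is_ddir_derivable v f z l : is_ddir v f z l -> dderivable v f z.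
Proof. exact: is_cderive_derivable. Qed.

Lemma is_ddir_val v f z l : is_ddir v f z l -> ddir v f z = l.
Proof. exact: is_cderive_val. Qed.

Lemma base_point v z : z + (0 : R)%:C *: v = z.
Proof. by rewrite scale0r addr0. Qed.

Lemma is_ddir_cst v (c : C) z : is_ddir v (fun=> c) z 0.
Proof. exact: is_cderive_cst. Qed.

Lemma is_ddirD v f g z a b : is_ddir v f z a -> is_ddir v g z b ->
  is_ddir v (fun y => f y + g y) z (a + b).
Proof. exact: is_cderiveD. Qed.

Lemma is_ddirM v f g z a b : is_ddir v f z a -> is_ddir v g z b ->
  is_ddir v (fun y => f y * g y) z (a * g z + f z * b).
Proof.
by move=> df dg; have := is_cderiveM df dg; rewrite !base_point.
Qed.

Lemma is_ddir_conj v f z a : is_ddir v f z a ->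
  is_ddir v (fun y => (f y)^*) z (a^*).
Proof. exact: is_cderive_conj. Qed.

Lemma is_ddirV v f z a : f z != 0 -> is_ddir v f z a ->
  is_ddir v (fun y => (f y)^-1) z (- (a / f z ^+ 2)).
Proof.
move=> fz df; have := @is_cderiveV _ (fun t => f (z + t%:C *: v)) a.
by rewrite !base_point; apply.
Qed.

Lemma is_ddir_sqrt v (r : V -> R) z a : 0 < r z ->
  is_ddir v (fun y => (r y)%:C) z a ->
  is_ddir v (fun y => (Num.sqrt (r y))%:C) z (a / (2 * (Num.sqrt (r z))%:C)).
Proof.
move=> rz dr; have := @is_cderive_sqrt _ (fun t => r (z + t%:C *: v)) a.
by rewrite !base_point; apply.
Qed.

Lemma is_ddir_coord v z j : is_ddir v (fun y => y 0 j) z (v 0 j).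
Proof.
rewrite /is_ddir; under eq_fun do rewrite !mxE.
have := is_cderiveD (is_cderive_cst (z 0 j))
  (is_cderiveM (_ : is_cderive (fun t : R => t%:C) 1) (is_cderive_cst (v 0 j))).
rewrite mul1r add0r mulr0 addr0; apply.
by split; [exact: is_derive_id|exact: is_derive_cst].
Qed.

Lemma open_line U v z : open U -> U z -> \forall t \near (0 : R), U (z + t%:C *: v).
Proof.
move=> /open_vabs1P oU /oU [e e0 he].
have v1 : 0 < vabs1 v + 1 by rewrite ltr_wpDl// vabs1_ge0.
apply/nbhs_ballP; exists (e / (vabs1 v + 1)); first by rewrite /= divr_gt0.
move=> t; rewrite /ball /= sub0r normrN ltr_pdivlMr// mulrDr mulr1 => te.
apply: he; rewrite addrC addKr vabs1Z.
by apply: le_lt_trans te; rewrite lerDl.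
Qed.

Lemma is_ddir_near U v f g z l : open U -> U z -> (forall y, U y -> f y = g y) ->
  is_ddir v f z l -> is_ddir v g z l.
Proof.
move=> oU Uz fg [d1 d2]; have near := open_line v oU Uz.
by split; [apply: near_eq_is_derive d1|apply: near_eq_is_derive d2];
  apply: filterS near => t /fg ->.
Qed.

Lemma ddir_near U v f g z : open U -> U z -> (forall y, U y -> f y = g y) ->
  dderivable v f z -> ddir v f z = ddir v g z.
Proof.
move=> oU Uz fg /is_ddirP df; apply/esym/is_ddir_val.
exact: is_ddir_near oU Uz fg df.
Qed.

Lemma continuous_near U f g z : open U -> U z -> (forall y, U y -> f y = g y) ->
  {for z, continuous f} -> {for z, continuous g}.
Proof.
move=> /open_vabs1P oU Uz fg /continuous_vabs1P cf; apply/continuous_vabs1P => e e0.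
have [d1 d10 h1] := oU z Uz; have [d2 d20 h2] := cf e e0.
exists (Num.min d1 d2); first by rewrite lt_min d10.
move=> w; rewrite lt_min => /andP[w1 w2].
by rewrite -!fg//; [exact: h2|exact: h1].
Qed.

Lemma Ck_cont k U f z : Ck_on k U f -> U z -> {for z, continuous f}.
Proof. by case: k => [|k] [cf _] Uz; exact: cf. Qed.

Lemma Ck_der k U f v z : Ck_on k.+1 U f -> U z -> dderivable v f z.
Proof. by move=> [_ H] Uz; apply: (H v).1. Qed.

Lemma Ck_ddir k U f v : Ck_on k.+1 U f -> Ck_on k U (ddir v f).
Proof. by move=> [_ H]; apply: (H v).2. Qed.

Lemma Ck_S k U f : Ck_on k.+1 U f -> Ck_on k U f.
Proof.
elim: k f => [|k IH] f; first by move=> [cf _]; split.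
move=> [cf H]; split => // v; split; first exact: (H v).1.
by apply: IH; apply: (H v).2.
Qed.

Lemma Ck_le k l U f : (l <= k)%N -> Ck_on k U f -> Ck_on l U f.
Proof.
move=> /subnKC <-; elim: (k - l)%N => [|j IH]; first by rewrite addn0.
by rewrite addnS => /Ck_S/IH.
Qed.

Lemma Ck_sub k U U' f : U' `<=` U -> Ck_on k U f -> Ck_on k U' f.
Proof.
move=> sU; elim: k f => [|k IH] f [cf H].
  by split => // z /sU; apply: cf.
split; first by move=> z /sU; apply: cf.
move=> v; split; first by move=> z /sU; apply: (H v).1.
by apply: IH; apply: (H v).2.
Qed.

Lemma Ck_local k U f :
  (forall z, U z -> exists2 U', U' z & Ck_on k U' f) -> Ck_on k U f.
Proof.
elim: k f => [|k IH] f H.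
  by split => // z /H [U' U'z] Hf; exact: Ck_cont Hf U'z.
split; first by move=> z /H [U' U'z] Hf; exact: Ck_cont Hf U'z.
move=> v; split; first by move=> z /H [U' U'z] Hf; exact: Ck_der Hf U'z.
by apply: IH => z /H [U' U'z Hf]; exists U' => //; apply: Ck_ddir.
Qed.

Lemma Ck_ext k U f g : open U -> (forall z, U z -> f z = g z) ->
  Ck_on k U f -> Ck_on k U g.
Proof.
move=> oU; elim: k f g => [|k IH] f g fg [cf H].
  split; last by [].
  by move=> z Uz; exact: (@continuous_near U f g z oU Uz fg (cf z Uz)).
split; first by move=> z Uz; exact: (@continuous_near U f g z oU Uz fg (cf z Uz)).
move=> v; split.
  move=> z Uz; have := is_ddir_near oU Uz fg (is_ddirP ((H v).1 z Uz)).
  exact: is_ddir_derivable.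
apply: IH (H v).2 => z Uz.
exact: (ddir_near oU Uz fg ((H v).1 z Uz)).
Qed.

Lemma Ck_cst k U (c : C) : Ck_on k U (fun=> c).
Proof.
elim: k c => [|k IH] c; first by split; [move=> z _; exact: cst_continuous|].
split; first by move=> z _; exact: cst_continuous.
move=> v; split; first by move=> z _; exact: (is_ddir_derivable (is_ddir_cst v c z)).
have -> : ddir v (fun=> c) = fun=> 0 by apply/funext => z; apply: is_ddir_val; exact: is_ddir_cst.
exact: IH.
Qed.

Lemma Ck_coord k U j : Ck_on k U (fun z => z 0 j).
Proof.
have cj z : {for z, continuous (fun z : V => z 0 j)}.
  apply/continuous_vabs1P => e e0; exists e => // w wz.
  by apply: le_lt_trans wz; have := abs1_coord (w - z) j; rewrite !mxE.
case: k => [|k]; first by split.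
split; [by move=> z _; exact: cj|move=> v; split].
  by move=> z _; exact: (is_ddir_derivable (is_ddir_coord v z j)).
have -> : ddir v (fun z => z 0 j) = fun=> v 0 j.
  by apply/funext => z; apply: is_ddir_val; exact: is_ddir_coord.
exact: Ck_cst.
Qed.

(** A formula for the derivatives valid on the open set [U] is enough, since [Ck_ext] disregards
    values outside [U]; the closure properties below supply such formulas. *)
Lemma Ck_step k U f (F : V -> V -> C) : open U ->
  (forall z, U z -> {for z, continuous f}) ->
  (forall v z, U z -> is_ddir v f z (F v z)) ->
  (forall v, Ck_on k U (F v)) -> Ck_on k.+1 U f.
Proof.
move=> oU cf df dF; split; [by move=> z Uz; exact: cf|move=> v; split].
  by move=> z Uz; exact: (is_ddir_derivable (df v z Uz)).
by apply: Ck_ext oU _ (dF v) => z Uz; rewrite (is_ddir_val (df v z Uz)).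
Qed.

Lemma continuous_addf f g z : {for z, continuous f} -> {for z, continuous g} ->
  {for z, continuous (fun y => f y + g y)}.
Proof. exact: continuousD. Qed.

Lemma CkD k U f g : open U -> Ck_on k U f -> Ck_on k U g ->
  Ck_on k U (fun z => f z + g z).
Proof.
move=> oU; elim: k f g => [|k IH] f g Hf Hg.
  by split; [move=> z Uz; apply: continuous_addf; [apply: Hf.1|apply: Hg.1]|].
apply: (Ck_step (F := fun v z => ddir v f z + ddir v g z)) => //.
- by move=> z Uz; apply: continuous_addf; [exact: (Ck_cont Hf Uz)|exact: (Ck_cont Hg Uz)].
- by move=> v z Uz; apply: is_ddirD; apply: is_ddirP; [exact: (Ck_der _ Hf Uz)|exact: (Ck_der _ Hg Uz)].
- by move=> v; apply: IH; apply: Ck_ddir.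
Qed.

Lemma continuous_mulf f g z : {for z, continuous f} -> {for z, continuous g} ->
  {for z, continuous (fun y => f y * g y)}.
Proof. exact: continuousM. Qed.

Lemma CkM k U f g : open U -> Ck_on k U f -> Ck_on k U g ->
  Ck_on k U (fun z => f z * g z).
Proof.
move=> oU; elim: k f g => [|k IH] f g Hf Hg.
  by split; [move=> z Uz; apply: continuous_mulf; [apply: Hf.1|apply: Hg.1]|].
apply: (Ck_step (F := fun v z => ddir v f z * g z + f z * ddir v g z)) => //.
- by move=> z Uz; apply: continuous_mulf; [exact: (Ck_cont Hf Uz)|exact: (Ck_cont Hg Uz)].
- by move=> v z Uz; apply: is_ddirM; apply: is_ddirP; [exact: (Ck_der _ Hf Uz)|exact: (Ck_der _ Hg Uz)].
- by move=> v; apply: CkD => //; apply: IH; by [apply: Ck_ddir|apply: Ck_S].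
Qed.

Lemma Ck_conj k U f : open U -> Ck_on k U f -> Ck_on k U (fun z => (f z)^*).
Proof.
move=> oU.
have cc g z : {for z, continuous g} -> {for z, continuous (fun y => (g y)^*)}.
  move=> /continuous_vabs1P cg; apply/continuous_vabs1P => e /cg [d d0 hd].
  exists d => // w /hd; rewrite -rmorphB.
  by case: (g w - g z) => x y; rewrite /abs1 /= normrN.
elim: k f => [|k IH] f Hf; first by split; [move=> z Uz; apply: cc; apply: Hf.1|].
apply: (Ck_step (F := fun v z => (ddir v f z)^*)) => //.
- by move=> z Uz; apply: cc; exact: (Ck_cont Hf Uz).
- by move=> v z Uz; apply: is_ddir_conj; apply: is_ddirP; exact: (Ck_der _ Hf Uz).
- by move=> v; apply: IH; apply: Ck_ddir.
Qed.

Lemma CkN k U f : open U -> Ck_on k U f -> Ck_on k U (fun z => - f z).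
Proof.
move=> oU Hf; under eq_fun do rewrite -mulN1r.
by apply: CkM => //; exact: Ck_cst.
Qed.

Lemma CkV k U f : open U -> (forall z, U z -> f z != 0) -> Ck_on k U f ->
  Ck_on k U (fun z => (f z)^-1).
Proof.
move=> oU f0.
have cV z : U z -> {for z, continuous f} -> {for z, continuous (fun y => (f y)^-1)}.
  by move=> /f0 fz cf; exact: continuousV.
elim: k => [|k IH] Hf; first by split; [move=> z Uz; apply: (cV z Uz); apply: Hf.1|].
apply: (Ck_step (F := fun v z => - (ddir v f z * ((f z)^-1 * (f z)^-1)))) => //.
- by move=> z Uz; apply: (cV z Uz); exact: (Ck_cont Hf Uz).
- move=> v z Uz; rewrite -invfM -expr2.
  by apply: is_ddirV; [exact: f0|apply: is_ddirP; exact: (Ck_der _ Hf Uz)].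
- move=> v; apply: CkN => //; apply: CkM => //; first exact: Ck_ddir.
  by apply: CkM => //; apply: IH; apply: Ck_S.
Qed.

Lemma Ck_sqrt k U (r : V -> R) : open U -> (forall z, U z -> 0 < r z) ->
  Ck_on k U (fun z => (r z)%:C) -> Ck_on k U (fun z => (Num.sqrt (r z))%:C).
Proof.
move=> oU r0.
have sn0 z : U z -> 2 * (Num.sqrt (r z))%:C != 0 :> C.
  move=> Uz; rewrite mulf_neq0 ?pnatr_eq0//.
  by rewrite -[0]/(0%:C) (inj_eq (@complexI _)) gt_eqF// sqrtr_gt0 r0.
have cs z : U z -> {for z, continuous (fun y => (r y)%:C : C)} ->
    {for z, continuous (fun y => (Num.sqrt (r y))%:C : C)}.
  move=> Uz /continuous_vabs1P cr; apply/continuous_vabs1P => e e0.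
  have : nbhs (r z) [set x | `|Num.sqrt (r z) - Num.sqrt x| < e].
    by have /cvgrPdist_lt /(_ e e0) := @sqrt_continuous R (r z).
  move=> /nbhs_ballP [e' /= e'0 he'].
  have [d d0 hd] := cr e' e'0; exists d => // w /hd.
  rewrite -!rmorphB !abs1_real => H; rewrite distrC; apply: he'.
  by rewrite /ball /= distrC.
elim: k => [|k IH] Hf; first by split; [move=> z Uz; apply: (cs z Uz); apply: Hf.1|].
apply: (Ck_step (F := fun v z => ddir v (fun z => (r z)%:C) z * (2 * (Num.sqrt (r z))%:C)^-1)) => //.
- by move=> z Uz; apply: (cs z Uz); exact: (Ck_cont Hf Uz).
- by move=> v z Uz; apply: is_ddir_sqrt; [exact: r0|apply: is_ddirP; exact: (Ck_der _ Hf Uz)].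
- move=> v; apply: CkM => //; first exact: Ck_ddir.
  apply: CkV => //; apply: CkM => //; first exact: Ck_cst.
  by apply: IH; apply: Ck_S.
Qed.

End Smoothness.

Section Conjugation.
Context {R : realType}.
Implicit Types a b : R[i].

Lemma conjCM a b : (a * b)^* = a^* * b^*.
Proof. exact: rmorphM. Qed.

Lemma conjCD a b : (a + b)^* = a^* + b^*.
Proof. exact: rmorphD. Qed.

Lemma conjCN a : (- a)^* = - a^*.
Proof. exact: rmorphN. Qed.

Lemma conjCB a b : (a - b)^* = a^* - b^*.
Proof. exact: rmorphB. Qed.

Lemma conjC_sum (I : Type) (r : seq I) (P : pred I) (F : I -> R[i]) :
  (\sum_(i <- r | P i) F i)^* = \sum_(i <- r | P i) (F i)^*.
Proof. exact: rmorph_sum. Qed.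

Lemma conjC_half : (2^-1 : R[i])^* = 2^-1.
Proof. by rewrite conjc_inv conjc_nat. Qed.

(* A copy of ['i] that can be made opaque, to keep conversion fast. *)
Definition ii : R[i] := 0 +i* 1.

Lemma iiM : ii * ii = -1.
Proof. by rewrite -expr2 sqr_i. Qed.

Lemma conjC_ii : ii^* = - ii.
Proof. by apply/eqP; rewrite eq_complex /= oppr0 !eqxx. Qed.

Lemma ii_neq0 : ii != 0.
Proof. by rewrite eq_complex /= oner_eq0 andbF. Qed.

End Conjugation.

Arguments ii {R}.

Section Chain.
Context {R : realType} {m : nat}.
Local Notation C := R[i].
Local Notation V := 'rV[C]_m.
Implicit Types (U : set V) (f g : V -> C) (v w z : V) (k : 'I_m).

Lemma abs1_ReB (a b : C) : `|complex.Re a - complex.Re b| <= abs1 (a - b).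
Proof. by case: a b => [? ?] [? ?]; rewrite /abs1 /= lerDl. Qed.

Lemma abs1_ImB (a b : C) : `|complex.Im a - complex.Im b| <= abs1 (a - b).
Proof. by case: a b => [? ?] [? ?]; rewrite /abs1 /= lerDr. Qed.

Definition unit_dir (s : 'I_m + 'I_m) : V :=
  match s with inl k => delta_mx 0 k | inr k => 'i *: delta_mx 0 k end.

Lemma decompose_dirs v :
  \sum_s (match s with inl k => complex.Re (v 0 k) | inr k => complex.Im (v 0 k) end)%:C
    *: unit_dir s = v.
Proof.
rewrite big_sumType /= -big_split /= [RHS]row_sum_delta; apply: eq_bigr => k _.
by rewrite scalerA -scalerDl [in RHS](complexE (v 0 k)) ['i * _]mulrC.
Qed.

Lemma Ck1_rC1 U f z v : open U -> Ck_on 1 U f -> U z ->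
  rC1 v (fun y => complex.Re (f y)) z /\ rC1 v (fun y => complex.Im (f y)) z.
Proof.
move=> /open_vabs1P oU Hf Uz.
have [d1 d10 h1] := oU z Uz.
have cf := (continuous_vabs1P _ _).1 (Ck_cont (Ck_ddir v Hf) Uz).
have H e : 0 < e -> exists2 d : R, 0 < d & forall w, vabs1 (w - z) < d ->
    dderivable v f w /\ abs1 (ddir v f w - ddir v f z) < e.
  move=> /cf [d2 d20 h2]; exists (Num.min d1 d2); first by rewrite lt_min d10.
  move=> w; rewrite lt_min => /andP[/h1 Uw /h2 wd]; split => //.
  exact: (Ck_der _ Hf Uw).
split=> e /H [d d0 hd]; (exists d; [exact: d0|move=> w /hd [[D1 D2]] H1; split]).
- exact: D1.
- exact: le_lt_trans (abs1_ReB _ _) H1.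
- exact: D2.
- exact: le_lt_trans (abs1_ImB _ _) H1.
Qed.

(** The real chain rule in the real basis [unit_dir], for real and imaginary parts separately.
    Regrouping the differential into its C-linear and C-antilinear parts produces [dz] and [dzb]. *)
Lemma curve_chain U f z (c : R -> V) (l : 'I_m -> C) :
  open U -> Ck_on 1 U f -> U z -> c 0 = z ->
  (forall k, is_cderive (fun t => c t 0 k) (l k)) ->
  is_cderive (fun t => f (c t)) (\sum_k (dz k f z * l k + dzb k f z * (l k)^*)).
Proof.
move=> oU Hf Uz c0 dc.
pose s (j : 'I_m + 'I_m) (t : R) := match j with
  inl k => complex.Re (c t 0 k) - complex.Re (z 0 k)
  | inr k => complex.Im (c t 0 k) - complex.Im (z 0 k) end.
pose ls (j : 'I_m + 'I_m) := match j with
  inl k => complex.Re (l k) | inr k => complex.Im (l k) end.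
have s0 j : s j 0 = 0 by case: j => k; rewrite /= c0 subrr.
have ds j : is_derive (0 : R) 1 (s j) (ls j).
  case: j => k; rewrite -[ls _]addr0.
    exact: (is_derive_addf (dc k).1 (is_derive_cst _ _ _)).
  exact: (is_derive_addf (dc k).2 (is_derive_cst _ _ _)).
have cE t : c t = z + \sum_j (s j t)%:C *: unit_dir j.
  rewrite -[in LHS](subrK z (c t)) addrC; congr (_ + _).
  rewrite -[LHS]decompose_dirs; apply: eq_bigr => j _; congr (_ %:C *: _).
  by case: j => k /=; rewrite !mxE; case: (c t 0 k) (z 0 k) => [? ?] [].
have -> : \sum_k (dz k f z * l k + dzb k f z * (l k)^*) =
    (\sum_j ls j * rdir (unit_dir j) (fun y => complex.Re (f y)) z) +i*
    (\sum_j ls j * rdir (unit_dir j) (fun y => complex.Im (f y)) z).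
  have -> : forall a b : R, a +i* b = a%:C + 'i * b%:C.
    by move=> a b; rewrite [LHS]complexE.
  rewrite !rmorph_sum /= mulr_sumr -big_split /= big_sumType /= -big_split /=.
  apply: eq_bigr => k _.
  have [-> ->] : dz k f z = 2^-1 *
      ((rdir (delta_mx 0 k) (fun y => complex.Re (f y)) z +i*
        rdir (delta_mx 0 k) (fun y => complex.Im (f y)) z) - 'i *
       (rdir ('i *: delta_mx 0 k) (fun y => complex.Re (f y)) z +i*
        rdir ('i *: delta_mx 0 k) (fun y => complex.Im (f y)) z)) /\
    dzb k f z = 2^-1 *
      ((rdir (delta_mx 0 k) (fun y => complex.Re (f y)) z +i*
        rdir (delta_mx 0 k) (fun y => complex.Im (f y)) z) + 'i *
       (rdir ('i *: delta_mx 0 k) (fun y => complex.Re (f y)) z +i*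
        rdir ('i *: delta_mx 0 k) (fun y => complex.Im (f y)) z)) by [].
  rewrite /=; move: (rdir _ _ _) (rdir _ _ _) (rdir _ _ _) (rdir _ _ _) => A B A' B'.
  case: (l k) => x y /=; apply/eqP; rewrite eq_complex /=; apply/andP.
  by split; apply/eqP; field.
have [cR cI] : (forall j, rC1 (unit_dir j) (fun y => complex.Re (f y)) z) /\
    (forall j, rC1 (unit_dir j) (fun y => complex.Im (f y)) z).
  by split => j; have [] := Ck1_rC1 (unit_dir j) oU Hf Uz.
split => /=; under eq_fun do rewrite cE.
  exact: (rdir_chain cR s0 ds).
exact: (rdir_chain cI s0 ds).
Qed.

Lemma ddirE U f z v : open U -> Ck_on 1 U f -> U z ->
  ddir v f z = \sum_k (dz k f z * v 0 k + dzb k f z * (v 0 k)^*).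
Proof.
move=> oU Hf Uz; apply: is_cderive_val.
apply: (@curve_chain U f z (fun t => z + t%:C *: v)) => // [|k].
  exact: base_point.
exact: (is_ddir_coord v z k).
Qed.

Lemma ddirC U f z v w : open U -> Ck_on 2 U f -> U z ->
  ddir v (ddir w f) z = ddir w (ddir v f) z.
Proof.
move=> oU Hf Uz.
have [d d0 hd] := (open_vabs1P _).1 oU z Uz.
have Hv := Ck_ddir v Hf; have Hw := Ck_ddir w Hf.
have c1 := (continuous_vabs1P _ _).1 (Ck_cont (Ck_ddir v Hw) Uz).
have c2 := (continuous_vabs1P _ _).1 (Ck_cont (Ck_ddir w Hv) Uz).
have D y : vabs1 (y - z) < d -> [/\ dderivable w f y, dderivable v f y,
    dderivable v (ddir w f) y & dderivable w (ddir v f) y].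
  by move=> /hd Uy; split; [exact: (Ck_der _ Hf Uy)|exact: (Ck_der _ Hf Uy)|
    exact: (Ck_der _ Hw Uy)|exact: (Ck_der _ Hv Uy)].
have E1 : complex.Re (ddir v (ddir w f) z) = complex.Re (ddir w (ddir v f) z).
  apply: (@rdir_comm _ _ w v (fun y => complex.Re (f y)) z d d0).
  - by move=> y /D [[d1 _] [d2 _] [d3 _] [d4 _]]; exact: And4 d1 d2 d3 d4.
  - move=> e /c1 [d' d'0 h]; exists d'; [exact: d'0|move=> y /h].
    exact: le_lt_trans (abs1_ReB _ _).
  - move=> e /c2 [d' d'0 h]; exists d'; [exact: d'0|move=> y /h].
    exact: le_lt_trans (abs1_ReB _ _).
have E2 : complex.Im (ddir v (ddir w f) z) = complex.Im (ddir w (ddir v f) z).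
  apply: (@rdir_comm _ _ w v (fun y => complex.Im (f y)) z d d0).
  - by move=> y /D [[_ d1] [_ d2] [_ d3] [_ d4]]; exact: And4 d1 d2 d3 d4.
  - move=> e /c1 [d' d'0 h]; exists d'; [exact: d'0|move=> y /h].
    exact: le_lt_trans (abs1_ImB _ _).
  - move=> e /c2 [d' d'0 h]; exists d'; [exact: d'0|move=> y /h].
    exact: le_lt_trans (abs1_ImB _ _).
by move: E1 E2; case: (ddir v _ z) (ddir w _ z) => [? ?] [? ?] /= -> ->.
Qed.

End Chain.

Section Composition.
Context {R : realType} {m p : nat}.
Local Notation C := R[i].
Implicit Types (f : 'rV[C]_m -> C) (g : 'rV[C]_p -> 'rV[C]_m).

Lemma is_ddir_comp U f g z v : open U -> Ck_on 1 U f -> U (g z) ->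
  (forall k, dderivable v (fun y => g y 0 k) z) ->
  is_ddir v (fun y => f (g y)) z
    (\sum_k (dz k f (g z) * ddir v (fun y => g y 0 k) z +
             dzb k f (g z) * (ddir v (fun y => g y 0 k) z)^*)).
Proof.
move=> oU Hf Ugz dg.
apply: (@curve_chain _ _ U f (g z) (fun t => g (z + t%:C *: v))) => // [|k].
  by rewrite base_point.
exact: (is_ddirP (dg k)).
Qed.

Lemma continuous_comp_coord f g z : {for g z, continuous f} ->
  (forall k, {for z, continuous (fun y => g y 0 k)}) ->
  {for z, continuous (fun y => f (g y))}.
Proof.
move=> cf cg A /cf [P Pz sP].
have : \forall y \near z, forall k, P 0 k (g y 0 k).
  apply: (@filter_forall _ _ (fun k y => P 0 k (g y 0 k)) (nbhs z) (nbhs_filter z)) => k.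
  by apply: cg; exact: Pz.
apply: (@filterS _ (nbhs z) (nbhs_filter z)) => y Py; apply: sP => i k.
by rewrite ord1.
Qed.

End Composition.

(** * Rules for the Wirtinger derivatives *)

Section Wirtinger.
Context {R : realType} {m : nat}.
Local Notation C := R[i].
Local Notation V := 'rV[C]_m.
Implicit Types (U : set V) (f g : V -> C) (v w z : V) (k : 'I_m) (c : C).

(* [c = - 'i] gives d/dz^k and [c = 'i] gives d/d(conj z^k). *)
Definition wirt c k f z : C :=
  2^-1 * (ddir (delta_mx 0 k) f z + c * ddir (ii *: delta_mx 0 k) f z).

Lemma dzE k f z : dz k f z = wirt (- ii) k f z.
Proof. by rewrite /wirt mulNr. Qed.

Lemma dzbE k f z : dzb k f z = wirt ii k f z.
Proof. by []. Qed.

#[local] Opaque ddir ii.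

Definition dd f z : Prop := forall v, dderivable v f z.

Lemma Ck_dd (l : nat) U f z : Ck_on l.+1 U f -> U z -> dd f z.
Proof. by move=> Hf Uz v; exact: (Ck_der _ Hf Uz). Qed.

Lemma Ck_wirt c n k U f : open U -> Ck_on n.+1 U f -> Ck_on n U (wirt c k f).
Proof.
move=> oU Hf; apply: CkM => //; first exact: Ck_cst.
apply: CkD => //; first exact: Ck_ddir.
by apply: CkM => //; [exact: Ck_cst|exact: Ck_ddir].
Qed.

Lemma wirt_near c k U f g z : open U -> U z -> (forall y, U y -> f y = g y) ->
  dd f z -> wirt c k f z = wirt c k g z.
Proof. by move=> oU Uz fg df; rewrite /wirt !(ddir_near oU Uz fg). Qed.

Lemma wirt_cst c k (a : C) z : wirt c k (fun=> a) z = 0.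
Proof. by rewrite /wirt !(is_ddir_val (is_ddir_cst _ _ _)) mulr0 addr0 mulr0. Qed.

Lemma wirtD c k f g z : dd f z -> dd g z ->
  wirt c k (fun y => f y + g y) z = wirt c k f z + wirt c k g z.
Proof.
move=> df dg; rewrite /wirt.
rewrite !(is_ddir_val (is_ddirD (is_ddirP (df _)) (is_ddirP (dg _)))).
move: (ddir _ _ _) (ddir _ _ _) (ddir _ _ _) (ddir _ _ _) => *; ring.
Qed.

Lemma wirtM c k f g z : dd f z -> dd g z ->
  wirt c k (fun y => f y * g y) z = wirt c k f z * g z + f z * wirt c k g z.
Proof.
move=> df dg; rewrite /wirt.
rewrite !(is_ddir_val (is_ddirM (is_ddirP (df _)) (is_ddirP (dg _)))).
move: (ddir _ _ _) (ddir _ _ _) (ddir _ _ _) (ddir _ _ _) => *; ring.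
Qed.

Lemma wirt_conj c k f z : dd f z ->
  wirt c k (fun y => (f y)^*) z = (wirt (c^*) k f z)^*.
Proof.
move=> df; rewrite /wirt.
rewrite !(is_ddir_val (is_ddir_conj (is_ddirP (df _)))).
move: (ddir _ _ _) (ddir _ _ _) => A B.
by rewrite [RHS]conjCM conjCD conjCM conjcK conjC_half.
Qed.

Lemma wirtV c k f z : f z != 0 -> dd f z ->
  wirt c k (fun y => (f y)^-1) z = - (wirt c k f z / f z ^+ 2).
Proof.
move=> fz df; rewrite /wirt.
rewrite !(is_ddir_val (is_ddirV fz (is_ddirP (df _)))).
move: (ddir _ _ _) (ddir _ _ _) (_ ^-1) => *; ring.
Qed.

Lemma wirt_coord c k j z :
  wirt c k (fun y => y 0 j) z = 2^-1 * (1 + c * ii) * (k == j)%:R.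
Proof.
rewrite /wirt !(is_ddir_val (is_ddir_coord _ _ _)) !mxE eqxx eq_sym /=.
by rewrite mulrA -[X in _ * (X + _)]mul1r -mulrDl mulrA.
Qed.

(** Since [wirt] is a combination of two real directional derivatives with a free constant, one use
    of Schwarz's theorem covers holomorphic, antiholomorphic and mixed pairs. *)
Lemma wirtC c k c' k' U f z : open U -> Ck_on 2 U f -> U z ->
  wirt c k (wirt c' k' f) z = wirt c' k' (wirt c k f) z.
Proof.
move=> oU Hf Uz.
have E v c1 k1 : ddir v (wirt c1 k1 f) z =
    2^-1 * (ddir v (ddir (delta_mx 0 k1) f) z +
            c1 * ddir v (ddir (ii *: delta_mx 0 k1) f) z).
  have d w : is_ddir v (ddir w f) z (ddir v (ddir w f) z).
    by apply: is_ddirP; exact: (Ck_der _ (Ck_ddir w Hf) Uz).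
  rewrite (is_ddir_val (is_ddirM (is_ddir_cst v 2^-1 z)
    (is_ddirD (d _) (is_ddirM (is_ddir_cst v c1 z) (d _))))).
  by rewrite !mul0r !add0r.
have W c1 k1 c2 k2 : wirt c1 k1 (wirt c2 k2 f) z = 2^-1 *
    (2^-1 * (ddir (delta_mx 0 k1) (ddir (delta_mx 0 k2) f) z +
        c2 * ddir (delta_mx 0 k1) (ddir (ii *: delta_mx 0 k2) f) z) +
     c1 * (2^-1 * (ddir (ii *: delta_mx 0 k1) (ddir (delta_mx 0 k2) f) z +
        c2 * ddir (ii *: delta_mx 0 k1) (ddir (ii *: delta_mx 0 k2) f) z))).
  exact: (congr2 (fun a b => 2^-1 * (a + c1 * b)) (E _ _ _) (E _ _ _)).
rewrite (W c k c' k') (W c' k' c k).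
move: (ii *: delta_mx 0 k) (ii *: delta_mx 0 k') => w w'.
move: (delta_mx 0 k) (delta_mx 0 k') => v v'.
rewrite (ddirC v v' oU Hf Uz) (ddirC v w' oU Hf Uz).
rewrite (ddirC w v' oU Hf Uz) (ddirC w w' oU Hf Uz).
move: (ddir _ _ _) (ddir _ _ _) (ddir _ _ _) (ddir _ _ _) => *; ring.
Qed.

End Wirtinger.

Section SmoothComposition.
Context {R : realType} {m p : nat}.
Local Notation C := R[i].
Implicit Types (f : 'rV[C]_m -> C) (g : 'rV[C]_p -> 'rV[C]_m).

Lemma Ck_sum k q (U : set 'rV[C]_q) (I : Type) (r : seq I) (F : I -> 'rV[C]_q -> C) : open U ->
  (forall i, Ck_on k U (F i)) -> Ck_on k U (fun y => \sum_(i <- r) F i y).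
Proof.
move=> oU HF; elim: r => [|i r IH].
  by under eq_fun do rewrite big_nil; exact: Ck_cst.
by under eq_fun do rewrite big_cons; exact: CkD.
Qed.

(** The derivative of the composite is built from [dz j f] and [dzb j f] composed with the same [g];
    the induction therefore varies [f] and fixes [g]. *)
Lemma Ck_comp k (U : set 'rV[C]_m) (U' : set 'rV[C]_p) f g :
  open U -> open U' -> (forall z, U' z -> U (g z)) ->
  Ck_on k U f -> (forall j, Ck_on k U' (fun y => g y 0 j)) ->
  Ck_on k U' (fun y => f (g y)).
Proof.
move=> oU oU' gU; elim: k f => [|k IH] f Hf Hg.
  split; last by [].
  move=> z Uz; apply: continuous_comp_coord; first exact: (Ck_cont Hf (gU z Uz)).
  by move=> j; exact: (Ck_cont (Hg j) Uz).
apply: (Ck_step (F := fun v z => \sum_j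
   (dz j f (g z) * ddir v (fun y => g y 0 j) z +
    dzb j f (g z) * (ddir v (fun y => g y 0 j) z)^*))) => //.
- move=> z Uz; apply: continuous_comp_coord; first exact: (Ck_cont Hf (gU z Uz)).
  by move=> j; exact: (Ck_cont (Hg j) Uz).
- move=> v z Uz; apply: is_ddir_comp oU _ (gU z Uz) _.
    by apply: Ck_le Hf.
  by move=> j; exact: (Ck_der _ (Hg j) Uz).
- have Hg' j : Ck_on k U' (fun y => g y 0 j) by apply: Ck_S.
  have Hd v j : Ck_on k U' (ddir v (fun y => g y 0 j)) by apply: Ck_ddir.
  move=> v; apply: Ck_sum => // j; apply: CkD => //; apply: CkM => //.
  + have -> : dz j f = wirt (- ii) j f by apply/funext => z; exact: dzE.
    by apply: IH => //; exact: Ck_wirt.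
  + by apply: IH => //; exact: (Ck_wirt ii j oU Hf).
  + exact: Ck_conj.
Qed.

End SmoothComposition.

#[local] Opaque ddir wirt ii.

(** * Calculus on the tangent bundle *)

Section Bundle.
Context {R : realType} {n : nat}.
Local Notation C := R[i].
Local Notation V := 'rV[C]_n.
Implicit Types (A : V -> set V) (f g : V -> V -> C) (z eta v : V).

Definition flat f : 'rV[C]_(n + n) -> C := fun p => f (lsubmx p) (rsubmx p).

(** Base derivatives ([lshift]) and fibre derivatives ([rshift]) are Wirtinger derivatives of one
    function on the flattened bundle; this makes them commute by [wirtC]. *)
Definition bwirt (c : C) (k : 'I_(n + n)) f : V -> V -> C :=
  fun z eta => wirt c k (flat f) (row_mx z eta).

Lemma flat_row f z eta : flat f (row_mx z eta) = f z eta.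
Proof. by rewrite /flat row_mxKl row_mxKr. Qed.

Lemma flat_bwirt c k f : flat (bwirt c k f) = wirt c k (flat f).
Proof. by apply/funext => p; rewrite /flat /bwirt hsubmxK. Qed.

Lemma row_deltal j : row_mx (delta_mx 0 j) 0 = delta_mx 0 (lshift n j) :> 'rV[C]_(n + n).
Proof.
apply/rowP => k; rewrite !mxE eqxx /=; case: splitP => i ki; rewrite !mxE.
  by rewrite eqxx -!val_eqE /= ki.
by rewrite -val_eqE /= ki; case: eqP => // E; move: (ltn_ord j); rewrite -E ltnNge leq_addr.
Qed.

Lemma row_deltar j : row_mx 0 (delta_mx 0 j) = delta_mx 0 (rshift n j) :> 'rV[C]_(n + n).
Proof.
apply/rowP => k; rewrite !mxE eqxx /=; case: splitP => i ki; rewrite !mxE.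
  by rewrite -val_eqE /= ki; case: eqP => // E; move: (ltn_ord i); rewrite E ltnNge leq_addr.
by rewrite eqxx -!val_eqE /= ki eqn_add2l.
Qed.

Lemma ddir_base f z eta v :
  ddir (row_mx v 0) (flat f) (row_mx z eta) = ddir v (fun z1 => f z1 eta) z.
Proof.
Transparent ddir.
congr curve_derive; apply/funext => t.
by rewrite scale_row_mx scaler0 add_row_mx addr0 flat_row.
Opaque ddir.
Qed.

Lemma ddir_fibre f z eta v :
  ddir (row_mx 0 v) (flat f) (row_mx z eta) = ddir v (f z) eta.
Proof.
Transparent ddir.
congr curve_derive; apply/funext => t.
by rewrite scale_row_mx scaler0 add_row_mx addr0 flat_row.
Opaque ddir.
Qed.

Lemma wirt_base c j f z eta :
  wirt c j (fun z1 => f z1 eta) z = bwirt c (lshift n j) f z eta.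
Proof.
Transparent wirt.
rewrite /bwirt /wirt -row_deltal -!ddir_base.
by rewrite scale_row_mx scaler0.
Opaque wirt.
Qed.

Lemma wirt_fibre c j f z eta :
  wirt c j (f z) eta = bwirt c (rshift n j) f z eta.
Proof.
Transparent wirt.
rewrite /bwirt /wirt -row_deltar -!ddir_fibre.
by rewrite scale_row_mx scaler0.
Opaque wirt.
Qed.

Section Region.
Variables (A : V -> set V) (oA : open (Defs.total A)).

Definition bsmooth f := smooth_on_bundle A f.

Lemma total_row z eta : A z eta -> Defs.total A (row_mx z eta).
Proof. by rewrite /Defs.total /= row_mxKl row_mxKr. Qed.

Lemma bsmooth_dd f z eta : bsmooth f -> A z eta -> dd (flat f) (row_mx z eta).
Proof. by move=> sf /total_row Az; exact: (@Ck_dd _ _ 0 _ (flat f) _ (sf 1%N) Az). Qed.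

Lemma bsmooth_ext f g : (forall z eta, A z eta -> f z eta = g z eta) ->
  bsmooth f -> bsmooth g.
Proof. by move=> fg sf k; apply: Ck_ext oA _ (sf k) => p Ap; apply: fg. Qed.

Lemma bsmooth_cst (c : C) : bsmooth (fun _ _ => c).
Proof. by move=> k; exact: Ck_cst. Qed.

Lemma bsmoothD f g : bsmooth f -> bsmooth g -> bsmooth (fun z eta => f z eta + g z eta).
Proof. by move=> sf sg k; exact: (CkD oA (sf k) (sg k)). Qed.

Lemma bsmoothM f g : bsmooth f -> bsmooth g -> bsmooth (fun z eta => f z eta * g z eta).
Proof. by move=> sf sg k; exact: (CkM oA (sf k) (sg k)). Qed.

Lemma bsmoothN f : bsmooth f -> bsmooth (fun z eta => - f z eta).
Proof. by move=> sf k; exact: (CkN oA (sf k)). Qed.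

Lemma bsmoothB f g : bsmooth f -> bsmooth g -> bsmooth (fun z eta => f z eta - g z eta).
Proof. by move=> sf sg; apply: bsmoothD => //; exact: bsmoothN. Qed.

Lemma bsmooth_conj f : bsmooth f -> bsmooth (fun z eta => (f z eta)^*).
Proof. by move=> sf k; exact: (Ck_conj oA (sf k)). Qed.

Lemma bsmoothV f : (forall z eta, A z eta -> f z eta != 0) -> bsmooth f ->
  bsmooth (fun z eta => (f z eta)^-1).
Proof. by move=> f0 sf k; apply: (CkV oA _ (sf k)) => p; exact: f0. Qed.

Lemma bsmooth_sqrt (r : V -> V -> R) : (forall z eta, A z eta -> 0 < r z eta) ->
  bsmooth (fun z eta => (r z eta)%:C) ->
  bsmooth (fun z eta => (Num.sqrt (r z eta))%:C).
Proof.
move=> r0 sf k.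
by apply: (@Ck_sqrt _ _ k _ (fun p => r (lsubmx p) (rsubmx p)) oA _ (sf k)) => p; exact: r0.
Qed.

Lemma bsmooth_sum (I : Type) (r : seq I) (F : I -> V -> V -> C) :
  (forall i, bsmooth (F i)) -> bsmooth (fun z eta => \sum_(i <- r) F i z eta).
Proof. by move=> sF k; apply: (Ck_sum _ oA) => i; exact: sF. Qed.

Lemma bsmooth_prod (I : Type) (r : seq I) (F : I -> V -> V -> C) :
  (forall i, bsmooth (F i)) -> bsmooth (fun z eta => \prod_(i <- r) F i z eta).
Proof.
move=> sF; elim: r => [|i r IH].
  apply: (@bsmooth_ext (fun _ _ => 1)); last exact: bsmooth_cst.
  by move=> *; rewrite big_nil.
apply: (@bsmooth_ext (fun z eta => F i z eta * \prod_(j <- r) F j z eta)).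
  by move=> *; rewrite big_cons.
exact: bsmoothM.
Qed.

Lemma bsmooth_bwirt c k f : bsmooth f -> bsmooth (bwirt c k f).
Proof. by move=> sf l; rewrite -/(flat _) flat_bwirt; apply: Ck_wirt oA _; exact: sf. Qed.

Lemma bsmooth_eta j : bsmooth (fun _ eta => eta 0 j).
Proof.
move=> k; have -> : (fun p : 'rV[C]_(n + n) => rsubmx p 0 j) = fun p => p 0 (rshift n j).
  by apply/funext => p; rewrite mxE.
exact: Ck_coord.
Qed.

Lemma bsmooth_base (D : set V) (c : V -> C) : open D ->
  (forall z eta, A z eta -> D z) -> smooth_on D c -> bsmooth (fun z _ => c z).
Proof.
move=> oD AD sc k; apply: (Ck_comp oD oA _ (sc k)) => [p Ap|j]; first exact: AD Ap.
have -> : (fun p : 'rV[C]_(n + n) => lsubmx p 0 j) = fun p => p 0 (lshift n j).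
  by apply/funext => p; rewrite mxE.
exact: Ck_coord.
Qed.

Lemma bwirt_ext c k f g : (forall z eta, A z eta -> f z eta = g z eta) -> bsmooth f ->
  forall z eta, A z eta -> bwirt c k f z eta = bwirt c k g z eta.
Proof.
move=> fg sf z eta Az; apply: (wirt_near c k oA (total_row Az)).
  by move=> p Ap; apply: fg.
exact: bsmooth_dd.
Qed.

Lemma bwirt_cst c k (a : C) z eta : bwirt c k (fun _ _ => a) z eta = 0.
Proof. exact: wirt_cst. Qed.

Lemma bwirtD c k f g z eta : bsmooth f -> bsmooth g -> A z eta ->
  bwirt c k (fun z eta => f z eta + g z eta) z eta =
  bwirt c k f z eta + bwirt c k g z eta.
Proof.
by move=> sf sg Az; exact: (wirtD c k (bsmooth_dd sf Az) (bsmooth_dd sg Az)).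
Qed.

Lemma bwirtM c k f g z eta : bsmooth f -> bsmooth g -> A z eta ->
  bwirt c k (fun z eta => f z eta * g z eta) z eta =
  bwirt c k f z eta * g z eta + f z eta * bwirt c k g z eta.
Proof.
move=> sf sg Az; have := wirtM c k (bsmooth_dd sf Az) (bsmooth_dd sg Az).
by rewrite !flat_row.
Qed.

Lemma bwirt_conj c k f z eta : bsmooth f -> A z eta ->
  bwirt c k (fun z eta => (f z eta)^*) z eta = (bwirt (c^*) k f z eta)^*.
Proof. by move=> sf Az; exact: (wirt_conj c k (bsmooth_dd sf Az)). Qed.

Lemma bwirt_sum (I : Type) (r : seq I) (F : I -> V -> V -> C) c k z eta :
  (forall i, bsmooth (F i)) -> A z eta ->
  bwirt c k (fun z eta => \sum_(i <- r) F i z eta) z eta =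
  \sum_(i <- r) bwirt c k (F i) z eta.
Proof.
move=> sF Az; elim: r => [|i r IH].
  rewrite big_nil -[RHS](bwirt_cst c k 0 z eta).
  by congr (bwirt c k _ z eta); apply/funext => ?; apply/funext => ?; rewrite big_nil.
rewrite big_cons -IH -bwirtD//; last exact: bsmooth_sum.
by congr (bwirt c k _ z eta); apply/funext => ?; apply/funext => ?; rewrite big_cons.
Qed.

Lemma bwirtC c k c' k' f z eta : bsmooth f -> A z eta ->
  bwirt c k (bwirt c' k' f) z eta = bwirt c' k' (bwirt c k f) z eta.
Proof.
move=> sf Az; rewrite /bwirt -/(bwirt c' k' f) -/(bwirt c k f) !flat_bwirt.
exact: (wirtC c k c' k' oA (sf 2%N) (total_row Az)).
Qed.

Lemma vdirE f z eta v : bsmooth f -> A z eta ->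
  ddir v (f z) eta =
  \sum_k (bwirt (- ii) (rshift n k) f z eta * v 0 k
          + bwirt ii (rshift n k) f z eta * (v 0 k)^*).
Proof.
move=> sf Az; rewrite -ddir_fibre (ddirE _ oA (sf 1%N) (total_row Az)).
rewrite big_split_ord /= [X in X + _]big1 ?add0r; last first.
  by move=> k _; rewrite row_mxEl mxE conjc0 !mulr0 addr0.
by apply: eq_bigr => k _; rewrite row_mxEr dzE dzbE.
Qed.

End Region.

Lemma bwirt_eta_base c k j z eta :
  bwirt c (lshift n k) (fun _ eta => eta 0 j) z eta = 0.
Proof. by rewrite -wirt_base wirt_cst. Qed.

Lemma bwirt_eta_fibre c k j z eta :
  bwirt c (rshift n k) (fun _ eta => eta 0 j) z eta = 2^-1 * (1 + c * ii) * (k == j)%:R.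
Proof. by rewrite -(wirt_fibre c k (fun _ eta => eta 0 j)) wirt_coord. Qed.

Lemma bwirt_base_fibre c k (a : V -> C) z eta :
  bwirt c (rshift n k) (fun z _ => a z) z eta = 0.
Proof. by rewrite -(wirt_fibre c k (fun z _ => a z)) wirt_cst. Qed.

Lemma bwirt_base_base c k (a : V -> C) z eta :
  bwirt c (lshift n k) (fun z _ => a z) z eta = wirt c k a z.
Proof. by rewrite -wirt_base. Qed.

End Bundle.

(* d/dz^j, d/d(conj z^j), d/deta^j and d/d(conj eta^j) on the tangent bundle *)
Notation Dz j := (bwirt (- ii) (lshift _ j)).
Notation Db j := (bwirt ii (lshift _ j)).
Notation De j := (bwirt (- ii) (rshift _ j)).
Notation Eb j := (bwirt ii (rshift _ j)).

Create HintDb bsm.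
#[local] Hint Resolve bsmooth_cst bsmoothD bsmoothM bsmoothN bsmoothB bsmooth_conj
  bsmooth_sum bsmooth_bwirt bsmooth_eta : bsm.

Section OpenNonzero.
Context {R : realType} {m : nat}.

Lemma open_neq0 (U : set 'rV[R[i]]_m) (f : 'rV[R[i]]_m -> R[i]) : open U ->
  (forall z, U z -> {for z, continuous f}) -> open [set z | U z /\ f z != 0].
Proof.
move=> /open_vabs1P oU cf; apply/open_vabs1P => z /= [Uz fz].
have fz0 : 0 < abs1 (f z).
  move: fz; case: (f z) => x y; rewrite eq_complex /abs1 /= negb_and => xy.
  rewrite lt_def addr_ge0// andbT paddr_eq0// !normr_eq0 negb_and.
  by [].
have [d d0 hd] := (continuous_vabs1P _ _).1 (cf z Uz) _ fz0.
have [e e0 he] := oU z Uz.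
exists (Num.min d e); first by rewrite lt_min d0.
move=> w; rewrite lt_min => /andP[/hd fw /he Uw]; split => //.
by apply/eqP => fw0; move: fw; rewrite fw0 sub0r abs1N ltxx.
Qed.

End OpenNonzero.

(** * Homogeneous functions on the bundle and Euler's relations *)

Section Homogeneity.
Context {R : realType} {n : nat}.
Local Notation C := R[i].
Local Notation V := 'rV[C]_n.
Variables (A : V -> set V) (oA : open (Defs.total A)).
Implicit Types (f : V -> V -> C) (z eta v : V).

Lemma total_open_base eta : open [set z | A z eta].
Proof.
apply/open_vabs1P => z /= Az.
have [e e0 he] := (open_vabs1P _).1 oA _ (total_row Az).
exists e => // w wz; have := he (row_mx w eta); rewrite /Defs.total /= row_mxKl row_mxKr.
apply; rewrite opp_row_mx add_row_mx subrr /vabs1 big_split_ord /=.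
rewrite [X in _ + X]big1 ?addr0; last first.
  by move=> k _; rewrite row_mxEr mxE /abs1 /= normr0 addr0.
by under eq_bigr do rewrite row_mxEl.
Qed.

Lemma total_open_fibre z : open (A z).
Proof.
apply/open_vabs1P => eta /= Az.
have [e e0 he] := (open_vabs1P _).1 oA _ (total_row Az).
exists e => // w wz; have := he (row_mx z w); rewrite /Defs.total /= row_mxKl row_mxKr.
apply; rewrite opp_row_mx add_row_mx subrr /vabs1 big_split_ord /=.
rewrite [X in X + _]big1 ?add0r; last first.
  by move=> k _; rewrite row_mxEl mxE /abs1 /= normr0 addr0.
by under eq_bigr do rewrite row_mxEr.
Qed.

Lemma vdir_delta f z eta k (a : C) : bsmooth A f -> A z eta ->
  ddir (a *: delta_mx 0 k) (f z) eta = De k f z eta * a + Eb k f z eta * a^*.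
Proof.
move=> sf Az; rewrite (vdirE oA _ sf Az) (bigD1 k)//= big1 ?addr0.
  by rewrite !mxE !eqxx mulr1.
by move=> j jk; rewrite !mxE eqxx (negbTE jk) !(mulr0, conjc0, addr0).
Qed.

Hypothesis scaleA : forall z eta (l : C), A z eta -> l != 0 -> A z (l *: eta).

Lemma ddir_scale f z eta v (l c : C) : bsmooth A f -> l != 0 ->
  (forall z eta, A z eta -> f z (l *: eta) = c * f z eta) -> A z eta ->
  ddir (l *: v) (f z) (l *: eta) = c * ddir v (f z) eta.
Proof.
move=> sf l0 fl Az.
have df : is_ddir v (f z) eta (ddir v (f z) eta).
  apply: is_ddirP; have := bsmooth_dd sf Az (row_mx 0 v).
  rewrite /dderivable; congr curve_derivable; apply/funext => t.
  by rewrite scale_row_mx scaler0 add_row_mx addr0 flat_row.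
have d2 : is_ddir v (fun w => c * f z w) eta (c * ddir v (f z) eta).
  have := is_ddirM (is_ddir_cst v c eta) df.
  by rewrite mul0r add0r.
have -> : ddir (l *: v) (f z) (l *: eta) = ddir v (fun w => f z (l *: w)) eta.
  Transparent ddir.
  congr curve_derive; apply/funext => t.
  by rewrite scalerDr !scalerA mulrC.
  Opaque ddir.
rewrite -(is_ddir_val d2); apply/esym.
apply: (@ddir_near _ _ (A z) v (fun w => c * f z w) (fun w => f z (l *: w)) eta
  (@total_open_fibre z) Az); last exact: is_ddir_derivable d2.
by move=> y Ay; rewrite fl.
Qed.

(* The two real directions [v] and [ii v] separate the C-linear and the
   C-antilinear part of the differential. *)
Lemma antilinear_eq2 (a b a' b' : C) : a + b = a' + b' ->
  a * ii + b * - ii = a' * ii + b' * - ii -> a = a' /\ b = b'.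
Proof.
move=> H1; rewrite !mulrN -!mulrBl => /(mulIf (@ii_neq0 R)) H2.
have E : a = a'.
  have : a + b + (a - b) = a' + b' + (a' - b') by rewrite H1 H2.
  rewrite addrACA subrr addr0 [in RHS]addrACA subrr addr0 -!mulr2n.
  by move/eqP; rewrite eqrMn2r// => /eqP.
by split=> //; move: H1; rewrite E => /addrI.
Qed.

Lemma antilinear_eq (a b a' b' : C) :
  (forall c, a * c + b * c^* = a' * c + b' * c^*) -> a = a' /\ b = b'.
Proof.
move=> H; have := H 1; have := H ii; rewrite conjC_ii conjc1 !mulr1 => H2 H1.
exact: antilinear_eq2.
Qed.

(** Differentiate the homogeneity relation along [a *: delta_mx 0 k] for every complex [a]; the
    parts linear and antilinear in [a] separate by [antilinear_eq]. *)
Lemma fibre_scale f (l c : C) : bsmooth A f -> l != 0 ->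
  (forall z eta, A z eta -> f z (l *: eta) = c * f z eta) ->
  forall k z eta, A z eta ->
    l * De k f z (l *: eta) = c * De k f z eta /\
    l^* * Eb k f z (l *: eta) = c * Eb k f z eta.
Proof.
move=> sf l0 fl k z eta Az.
apply: antilinear_eq => a.
have := vdir_delta k (l * a) sf (scaleA Az l0).
rewrite -scalerA (ddir_scale _ sf l0 fl Az) (vdir_delta _ _ sf Az) conjCM.
move: (bwirt (- ii) (rshift n k) f z eta) (bwirt ii (rshift n k) f z eta).
move: (bwirt (- ii) (rshift n k) f z (l *: eta)) (bwirt ii (rshift n k) f z (l *: eta)).
move: (l^*) (a^*) => l' a' x' y' x y E /=.
have -> : l * x' * a + l' * y' * a' = x' * (l * a) + y' * (l' * a') by ring.
by rewrite -E; ring.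
Qed.

Lemma base_scale f (l c : C) : bsmooth A f -> l != 0 ->
  (forall z eta, A z eta -> f z (l *: eta) = c * f z eta) ->
  forall k z eta, A z eta -> Dz k f z (l *: eta) = c * Dz k f z eta.
Proof.
move=> sf l0 fl k z eta Az; rewrite -!wirt_base.
have -> : c * wirt (- ii) k (fun z1 => f z1 eta) z =
    wirt (- ii) k (fun z1 => c * f z1 eta) z.
  rewrite (wirt_base _ _ (fun z eta => c * f z eta)).
  rewrite (bwirtM _ _ (bsmooth_cst A c) sf Az) bwirt_cst mul0r add0r.
  by rewrite wirt_base.
apply: (wirt_near _ _ (@total_open_base eta) Az) => [y Ay|v]; first by rewrite fl.
have := bsmooth_dd sf (scaleA Az l0) (row_mx v 0).
rewrite /dderivable; congr curve_derivable; apply/funext => t.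
by rewrite scale_row_mx scaler0 add_row_mx addr0 flat_row.
Qed.

Lemma is_cderive_affine (c : C) : is_cderive (fun t : R => 1 + t%:C * c) c.
Proof.
rewrite -[X in is_cderive _ X]add0r; apply: is_cderiveD; first exact: is_cderive_cst.
have id1 : is_cderive (fun t : R => t%:C) 1.
  by split; [exact: is_derive_id|exact: is_derive_cst].
have := is_cderiveM id1 (is_cderive_cst c).
by rewrite mul1r mulr0 addr0.
Qed.

Lemma is_cderive_affine_sqr (c : C) :
  is_cderive (fun t : R => (1 + t%:C * c) * (1 + t%:C * c)^*) (c + c^*).
Proof.
have := is_cderiveM (is_cderive_affine c) (is_cderive_conj (is_cderive_affine c)).
by rewrite mul0r addr0 conjc1 mulr1 mul1r.
Qed.

(** Differentiate along [(1 + t c) eta] for [c = 1] and [c = ii]. The degree enters only through the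
    differential of [chi] at 1, so that |l|^2-homogeneity and complex linearity are both
    instances. *)
Lemma euler f (chi : C -> C) (a b : C) : bsmooth A f ->
  (forall z eta (l : C), A z eta -> l != 0 -> f z (l *: eta) = chi l * f z eta) ->
  (forall c, is_cderive (fun t : R => chi (1 + t%:C * c)) (a * c + b * c^*)) ->
  forall z eta, A z eta ->
    \sum_k De k f z eta * eta 0 k = a * f z eta /\
    \sum_k Eb k f z eta * (eta 0 k)^* = b * f z eta.
Proof.
move=> sf fchi dchi z eta Az.
have H (c d : C) : is_cderive (fun t : R => chi (1 + t%:C * c)) d ->
    \sum_k De k f z eta * eta 0 k * c + \sum_k Eb k f z eta * (eta 0 k)^* * c^* =
    d * f z eta.
  move=> dc; have := vdirE oA (c *: eta) sf Az.
  rewrite big_split /= => E.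
  transitivity (ddir (c *: eta) (f z) eta).
    rewrite E; congr (_ + _); apply: eq_bigr => k _; rewrite !mxE.
      by rewrite -mulrA [c * _]mulrC.
    by rewrite conjCM -mulrA [c^* * _]mulrC.
  apply: is_ddir_val; rewrite /is_ddir.
  have := is_cderiveM dc (is_cderive_cst (f z eta)).
  rewrite mulr0 addr0 => -[D1 D2].
  (* Homogeneity is given for nonzero scalars, so it is used for small [t] only. *)
  have near : \forall t \near (0 : R), 1 + t%:C * c != 0.
    have oU : open [set w : 'rV[C]_1 | setT w /\ w 0 0 != 0].
      by apply: open_neq0 openT _ => w _; exact: (Ck_cont (Ck_coord 0 setT 0)).
    have := @open_line R 1 _ (const_mx c) (const_mx 1) oU.
    rewrite /= mxE oner_eq0 => /(_ (conj I isT)); apply: filterS => t [_].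
    by rewrite !mxE.
  have E' t : 1 + t%:C * c != 0 -> chi (1 + t%:C * c) * f z eta = f z (eta + t%:C *: (c *: eta)).
    by move=> t0; rewrite -fchi// scalerDl scale1r scalerA.
  by split; [apply: near_eq_is_derive D1|apply: near_eq_is_derive D2];
    apply: filterS near => t /E' ->.
have := H 1 _ (dchi 1); have := H ii _ (dchi ii).
rewrite -!mulr_suml conjc1 !mulr1 conjC_ii.
set X := \sum_k _; set Y := \sum_k _; move: X Y (f z eta) => X Y F H2 H1.
by apply: antilinear_eq2; rewrite ?H1 ?H2; ring.
Qed.

End Homogeneity.

(** * Sprays and connections of complex Finsler metrics *)

Section FinslerRegion.
Context {R : realType} {n : nat}.
Local Notation C := R[i].
Local Notation V := 'rV[C]_n.

Definition energy (F : V -> V -> R) : V -> V -> C := fun z eta => (F z eta ^+ 2)%:C.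

(** The common ground of genuine metrics off the zero section and of [alpha + |beta|] off the zeros
    of beta. Invertibility of [fund] is added separately in [finsler_region]: smoothness and
    homogeneity already serve to compute [fund] of [alpha + |beta|], and to treat a metric read in a
    chart. *)
Record energy_region (A : V -> set V) (F : V -> V -> R) : Prop := {
  region_open : open (Defs.total A);
  region_scale : forall z eta (l : C), A z eta -> l != 0 -> A z (l *: eta);
  region_smooth : bsmooth A (energy F);
  region_homog : forall z eta (l : C), A z eta ->
    F z (l *: eta) = Normc.normc l * F z eta;
  region_neq0 : forall z eta, A z eta -> F z eta != 0
}.

Record finsler_region (A : V -> set V) (F : V -> V -> R) : Prop := {
  region_energy :> energy_region A F;
  region_unit : forall z eta, A z eta -> fund F z eta \in unitmx
}.

Variables (A : V -> set V) (F : V -> V -> R).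
Implicit Types (z eta : V) (i j k l m p q r : 'I_n).

Lemma fundE z eta i j : fund F z eta i j = De i (Eb j (energy F)) z eta.
Proof.
have E : (fun eta1 => dzb j (fun eta2 => (F z eta2 ^+ 2)%:C) eta1) = Eb j (energy F) z.
  apply/funext => eta1; rewrite dzbE; exact: (wirt_fibre ii j (energy F)).
by rewrite mxE E dzE; exact: (wirt_fibre (- ii) i (Eb j (energy F))).
Qed.

#[local] Opaque fund.

Local Notation L := (energy F).
Local Notation g i j := (fun z eta => fund F z eta i j).
Local Notation N i j := (nonlin_conn F i j).
Local Notation G i := (spray F i).

Section Energy.
Hypothesis FA : energy_region A F.
Let oA := region_open FA.
Let sL := region_smooth FA.

#[local] Hint Resolve oA sL : bsm.

Lemma bsmooth_fund i j : bsmooth A (g i j).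
Proof.
apply: (bsmooth_ext oA (f := De i (Eb j L))); last by auto with bsm.
by move=> z eta _; rewrite fundE.
Qed.

Lemma bsmooth_det (q : nat) (M : V -> V -> 'M[C]_q) :
  (forall i j : 'I_q, bsmooth A (fun z eta => M z eta i j)) ->
  bsmooth A (fun z eta => \det (M z eta)).
Proof.
move=> sM; apply: bsmooth_sum => // s; apply: bsmoothM => //; first exact: bsmooth_cst.
by apply: bsmooth_prod => // i; exact: sM.
Qed.

Lemma energy_conj z eta : (L z eta)^* = L z eta.
Proof. exact: conjc_real. Qed.

Lemma De_conj k f z eta : bsmooth A f -> A z eta ->
  (De k f z eta)^* = Eb k (fun z eta => (f z eta)^*) z eta.
Proof. by move=> sf Az; rewrite (bwirt_conj _ _ sf Az) conjC_ii. Qed.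

Lemma Eb_conj k f z eta : bsmooth A f -> A z eta ->
  (Eb k f z eta)^* = De k (fun z eta => (f z eta)^*) z eta.
Proof. by move=> sf Az; rewrite (bwirt_conj _ _ sf Az) conjCN conjC_ii opprK. Qed.

Lemma De_energy_conj k z eta : A z eta -> (De k L z eta)^* = Eb k L z eta.
Proof.
move=> Az; rewrite (De_conj _ sL Az).
by congr (Eb k _ z eta); apply/funext => ?; apply/funext => ?; rewrite energy_conj.
Qed.

Lemma fund_conj i j z eta : A z eta -> (fund F z eta i j)^* = fund F z eta j i.
Proof.
move=> Az; rewrite (fundE z eta i j) (fundE z eta j i) De_conj//; last by auto with bsm.
have H z1 eta1 : A z1 eta1 -> (Eb j L z1 eta1)^* = De j L z1 eta1.
  move=> Az1; rewrite (Eb_conj _ sL Az1).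
  by congr (De j _ z1 eta1); apply/funext => ?; apply/funext => ?; rewrite energy_conj.
rewrite (bwirt_ext oA _ _ H _ Az); last by auto with bsm.
by rewrite (bwirtC oA).
Qed.

Lemma energy_scale z eta (l : C) : A z eta -> L z (l *: eta) = l * l^* * L z eta.
Proof.
move=> Az; rewrite /energy (region_homog FA l Az) exprMn rmorphM /=; congr (_ * _).
rewrite -[RHS]sqr_normc normc_def rmorphXn /=.
by case: l => x y.
Qed.

Lemma energy_neq0 z eta : A z eta -> L z eta != 0.
Proof.
move=> Az; rewrite /energy -[0]/(0%:C) (inj_eq (@complexI _)).
by rewrite sqrf_eq0 (region_neq0 FA Az).
Qed.

Lemma euler_energy z eta : A z eta -> \sum_k De k L z eta * eta 0 k = L z eta.
Proof.
move=> Az.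
have d c : is_cderive (fun t : R => (1 + t%:C * c) * (1 + t%:C * c)^*) (1 * c + 1 * c^*).
  by rewrite !mul1r; exact: is_cderive_affine_sqr.
have E z' eta' (l : C) : A z' eta' -> l != 0 -> L z' (l *: eta') = l * l^* * L z' eta'.
  by move=> Az' _; exact: energy_scale.
have [-> _] := euler oA (chi := fun l : C => l * l^*) sL E d Az.
by rewrite mul1r.
Qed.

Lemma euler10 f : bsmooth A f ->
  (forall z eta (l : C), A z eta -> l != 0 -> f z (l *: eta) = l * f z eta) ->
  forall z eta, A z eta -> \sum_k De k f z eta * eta 0 k = f z eta.
Proof.
move=> sf E z eta Az.
have d c : is_cderive (fun t : R => 1 + t%:C * c) (1 * c + 0 * c^*).
  by rewrite mul1r mul0r addr0; exact: is_cderive_affine.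
have [-> _] := euler oA (chi := id) sf E d Az.
by rewrite mul1r.
Qed.

Lemma Eb_energy_scale k z eta (l : C) : A z eta -> l != 0 ->
  Eb k L z (l *: eta) = l * Eb k L z eta.
Proof.
move=> Az l0.
have H z' eta' : A z' eta' -> L z' (l *: eta') = l * l^* * L z' eta'.
  by move=> Az'; exact: energy_scale.
have [_] := fibre_scale oA (region_scale FA) sL l0 H k Az.
have l0' : l^* != 0 by rewrite conjc_eq0.
by rewrite [l * _]mulrC -mulrA => /(mulfI l0').
Qed.

Lemma fund_scale i j z eta (l : C) : A z eta -> l != 0 ->
  fund F z (l *: eta) i j = fund F z eta i j.
Proof.
move=> Az l0; apply: etrans (fundE z (l *: eta) i j) (etrans _ (esym (fundE z eta i j))).
have sE : bsmooth A (Eb j L) by auto with bsm.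
have H z' eta' : A z' eta' -> Eb j L z' (l *: eta') = l * Eb j L z' eta'.
  by move=> Az'; exact: Eb_energy_scale.
have [+ _] := fibre_scale oA (region_scale FA) sE l0 H i Az.
by move/(mulfI l0).
Qed.

Lemma fund_eta m z eta : A z eta -> \sum_l fund F z eta l m * eta 0 l = Eb m L z eta.
Proof.
move=> Az; under eq_bigr do rewrite fundE.
apply: (euler10 (f := Eb m L)) Az; first by auto with bsm.
by move=> *; exact: Eb_energy_scale.
Qed.

Lemma fund_eta_conj l z eta : A z eta ->
  \sum_m fund F z eta l m * (eta 0 m)^* = De l L z eta.
Proof.
move=> Az; rewrite -[RHS]conjcK De_energy_conj// -fund_eta// conjC_sum.
by apply: eq_bigr => m _; rewrite conjCM fund_conj.
Qed.

End Energy.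

Hypothesis FA : finsler_region A F.
Let oA := region_open FA.
Let sL := region_smooth FA.
#[local] Hint Resolve oA sL : bsm.

Lemma bsmooth_ginv m i : bsmooth A (fun z eta => ginv F z eta m i).
Proof.
pose f z eta := (\det (fund F z eta))^-1 * ((-1) ^+ (i + m) *
  \det (row' i (col' m (fund F z eta)))).
apply: (bsmooth_ext oA (f := f)).
  by move=> z eta Az; rewrite /ginv /invmx (region_unit FA Az) !mxE.
apply: bsmoothM => //.
  apply: bsmoothV => // [z eta Az|]; last by apply: (bsmooth_det FA) => *; exact: (bsmooth_fund FA).
  by have := region_unit FA Az; rewrite unitmxE unitfE.
apply: bsmoothM => //; first exact: bsmooth_cst.
apply: (bsmooth_det FA) => p q; apply: (bsmooth_ext oA (f := g (lift i p) (lift m q))).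
  by move=> z eta _; rewrite [RHS]mxE [RHS]mxE.
exact: (bsmooth_fund FA).
Qed.

Lemma ginv_fund z eta m m' : A z eta ->
  \sum_i ginv F z eta m i * fund F z eta i m' = (m == m')%:R.
Proof.
move=> Az; have := mulVmx (region_unit FA Az) => /matrixP /(_ m m').
by rewrite !mxE.
Qed.

Lemma fund_inj z eta (x y : 'I_n -> C) : A z eta ->
  (forall m, \sum_i x i * fund F z eta i m = \sum_i y i * fund F z eta i m) -> x =1 y.
Proof.
move=> Az H i.
have E : (\row_k x k) *m fund F z eta = (\row_k y k) *m fund F z eta.
  have Eu (u : 'I_n -> C) m : ((\row_k u k) *m fund F z eta) 0 m =
      \sum_i u i * fund F z eta i m.
    by rewrite mxE; apply: eq_bigr => k _; rewrite mxE.
  by apply/rowP => m; rewrite !Eu.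
have := congr1 (fun M => (M *m invmx (fund F z eta)) 0 i) E.
by rewrite !mulmxK ?(region_unit FA Az)// !mxE.
Qed.

Lemma lower_raise z eta (Y : 'I_n -> C) m : A z eta ->
  \sum_i (\sum_p ginv F z eta p i * Y p) * fund F z eta i m = Y m.
Proof.
move=> Az; under eq_bigr do rewrite mulr_suml.
rewrite exchange_big /=.
under eq_bigr => p _.
  under eq_bigr do rewrite mulrAC.
  rewrite -mulr_suml ginv_fund//.
  over.
rewrite (bigD1 m)//= eqxx mul1r big1 ?addr0// => p pm.
by rewrite (negbTE pm) mul0r.
Qed.

(** By Euler's relation, [fund] contracted with [eta] is [Eb m L], and [eta] is constant in base
    directions; so the derivative of [fund] in the definition is a second derivative of [L]. *)
Lemma nonlin_connE i j z eta : A z eta ->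
  N i j z eta = \sum_m ginv F z eta m i * Dz j (Eb m L) z eta.
Proof.
move=> Az; apply: eq_bigr => m _.
have sg := bsmooth_fund FA.
have E : Dz j (fun z eta => \sum_l fund F z eta l m * eta 0 l) z eta =
    Dz j (Eb m L) z eta.
  apply: (bwirt_ext oA _ _ _ _ Az); last by auto with bsm.
  by move=> z' eta' Az'; exact: (fund_eta FA).
rewrite -E (bwirt_sum oA _ _ _ _ Az); last by auto with bsm.
rewrite mulr_sumr; apply: eq_bigr => l _.
rewrite (bwirtM _ _ (sg l m) (bsmooth_eta A l) Az).
by rewrite bwirt_eta_base mulr0 addr0 mulrA dzE (wirt_base _ _ (g l m)).
Qed.

Lemma lower_nonlin j m z eta : A z eta ->
  \sum_i N i j z eta * fund F z eta i m = Dz j (Eb m L) z eta.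
Proof.
move=> Az; under eq_bigr do rewrite nonlin_connE//.
exact: (lower_raise (fun m => Dz j (Eb m L) z eta)).
Qed.

Lemma bsmooth_nonlin i j : bsmooth A (N i j).
Proof.
apply: (bsmooth_ext oA (f := fun z eta => \sum_m ginv F z eta m i * Dz j (Eb m L) z eta)).
  by move=> z eta Az; rewrite nonlin_connE.
by apply: bsmooth_sum => // m; apply: bsmoothM => //; [exact: bsmooth_ginv|auto with bsm].
Qed.

Lemma bsmooth_spray i : bsmooth A (G i).
Proof.
have sN := bsmooth_nonlin.
apply: bsmoothM => //; first exact: bsmooth_cst.
by apply: bsmooth_sum => // j; apply: bsmoothM => //; exact: bsmooth_eta.
Qed.

(** The horizontal derivatives of the Chern-Finsler connection annihilate [L]: pair [lower_nonlin]
    with conj eta and use Euler's relation in conj eta. *)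
Lemma nonlin_energy j z eta : A z eta ->
  \sum_i N i j z eta * De i L z eta = Dz j L z eta.
Proof.
move=> Az.
have sb := bsmooth_base.
transitivity (\sum_m Dz j (Eb m L) z eta * (eta 0 m)^*).
  under eq_bigr => i _ do rewrite -(fund_eta_conj FA)// mulr_sumr.
  rewrite exchange_big /=; apply: eq_bigr => m _.
  rewrite -lower_nonlin// mulr_suml; apply: eq_bigr => i _.
  by rewrite mulrA.
have E : Dz j (fun z eta => \sum_m Eb m L z eta * (eta 0 m)^*) z eta = Dz j L z eta.
  apply: (bwirt_ext oA _ _ _ _ Az); last by auto 6 with bsm.
  move=> z' eta' Az'; rewrite -[RHS]energy_conj -(euler_energy FA)// conjC_sum.
  by apply: eq_bigr => m _; rewrite conjCM (De_energy_conj FA).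
rewrite -E (bwirt_sum oA _ _ _ _ Az); last by auto 6 with bsm.
apply: eq_bigr => m _; rewrite (bwirtM _ _ _ _ Az); [|by auto with bsm|by auto with bsm].
by rewrite (bwirt_conj _ _ (bsmooth_eta A m) Az) bwirt_eta_base conjc0 mulr0 addr0.
Qed.

Lemma sprayE i z eta : 2 * G i z eta = \sum_j N i j z eta * eta 0 j.
Proof. by rewrite /spray mulrA divff ?mul1r// pnatr_eq0. Qed.

Lemma spray_energy z eta : A z eta ->
  \sum_i (2 * G i z eta) * De i L z eta = \sum_j Dz j L z eta * eta 0 j.
Proof.
move=> Az; under eq_bigr do rewrite sprayE mulr_suml.
rewrite exchange_big /=; apply: eq_bigr => j _.
rewrite -nonlin_energy// mulr_suml; apply: eq_bigr => i _.
by rewrite mulrAC.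
Qed.

(* Differentiating the contraction [spray_energy] along the conjugate fibre
   directions, the terms without derivatives of the spray cancel. *)
Lemma Eb_spray_energy m z eta : A z eta ->
  \sum_i Eb m (G i) z eta * De i L z eta = 0.
Proof.
move=> Az; have sG := bsmooth_spray; have sN := bsmooth_nonlin.
have E : Eb m (fun z eta => \sum_i (2 * G i z eta) * De i L z eta) z eta =
    Eb m (fun z eta => \sum_j Dz j L z eta * eta 0 j) z eta.
  apply: (bwirt_ext oA _ _ _ _ Az); last by auto 8 with bsm.
  by move=> z' eta' Az'; exact: spray_energy.
move: E; rewrite (bwirt_sum oA _ _ _ _ Az); last by auto 8 with bsm.
rewrite (bwirt_sum oA _ _ _ _ Az); last by auto 8 with bsm.
have -> : \sum_j Eb m (fun z eta => Dz j L z eta * eta 0 j) z eta =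
    \sum_i (2 * G i z eta) * fund F z eta i m.
  under eq_bigr => j _.
    rewrite (bwirtM _ _ _ _ Az); [|by auto with bsm|exact: bsmooth_eta].
    rewrite bwirt_eta_fibre iiM subrr mulr0 mul0r mulr0 addr0.
    rewrite (bwirtC oA _ _ _ _ sL Az) -lower_nonlin// mulr_suml.
    over.
  rewrite exchange_big /=; apply: eq_bigr => i _.
  rewrite sprayE mulr_suml; apply: eq_bigr => j _; exact: mulrAC.
under eq_bigr => i _.
  rewrite (bwirtM _ _ _ _ Az); [|by auto with bsm|by auto with bsm].
  rewrite (bwirtM _ _ _ _ Az); [|exact: bsmooth_cst|exact: sG].
  rewrite bwirt_cst mul0r add0r (bwirtC oA _ _ _ _ sL Az) -fundE -mulrA.
  over.
rewrite big_split /= => /eqP; rewrite -subr_eq0 addrK -mulr_sumr.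
by rewrite mulf_eq0 pnatr_eq0 /= => /eqP.
Qed.

End FinslerRegion.

#[local] Opaque fund.

Section FinslerConnection.
Context {R : realType} {n : nat}.
Local Notation C := R[i].
Local Notation V := 'rV[C]_n.

Variables (A : V -> set V) (F : V -> V -> R).
Implicit Types (z eta : V) (i j k m p q r : 'I_n).

Lemma sum_delta (f : 'I_n -> C) k : \sum_j f j * (k == j)%:R = f k.
Proof.
rewrite (bigD1 k)//= eqxx mulr1 big1 ?addr0// => j.
by rewrite eq_sym => /negbTE ->; rewrite mulr0.
Qed.

Lemma De_eta k j z eta : De k (fun _ eta : V => eta 0 j) z eta = (k == j)%:R.
Proof.
by rewrite bwirt_eta_fibre mulNr iiM opprK -[1 + 1]/(2%:R) mulVf ?mul1r// pnatr_eq0.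
Qed.

Lemma Eb_eta k j z eta : Eb k (fun _ eta : V => eta 0 j) z eta = 0.
Proof. by rewrite bwirt_eta_fibre iiM subrr mulr0 mul0r. Qed.

Lemma conn_coefE i j k z eta : conn_coef F i j k z eta = De j (nonlin_conn F i k) z eta.
Proof. by rewrite /conn_coef dzE; exact: (wirt_fibre (- ii) j (nonlin_conn F i k)). Qed.

#[local] Opaque dz dzb conn_coef nonlin_conn ginv.

Hypothesis FA : finsler_region A F.
Let oA := region_open FA.
Let sL := region_smooth FA.
Local Notation L := (energy F).
Local Notation N i j := (nonlin_conn F i j).
Local Notation G i := (spray F i).
Let sN := bsmooth_nonlin FA.
Let sG := bsmooth_spray FA.

#[local] Hint Resolve oA sL sN sG : bsm.

Lemma ginv_scale z eta (l : C) : A z eta -> l != 0 ->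
  ginv F z (l *: eta) = ginv F z eta.
Proof.
move=> Az l0; apply: (congr1 invmx); apply/matrixP => i j.
exact: (fund_scale FA i j Az l0).
Qed.

Lemma nonlin_scale i j z eta (l : C) : A z eta -> l != 0 ->
  N i j z (l *: eta) = l * N i j z eta.
Proof.
move=> Az l0.
apply: etrans (nonlin_connE FA i j (region_scale FA Az l0)) _.
rewrite (nonlin_connE FA i j Az) mulr_sumr; apply: eq_bigr => m _.
have sE : bsmooth A (Eb m L) by auto with bsm.
have H z' eta' : A z' eta' -> Eb m L z' (l *: eta') = l * Eb m L z' eta'.
  by move=> Az'; exact: (Eb_energy_scale FA m Az' l0).
have -> := base_scale oA (region_scale FA) sE l0 H j Az.
by rewrite (ginv_scale Az l0) mulrCA.
Qed.

Lemma conn_scale i j k z eta (l : C) : A z eta -> l != 0 ->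
  conn_coef F i j k z (l *: eta) = conn_coef F i j k z eta.
Proof.
move=> Az l0.
apply: etrans (conn_coefE i j k z (l *: eta)) (etrans _ (esym (conn_coefE i j k z eta))).
have H z' eta' : A z' eta' -> N i k z' (l *: eta') = l * N i k z' eta'.
  by move=> Az'; exact: nonlin_scale.
have [+ _] := fibre_scale oA (region_scale FA) (sN i k) l0 H j Az.
by move/(mulfI l0).
Qed.

Lemma spray_scale i z eta (l : C) : A z eta -> l != 0 ->
  G i z (l *: eta) = l * l * G i z eta.
Proof.
move=> Az l0; rewrite /spray mulrCA; congr (_ * _); rewrite mulr_sumr.
apply: eq_bigr => j _.
by rewrite (nonlin_scale i j Az l0) mxE mulrACA.
Qed.

Definition theta_low q z eta : C :=
  \sum_r \sum_p \sum_j fund F z eta r p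
    * ((conn_coef F p j q z eta)^* - (conn_coef F p q j z eta)^*)
    * eta 0 r * (eta 0 j)^*.

Lemma thetaE i z eta :
  theta F i z eta = \sum_m ginv F z eta m i * theta_low m z eta.
Proof.
apply: eq_bigr => m _; rewrite !mulr_sumr; apply: eq_bigr => r _.
rewrite !mulr_sumr; apply: eq_bigr => p _.
rewrite !mulr_sumr; apply: eq_bigr => j _.
by rewrite !mulrA.
Qed.

Lemma theta_low_scale q z eta (l : C) : A z eta -> l != 0 ->
  theta_low q z (l *: eta) = l * l^* * theta_low q z eta.
Proof.
move=> Az l0; rewrite mulr_sumr; apply: eq_bigr => r _.
rewrite mulr_sumr; apply: eq_bigr => p _.
rewrite mulr_sumr; apply: eq_bigr => j _.
pose K (a b c x y : C) := a * (b^* - c^*) * x * y^*.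
have EK a b c x y a' b' c' x' y' : a = a' -> b = b' -> c = c' -> x = x' -> y = y' ->
  K a b c x y = K a' b' c' x' y' by move=> -> -> -> -> ->.
have alg a b c x y : K a b c (l * x) (l * y) = l * l^* * K a b c x y.
  by rewrite /K (conjCM l y); move: (l^*) (b^*) (c^*) (y^*) => *; ring.
exact: etrans (EK _ _ _ _ _ _ _ _ _ _ (fund_scale FA r p Az l0)
  (conn_scale p j q Az l0) (conn_scale p q j Az l0) (mxE _ _ 0 r) (mxE _ _ 0 j))
  (alg _ _ _ _ _).
Qed.

Lemma theta_scale i z eta (l : C) : A z eta -> l != 0 ->
  theta F i z (l *: eta) = l * l^* * theta F i z eta.
Proof.
move=> Az l0; apply: etrans (thetaE i z (l *: eta)) _.
rewrite thetaE mulr_sumr; apply: eq_bigr => m _.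
by rewrite (ginv_scale Az l0) (theta_low_scale m Az l0) mulrCA.
Qed.

(** [theta_low] contracts the torsion, antisymmetric in its two conjugate lower indices, with one
    conj eta; a second contraction with conj eta gives zero. *)
Lemma theta_low_antisym z eta : \sum_q theta_low q z eta * (eta 0 q)^* = 0.
Proof.
pose U j q := \sum_r \sum_p fund F z eta r p * (conn_coef F p j q z eta)^* * eta 0 r.
have E q : theta_low q z eta = \sum_j (U j q - U q j) * (eta 0 j)^*.
  rewrite /theta_low.
  under eq_bigr do rewrite exchange_big /=.
  rewrite exchange_big /=; apply: eq_bigr => j _.
  rewrite -sumrB mulr_suml; apply: eq_bigr => r _.
  rewrite -sumrB mulr_suml; apply: eq_bigr => p _.
  by rewrite -mulrBl -mulrBr.
under eq_bigr do rewrite E mulr_suml.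
have S0 (S : C) : S = - S -> S = 0.
  by move/eqP; rewrite -addr_eq0 -mulr2n mulrn_eq0 /= => /eqP.
apply: S0; rewrite [LHS]exchange_big /= -sumrN; apply: eq_bigr => q _.
rewrite -sumrN; apply: eq_bigr => j _.
move: (U j q) (U q j) ((eta 0 q)^*) ((eta 0 j)^*) => a b c d; ring.
Qed.

Lemma lower_theta q z eta : A z eta ->
  \sum_i theta F i z eta * fund F z eta i q = theta_low q z eta.
Proof.
move=> Az; under eq_bigr do rewrite thetaE.
exact: (lower_raise FA (fun m => theta_low m z eta) q Az).
Qed.

Lemma theta_energy z eta : A z eta -> \sum_i theta F i z eta * De i L z eta = 0.
Proof.
move=> Az; rewrite -[RHS](theta_low_antisym z eta).
under eq_bigr => i _ do rewrite -(fund_eta_conj FA i Az) mulr_sumr.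
rewrite exchange_big /=; apply: eq_bigr => m _.
rewrite -lower_theta// mulr_suml; apply: eq_bigr => i _.
by rewrite mulrA.
Qed.

(** The weak Kaehler expression is the conjugate of [theta_low], and raising its index by the
    invertible [fund] gives [theta]. *)
Lemma weakly_kahler_thetaP :
  weakly_kahler A F <-> forall z eta, A z eta -> forall i, theta F i z eta = 0.
Proof.
have alg (a b c x y : C) : (a * (b - c) * x * y^*)^* = a^* * (b^* - c^*) * y * x^*.
  by rewrite !conjCM conjCB conjcK mulrAC.
have E z eta k : A z eta -> (\sum_i \sum_l \sum_j
      fund F z eta i l * (conn_coef F i j k z eta - conn_coef F i k j z eta)
      * eta 0 j * (eta 0 l)^*)^* = theta_low k z eta.
  move=> Az; rewrite conjC_sum; under eq_bigr do rewrite conjC_sum.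
  rewrite exchange_big /=; apply: eq_bigr => r _; apply: eq_bigr => p _.
  rewrite conjC_sum; apply: eq_bigr => j _.
  apply: etrans (alg _ _ _ _ _) _.
  exact: (congr1 (fun a => a * _ * _ * _) (fund_conj FA _ _ Az)).
split=> H z eta Az.
  move=> i; rewrite thetaE big1// => m _.
  by rewrite -E// (H z eta Az m) conjc0 mulr0.
move=> k; apply/eqP; rewrite -conjc_eq0 E// -lower_theta//.
by rewrite big1// => i _; rewrite H// mul0r.
Qed.

Lemma conn_sum_fst i k z eta : A z eta ->
  \sum_j conn_coef F i j k z eta * eta 0 j = N i k z eta.
Proof.
move=> Az; under eq_bigr do rewrite conn_coefE.
by apply: (euler10 FA (sN i k)) Az => *; exact: nonlin_scale.
Qed.

Lemma De_spray k i z eta : A z eta ->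
  2 * De k (G i) z eta = \sum_j conn_coef F i k j z eta * eta 0 j + N i k z eta.
Proof.
move=> Az.
have E : De k (fun z eta => 2 * G i z eta) z eta =
    De k (fun z eta => \sum_j N i j z eta * eta 0 j) z eta.
  apply: (bwirt_ext oA _ _ _ _ Az); last by auto with bsm.
  by move=> z' eta' Az'; exact: sprayE.
move: E; rewrite (bwirtM _ _ (bsmooth_cst A 2) (sG i) Az) bwirt_cst mul0r add0r => ->.
rewrite (bwirt_sum oA _ _ _ _ Az); last by auto with bsm.
transitivity (\sum_j (conn_coef F i k j z eta * eta 0 j + N i j z eta * (k == j)%:R)).
  apply: eq_bigr => j _.
  by rewrite (bwirtM _ _ (sN i j) (bsmooth_eta A j) Az) De_eta conn_coefE.
rewrite big_split; apply: (congr1 (fun a => _ + a)).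
exact: sum_delta.
Qed.

Lemma euler_spray i z eta : A z eta -> \sum_k De k (G i) z eta * eta 0 k = 2 * G i z eta.
Proof.
move=> Az; have two0 : 2 != 0 :> C by rewrite pnatr_eq0.
apply: (mulfI two0); rewrite mulr_sumr.
under eq_bigr do rewrite mulrA De_spray// mulrDl.
have E2 (x : C) : 2 * x = x + x by ring.
rewrite big_split /= -sprayE (E2 (2 * G i z eta)); apply: (congr1 (fun a => a + _)).
under eq_bigr do rewrite mulr_suml.
rewrite exchange_big /= sprayE; apply: eq_bigr => j _.
rewrite -conn_sum_fst// mulr_suml; apply: eq_bigr => k _; exact: mulrAC.
Qed.

(** By [De_spray], [2 * (N i k - De k (G i))] is the torsion contracted with [eta]. The weak Kaehler
    condition kills its pairing with [De i L], so [De k (G i)] may replace [N i k] in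
    [nonlin_energy]. *)
Lemma weakly_kahler_energy : weakly_kahler A F ->
  forall k z eta, A z eta ->
  Dz k L z eta = \sum_p De p L z eta * De k (G p) z eta.
Proof.
move=> wk k z eta Az; have := wk z eta Az k.
have -> : \sum_i \sum_l \sum_j
      fund F z eta i l * (conn_coef F i j k z eta - conn_coef F i k j z eta)
      * eta 0 j * (eta 0 l)^* =
    \sum_i De i L z eta * (2 * N i k z eta - 2 * De k (G i) z eta).
  apply: eq_bigr => i _; rewrite exchange_big /=.
  have -> : 2 * N i k z eta - 2 * De k (G i) z eta =
     \sum_j (conn_coef F i j k z eta - conn_coef F i k j z eta) * eta 0 j.
    have alg (a b : C) : 2 * a - (b + a) = a - b by ring.
    rewrite (De_spray k i Az); transitivity (N i k z eta -
      \sum_j conn_coef F i k j z eta * eta 0 j); first exact: alg.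
    rewrite -(conn_sum_fst i k Az) -sumrB; apply: eq_bigr => j _.
    by rewrite mulrBl.
  rewrite mulr_sumr; apply: eq_bigr => j _.
  rewrite -(fund_eta_conj FA i Az) mulr_suml; apply: eq_bigr => l _.
  have alg (a b c d : C) : a * b * c * d = a * d * (b * c) by ring.
  exact: alg.
under eq_bigr do rewrite -mulrBr mulrCA mulrBr.
rewrite -mulr_sumr => /eqP; rewrite mulf_eq0 pnatr_eq0 /= sumrB subr_eq0 => /eqP <-.
rewrite -(nonlin_energy FA k Az); apply: eq_bigr => i _; exact: mulrC.
Qed.

(** * Connections whose coefficients depend on the base point alone *)

Section Flat.
Variable Gam : 'I_n -> 'I_n -> 'I_n -> V -> C.
Hypothesis sGam : forall i l j, bsmooth A (fun z _ => Gam i l j z).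

(** Apply [Eb m] to the hypothesis: the linear connection is holomorphic along the fibre, so only
    [De i L] is differentiated and becomes [fund]; nondegeneracy then identifies [N]. All
    connections below are recognized in this way. *)
Lemma nonlin_of_parallel :
  (forall j z eta, A z eta -> Dz j L z eta =
     \sum_i De i L z eta * \sum_l Gam i l j z * eta 0 l) ->
  forall i j z eta, A z eta -> N i j z eta = \sum_l Gam i l j z * eta 0 l.
Proof.
move=> H i j z eta Az; move: i; apply: (fund_inj FA Az) => m.
rewrite (lower_nonlin FA j m Az) -(bwirtC oA _ _ _ _ sL Az).
have E : Eb m (Dz j L) z eta =
    Eb m (fun z eta => \sum_i De i L z eta * \sum_l Gam i l j z * eta 0 l) z eta.
  by apply: (bwirt_ext oA _ _ _ _ Az) => [z' eta' Az'|]; [exact: H|auto with bsm].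
have sS i : bsmooth A (fun z eta => \sum_l Gam i l j z * eta 0 l).
  by auto with bsm.
rewrite E (bwirt_sum oA _ _ _ _ Az); last by auto with bsm.
apply: eq_bigr => i _; rewrite (bwirtM _ _ _ (sS i) Az); last by auto with bsm.
rewrite (bwirt_sum oA _ _ _ _ Az); last by auto with bsm.
rewrite [X in _ + _ * X]big1 ?mulr0 ?addr0; last first.
  move=> l _; rewrite (bwirtM _ _ (sGam i l j) (bsmooth_eta A l) Az).
  by rewrite bwirt_base_fibre Eb_eta mul0r mulr0 addr0.
by rewrite (bwirtC oA _ _ _ _ sL Az) -fundE mulrC.
Qed.

Hypothesis NGam : forall i j z eta, A z eta ->
  N i j z eta = \sum_l Gam i l j z * eta 0 l.

Lemma conn_flat i j k z eta : A z eta -> conn_coef F i j k z eta = Gam i j k z.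
Proof.
move=> Az; rewrite conn_coefE.
rewrite (bwirt_ext oA _ _ (fun z' eta' => @NGam i k z' eta') (sN i k) Az).
rewrite (bwirt_sum oA _ _ _ _ Az); last by auto with bsm.
rewrite -(sum_delta (fun l => Gam i l k z) j); apply: eq_bigr => l _.
by rewrite (bwirtM _ _ (sGam i l k) (bsmooth_eta A l) Az) bwirt_base_fibre De_eta mul0r add0r.
Qed.

Lemma spray_flat i z eta : A z eta ->
  G i z eta = 2^-1 * \sum_j \sum_l Gam i l j z * eta 0 l * eta 0 j.
Proof.
move=> Az; congr (_ * _); apply: eq_bigr => j _.
by rewrite NGam// mulr_suml.
Qed.

Lemma flat_generalized_berwald : generalized_berwald A F.
Proof.
move=> z eta Az i r; rewrite dzbE.
apply: etrans (wirt_fibre ii r (G i) z eta) _.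
rewrite (bwirt_ext oA _ _ (fun z' eta' => @spray_flat i z' eta') (sG i) Az).
rewrite (bwirtM _ _ (bsmooth_cst A _) _ Az); last by auto 8 with bsm.
rewrite bwirt_cst mul0r add0r (bwirt_sum oA _ _ _ _ Az); last by auto 8 with bsm.
rewrite big1 ?mulr0// => j _.
rewrite (bwirt_sum oA _ _ _ _ Az); last by auto 8 with bsm.
rewrite big1// => l _.
rewrite (bwirtM _ _ _ (bsmooth_eta A j) Az); last by auto with bsm.
rewrite (bwirtM _ _ (sGam i l j) (bsmooth_eta A l) Az).
by rewrite bwirt_base_fibre !Eb_eta !(mul0r, mulr0, addr0).
Qed.

Lemma flat_weakly_kahler :
  (forall z eta, A z eta -> forall i j k, Gam i j k z = Gam i k j z) ->
  weakly_kahler A F.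
Proof.
move=> sym z eta Az k; rewrite big1// => i _; rewrite big1// => l _.
rewrite big1// => j _.
by rewrite !conn_flat// (sym z eta Az) subrr mulr0 !mul0r.
Qed.

Lemma flat_hol_curv z eta : A z eta ->
  (forall i j k r, dzb r (Gam i j k) z = 0) -> hol_curv F z eta = 0.
Proof.
move=> Az dG; rewrite /hol_curv big1 ?mulr0// => k _; rewrite big1// => m _.
rewrite big1// => r _.
suff -> : dzb r (fun z1 => G k z1 eta) z = 0 by rewrite mulr0 !mul0r.
rewrite dzbE (wirt_base ii r (G k)).
rewrite (bwirt_ext oA _ _ (fun z' eta' => @spray_flat k z' eta') (sG k) Az).
rewrite (bwirtM _ _ (bsmooth_cst A _) _ Az); last by auto 8 with bsm.
rewrite bwirt_cst mul0r add0r (bwirt_sum oA _ _ _ _ Az); last by auto 8 with bsm.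
rewrite big1 ?mulr0// => j _.
rewrite (bwirt_sum oA _ _ _ _ Az); last by auto 8 with bsm.
rewrite big1// => l _.
rewrite (bwirtM _ _ _ (bsmooth_eta A j) Az); last by auto with bsm.
rewrite (bwirtM _ _ (sGam k l j) (bsmooth_eta A l) Az).
rewrite bwirt_base_base -dzbE dG !bwirt_eta_base.
by rewrite !(mul0r, mulr0, addr0).
Qed.

End Flat.

End FinslerConnection.

(** * Metrics projectively related to a complex Berwald metric *)

Section ProjectiveBerwald.
Context {R : realType} {n : nat}.
Local Notation C := R[i].
Local Notation V := 'rV[C]_n.
#[local] Opaque dz dzb conn_coef nonlin_conn ginv spray theta.
Variables (A B : V -> set V) (F F0 : V -> V -> R).
Hypotheses (FA : finsler_region A F) (FB : finsler_region B F0).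
Hypotheses (gb0 : generalized_berwald B F0) (wk0 : weakly_kahler B F0).
Hypothesis AB : forall z eta, A z eta -> B z eta.

(* Replacing [eta] by [i eta] changes the sign of the sprays but not of the
   torsion vector [theta], which is therefore proportional to [eta]. *)
Lemma proj_related_berwald : proj_related A F B F0 ->
  complex_berwald A F /\ exists2 P, bsmooth A P & forall z eta, A z eta ->
    forall i, spray F0 i z eta = spray F i z eta + P z eta * eta 0 i.
Proof.
move=> [P [sP H]]; have oA := region_open FA.
have eAB : (fun z => A z `&` B z) = A.
  by apply/funext => z; apply/seteqP; split => [eta []//|eta Az]; split => //; exact: AB.
rewrite eAB in sP.
have th0 := (weakly_kahler_thetaP FB).1 wk0.
have H1 z eta : A z eta -> forall i, spray F0 i z eta =
    spray F i z eta - 2^-1 * theta F i z eta + P z eta * eta 0 i.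
  move=> Az i; rewrite (H z eta (conj Az (AB Az)) i) (th0 z eta (AB Az) i).
  by rewrite sub0r mulrN.
have th z eta : A z eta -> forall i, theta F i z eta = 0.
  (* Adding [H1] at [eta] and at [ii *: eta] cancels the sprays; [c] is what remains of the two
     projective factors. *)
  move=> Az; pose c := P z eta + P z (ii *: eta) * ii.
  have E i : theta F i z eta = c * eta 0 i.
    have E1 := H1 z eta Az i.
    have E2 := H1 z (ii *: eta) (region_scale FA Az (@ii_neq0 R)) i.
    have alg (g0 g t p p' e : C) : g0 = g - 2^-1 * t + p * e ->
      ii * ii * g0 = ii * ii * g - 2^-1 * (ii * ii^* * t) + p' * (ii * e) ->
      t = (p + p' * ii) * e.
      rewrite conjC_ii mulrN iiM opprK => E1' E2'.
      apply/eqP; rewrite -subr_eq0; apply/eqP.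
      transitivity (g0 - (g - 2^-1 * t + p * e) + (-1 * g0 - (-1 * g - 2^-1 * (1 * t) + p' * (ii * e)))).
        by field.
      by rewrite -E1' -E2' !subrr addr0.
    apply: (alg (spray F0 i z eta) (spray F i z eta)) E1 _.
    have EK (a b e a' b' e' p' : C) : a = a' -> b = b' -> e = e' ->
      a - 2^-1 * b + p' * e = a' - 2^-1 * b' + p' * e' by move=> -> -> ->.
    exact: etrans (esym (spray_scale FB i (AB Az) (@ii_neq0 R))) (etrans E2
      (EK _ _ _ _ _ _ _ (spray_scale FA i Az (@ii_neq0 R))
        (theta_scale FA i Az (@ii_neq0 R)) (mxE _ _ 0 i))).
  (* Pair with the differential of [L]: [theta] gives zero by [theta_energy], while [c * eta] gives
     [c * L] by Euler's relation. *)
  have : c * energy F z eta = 0.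
    rewrite -(theta_energy FA Az) -(euler_energy FA Az) mulr_sumr.
    by apply: eq_bigr => k _; rewrite E [X in c * X]mulrC mulrA.
  move/eqP; rewrite mulf_eq0 (negbTE (energy_neq0 FA Az)) orbF => /eqP c0 i.
  by rewrite E c0 mul0r.
have E z eta : A z eta -> forall i, spray F0 i z eta =
    spray F i z eta + P z eta * eta 0 i.
  by move=> Az i; rewrite (H1 z eta Az) (th z eta Az) mulr0 subr0.
split; last by exists P.
split; last by apply/(weakly_kahler_thetaP FA).
have sG := bsmooth_spray FA.
have gE m z eta : A z eta -> forall i,
    0 = Eb m (spray F i) z eta + Eb m P z eta * eta 0 i.
  move=> Az i.
  have Z : Eb m (spray F0 i) z eta = 0.
    by rewrite -(wirt_fibre ii m (spray F0 i)) -dzbE; exact: (gb0 (AB Az) i m).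
  have Ei : Eb m (fun z eta => spray F i z eta + P z eta * eta 0 i) z eta =
      Eb m (spray F0 i) z eta.
    apply: (bwirt_ext oA _ _ _ _ Az); last by auto with bsm.
    by move=> z' eta' Az'; rewrite E.
  apply: etrans (esym Z) (etrans (esym Ei) _).
  have sPe : bsmooth A (fun z eta => P z eta * eta 0 i) by auto with bsm.
  apply: etrans (bwirtD _ _ (sG i) sPe Az) _; apply: (congr1 (fun a => _ + a)).
  by rewrite (bwirtM _ _ sP (bsmooth_eta A i) Az) Eb_eta mulr0 addr0.
move=> z eta Az i r; rewrite dzbE (wirt_fibre ii r (spray F i)).
(* Same pairing: [Eb_spray_energy] removes the spray term and leaves [Eb r P * L], with [L]
   nonzero. *)
have P0 : Eb r P z eta = 0.
  have : \sum_i (Eb r (spray F i) z eta + Eb r P z eta * eta 0 i) * De i (energy F) z eta = 0.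
    by rewrite big1// => j _; rewrite -gE// mul0r.
  under eq_bigr do rewrite mulrDl.
  rewrite big_split /= (Eb_spray_energy FA r Az) add0r.
  under eq_bigr => j _ do rewrite -mulrA [X in _ * X]mulrC.
  rewrite -mulr_sumr (euler_energy FA Az) => /eqP.
  by rewrite mulf_eq0 (negbTE (energy_neq0 FA Az)) orbF => /eqP.
by have := gE r z eta Az i; rewrite P0 mul0r addr0.
Qed.

End ProjectiveBerwald.

(** * Locally Minkowski metrics *)

Section Holomorphic.
Context {R : realType} {m : nat}.
Local Notation C := R[i].
Local Notation V := 'rV[C]_m.
Implicit Types (U : set V) (f g : V -> C) (z : V) (k : 'I_m).

Lemma smooth_dd U f z : smooth_on U f -> U z -> dd f z.
Proof. by move=> sf Uz; exact: (Ck_dd (sf 1%N) Uz). Qed.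

Lemma holomorphic_dz U f k : open U -> holomorphic_on U f -> holomorphic_on U (dz k f).
Proof.
move=> oU [sf hf].
have -> : dz k f = wirt (- ii) k f by apply/funext => z; exact: dzE.
split; first by move=> l; apply: Ck_wirt oU _; exact: sf.
move=> z Uz j; rewrite dzbE (wirtC _ _ _ _ oU (sf 2%N) Uz).
rewrite -[RHS](wirt_cst (- ii) k 0 z); apply: (wirt_near _ _ oU Uz).
  by move=> y Uy; rewrite -dzbE hf.
by apply: (@Ck_dd _ _ 0 U _ z _ Uz); apply: Ck_wirt oU _; exact: sf.
Qed.

Lemma wirt_sum U (I : Type) (r : seq I) (f : I -> V -> C) (c : C) k z : open U -> U z ->
  (forall i, smooth_on U (f i)) ->
  wirt c k (fun y => \sum_(i <- r) f i y) z = \sum_(i <- r) wirt c k (f i) z.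
Proof.
move=> oU Uz sf; elim: r => [|i r IH].
  have -> : (fun y => \sum_(i <- [::]) f i y) = fun=> 0.
    by apply/funext => y; rewrite big_nil.
  by rewrite big_nil; exact: wirt_cst.
have sr : smooth_on U (fun y => \sum_(j <- r) f j y).
  by move=> l; apply: (Ck_sum _ oU) => j; exact: sf.
have -> : (fun y => \sum_(j <- i :: r) f j y) = fun y => f i y + \sum_(j <- r) f j y.
  by apply/funext => y; rewrite big_cons.
rewrite big_cons -IH; exact: (wirtD _ _ (smooth_dd (sf i) Uz) (smooth_dd sr Uz)).
Qed.

Lemma smooth_sum U (I : Type) (r : seq I) (f : I -> V -> C) : open U ->
  (forall i, smooth_on U (f i)) -> smooth_on U (fun y => \sum_(i <- r) f i y).
Proof. by move=> oU sf l; apply: (Ck_sum _ oU) => j; exact: sf. Qed.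

Lemma smoothM U f g : open U -> smooth_on U f -> smooth_on U g ->
  smooth_on U (fun z => f z * g z).
Proof. by move=> oU sf sg k; exact: (CkM oU (sf k) (sg k)). Qed.

Lemma holomorphicM U f g : open U -> holomorphic_on U f -> holomorphic_on U g ->
  holomorphic_on U (fun z => f z * g z).
Proof.
move=> oU [sf hf] [sg hg]; split; first exact: smoothM.
move=> z Uz k; rewrite dzbE (wirtM _ _ (smooth_dd sf Uz) (smooth_dd sg Uz)).
by rewrite -!dzbE hf// hg// mulr0 mul0r addr0.
Qed.

Lemma holomorphic_sum U (I : Type) (r : seq I) (f : I -> V -> C) : open U ->
  (forall i, holomorphic_on U (f i)) -> holomorphic_on U (fun y => \sum_(i <- r) f i y).
Proof.
move=> oU hf; split; first by apply: smooth_sum => // i; exact: (hf i).1.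
move=> z Uz k; rewrite dzbE (wirt_sum _ _ _ oU Uz (fun i => (hf i).1)).
by apply: big1 => i _; rewrite -dzbE; exact: (hf i).2.
Qed.

Lemma holomorphic_cst U (c : C) : holomorphic_on U (fun=> c).
Proof. by split => [k|z _ k]; [exact: Ck_cst|rewrite dzbE wirt_cst]. Qed.

End Holomorphic.

Section HolomorphicComposition.
Context {R : realType} {m p : nat}.
Local Notation C := R[i].
Implicit Types (f : 'rV[C]_m -> C) (g : 'rV[C]_p -> 'rV[C]_m).

Lemma wirt_comp (U : set 'rV[C]_m) f g (z : 'rV[C]_p) (c : C) j :
  open U -> Ck_on 1 U f -> U (g z) ->
  (forall k, dd (fun y => g y 0 k) z) ->
  wirt c j (fun y => f (g y)) z =
  \sum_k (dz k f (g z) * wirt c j (fun y => g y 0 k) z +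
          dzb k f (g z) * (wirt (c^*) j (fun y => g y 0 k) z)^*).
Proof.
Transparent wirt.
move=> oU Hf Ugz dg; rewrite /wirt.
have D v := is_ddir_val (is_ddir_comp oU Hf Ugz (fun k => dg k v)).
rewrite !D mulr_sumr -big_split /= mulr_sumr; apply: eq_bigr => k _.
rewrite conjCM conjCD conjC_half conjCM conjcK.
move: (dz _ _ _) (dzb _ _ _) (ddir _ _ _) (ddir _ _ _) => a b x y.
by move: (x^*) (y^*) => x' y'; ring.
Opaque wirt.
Qed.

Lemma dz_comp_holomorphic (U : set 'rV[C]_m) (U' : set 'rV[C]_p) f g z j :
  open U -> Ck_on 1 U f -> U' z -> U (g z) ->
  (forall k, holomorphic_on U' (fun y => g y 0 k)) ->
  dz j (fun y => f (g y)) z = \sum_k dz k f (g z) * dz j (fun y => g y 0 k) z.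
Proof.
move=> oU Hf U'z Ugz hg.
have dg k : dd (fun y => g y 0 k) z by apply: smooth_dd U'z; exact: (hg k).1.
rewrite dzE (wirt_comp _ _ oU Hf Ugz dg); apply: eq_bigr => k _.
by rewrite conjCN conjC_ii opprK -dzE -dzbE (hg k).2// conjc0 mulr0 addr0.
Qed.

Lemma holomorphic_comp (U : set 'rV[C]_m) (U' : set 'rV[C]_p) f g :
  open U -> open U' -> (forall z, U' z -> U (g z)) -> holomorphic_on U f ->
  (forall k, holomorphic_on U' (fun y => g y 0 k)) ->
  holomorphic_on U' (fun y => f (g y)).
Proof.
move=> oU oU' gU [sf hf] hg; split.
  by move=> k; apply: (Ck_comp oU oU' gU (sf k)) => j; exact: (hg j).1.
move=> z U'z j.
have dg k : dd (fun y => g y 0 k) z by apply: smooth_dd U'z; exact: (hg k).1.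
rewrite dzbE (wirt_comp _ _ oU (sf 1%N) (gU z U'z) dg) big1// => k _.
by rewrite -dzbE (hg k).2// mulr0 hf ?mul0r ?addr0//; exact: gU.
Qed.

End HolomorphicComposition.

#[local] Opaque dz dzb nonlin_conn.

Section SlitRegion.
Context {R : realType} {n : nat}.
Local Notation C := R[i].
Local Notation V := 'rV[C]_n.
Implicit Types (z eta : V) (U D : set V).

Lemma open_base U : open U -> open [set p : 'rV[C]_(n + n) | U (lsubmx p)].
Proof.
move=> /open_vabs1P oU; apply/open_vabs1P => p /= /oU [e e0 he]; exists e => // w wp.
apply: he; apply: le_lt_trans wp.
rewrite /vabs1 big_split_ord /=; apply: ler_wpDr.
  by rewrite sumr_ge0// => k _; exact: abs1_ge0.
by apply: ler_sum => k _; rewrite !mxE.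
Qed.

Lemma rV_neq0 m (v : 'rV[C]_m) : v != 0 -> exists j, v 0 j != 0.
Proof.
move=> v0; apply: contrapT => H; move: v0 => /negP; apply; apply/eqP/rowP => j.
by rewrite mxE; apply/eqP; apply: contrapT => vj; apply: H; exists j; apply/negP.
Qed.

Lemma open_slit U : open U -> open (Defs.total (slit U)).
Proof.
move=> oU; apply/open_vabs1P => p [/= Up /rV_neq0 [j pj]].
have oj : open [set q : 'rV[C]_(n + n) | U (lsubmx q) /\ q 0 (rshift n j) != 0].
  apply: (@open_neq0 _ _ [set q | U (lsubmx q)]); first exact: open_base.
  by move=> q _; exact: (Ck_cont (Ck_coord 0 setT _)).
have pj' : p 0 (rshift n j) != 0 by move: pj; rewrite mxE.
have [e e0 he] := (open_vabs1P _).1 oj p (conj Up pj').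
exists e => // w /he [Uw wj]; split => //=.
by apply: contra_neq wj => w0; have /rowP /(_ j) := w0; rewrite !mxE.
Qed.

Lemma smooth_fibre (A : V -> set V) (f : V -> V -> C) z : open (Defs.total A) ->
  bsmooth A f -> smooth_on (A z) (f z).
Proof.
move=> oA sf k.
have -> : f z = fun eta => flat f (row_mx z eta) by apply/funext => eta; rewrite flat_row.
apply: (Ck_comp oA (@total_open_fibre _ _ _ oA z) _ (sf k)) => [eta|j]; first exact: total_row.
case: (split_ordP j) => i ->.
  by under eq_fun do rewrite row_mxEl; exact: Ck_cst.
by under eq_fun do rewrite row_mxEr; exact: Ck_coord.
Qed.

Lemma posdef_unitmx (H : 'M[C]_n) : posdef H -> H \in unitmx.
Proof.
move=> pH; rewrite -row_free_unit -kermx_eq0; apply/eqP/row_matrixP => i.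
rewrite row0; apply/eqP; apply: contrapT => /negP ki.
have := pH _ ki; have /matrixP kH : row i (kermx H) *m H = 0.
  by rewrite -row_mul mulmx_ker row0.
suff -> : hform H (row i (kermx H)) = 0 by rewrite ltxx.
rewrite /hform exchange_big /= big1// => j _; rewrite -mulr_suml.
have := kH 0 j; rewrite mxE [RHS]mxE => E.
by under eq_bigr do rewrite mulrC; rewrite E mul0r.
Qed.

Lemma finsler_slit_region D U (F : V -> V -> R) : open U -> U `<=` D ->
  complex_finsler D F -> finsler_region (slit U) F.
Proof.
move=> oU UD [_ Fz _ Fs Fh Fp].
have oS := open_slit oU.
split; first split => //.
- by move=> z eta l [Uz e0] l0; split => //; rewrite scaler_eq0 negb_or l0.
- have sF : bsmooth (slit U) (fun z eta => (F z eta)%:C).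
    by move=> k; apply: Ck_sub (Fs k) => p [/= /UD Dp p0].
  apply: (bsmooth_ext oS (f := fun z eta => (F z eta)%:C * (F z eta)%:C)).
    by move=> z eta _; rewrite /energy expr2 rmorphM.
  exact: (bsmoothM oS sF sF).
- by move=> z eta l [/UD zD _]; exact: Fh.
- by move=> z eta [/UD zD e0]; apply: contra_neq e0; exact: (Fz z eta zD).1.
- by move=> z eta [/UD zD e0]; apply: posdef_unitmx; exact: Fp.
Qed.

Lemma energy_quadratic (A : V -> set V) (F : V -> V -> R) z eta :
  energy_region A F -> A z eta -> energy F z eta =
  \sum_k \sum_m fund F z eta k m * (eta 0 m)^* * eta 0 k.
Proof.
move=> FA Az; rewrite -(euler_energy FA Az); apply: eq_bigr => k _.
by rewrite -(fund_eta_conj FA k Az) mulr_suml.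
Qed.

Lemma dz_coord m (k j : 'I_m) (z : 'rV[C]_m) : dz k (fun y => y 0 j) z = (k == j)%:R.
Proof.
by rewrite dzE wirt_coord mulNr iiM opprK -[1 + 1]/(2%:R) mulVf ?mul1r// pnatr_eq0.
Qed.

Lemma holomorphic_coord m (U : set 'rV[C]_m) j : holomorphic_on U (fun y => y 0 j).
Proof.
split=> [k|z _ k]; first exact: Ck_coord.
by rewrite dzbE wirt_coord iiM subrr mulr0 mul0r.
Qed.

Lemma jacobian_inverse (U U' : set V) (phi psi : V -> V) i j z :
  open U -> open U' -> (forall z, U z -> U' (phi z)) ->
  (forall z, U z -> psi (phi z) = z) ->
  (forall i, holomorphic_on U (fun z => phi z 0 i)) ->
  (forall i, holomorphic_on U' (fun z => psi z 0 i)) -> U z ->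
  \sum_k dz k (fun w => psi w 0 i) (phi z) * dz j (fun z => phi z 0 k) z = (j == i)%:R.
Proof.
move=> oU oU' UU' K hphi hpsi Uz.
rewrite -(dz_comp_holomorphic j oU' ((hpsi i).1 1%N) Uz (UU' z Uz) hphi).
rewrite -(dz_coord j i z) !dzE; apply/esym.
apply: (wirt_near _ _ oU Uz) => [y Uy|]; first by rewrite K.
by apply: (smooth_dd (U := U)) => //; exact: (holomorphic_coord U i).1.
Qed.

End SlitRegion.

Section Minkowski.
Context {R : realType} {n : nat}.
Local Notation C := R[i].
Local Notation V := 'rV[C]_n.
Variables (D : set V) (F0 : V -> V -> R).
Hypotheses (oD : open D) (cF0 : complex_finsler D F0).

Section Chart.
Variables (U U' : set V) (phi psi : V -> V).
Hypothesis chart : local_chart D U U' phi psi.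
Let oU := chart_open chart.
Let oU' := chart_open' chart.
Let hphi := chart_holo chart.
Let hpsi := chart_holo' chart.

Definition jac (f : V -> V) i k z : C := dz k (fun y => f y 0 i) z.

Definition push (f : V -> V) z (eta : V) : V := \row_i \sum_j jac f i j z * eta 0 j.

Lemma holomorphic_jac (W : set V) (f : V -> V) i k : open W -> (forall i, holomorphic_on W (fun z => f z 0 i)) ->
  holomorphic_on W (jac f i k).
Proof. by move=> oW hf; exact: (holomorphic_dz k oW (hf i)). Qed.

Lemma jac_psi_phi i j z : U z -> \sum_k jac psi i k (phi z) * jac phi k j z = (j == i)%:R.
Proof.
exact: (jacobian_inverse i j oU oU' (chart_to chart) (chartK chart) hphi hpsi).
Qed.

Lemma jac_phi_psi i j z : U z -> \sum_k jac phi i k z * jac psi k j (phi z) = (j == i)%:R.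
Proof.
move=> Uz; have := jacobian_inverse i j oU' oU (chart_from chart) (chartVK chart)
  hpsi hphi (chart_to chart Uz).
by rewrite (chartK chart Uz).
Qed.

Lemma push_psi_phi z eta : U z -> push psi (phi z) (push phi z eta) = eta.
Proof.
move=> Uz; apply/rowP => i; rewrite mxE.
under eq_bigr do rewrite mxE mulr_sumr.
rewrite exchange_big /= -(sum_delta (fun j => eta 0 j) i); apply: eq_bigr => j _.
rewrite eq_sym -(jac_psi_phi i j Uz) mulrC mulr_suml; apply: eq_bigr => k _.
by rewrite mulrA.
Qed.

Lemma push0 (f : V -> V) z : push f z 0 = 0.
Proof. by apply/rowP => i; rewrite !mxE big1// => j _; rewrite mxE mulr0. Qed.

Lemma push_phi_neq0 z eta : U z -> eta != 0 -> push phi z eta != 0.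
Proof.
by move=> Uz; apply: contra_neq => e0; rewrite -(push_psi_phi eta Uz) e0 push0.
Qed.

Lemma push_psi_neq0 w zeta : U' w -> zeta != 0 -> push psi w zeta != 0.
Proof.
move=> Uw; apply: contra_neq => e0.
have : push phi (psi w) (push psi w zeta) = zeta.
  apply/rowP => i; rewrite mxE.
  under eq_bigr do rewrite mxE mulr_sumr.
  rewrite exchange_big /= -(sum_delta (fun j => zeta 0 j) i); apply: eq_bigr => j _.
  have := jac_phi_psi i j (chart_from chart Uw); rewrite (chartVK chart Uw) => E.
  rewrite eq_sym -E mulrC mulr_suml; apply: eq_bigr => k _.
  by rewrite mulrA.
by rewrite e0 push0.
Qed.

Lemma pushZ (f : V -> V) z (l : C) eta : push f z (l *: eta) = l *: push f z eta.
Proof.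
apply/rowP => i; rewrite !mxE mulr_sumr; apply: eq_bigr => j _.
by rewrite mxE mulrCA.
Qed.

Lemma in_chartE w zeta : in_chart psi F0 w zeta = F0 (psi w) (push psi w zeta).
Proof. by []. Qed.

Lemma chart_energy_region : energy_region (slit U') (in_chart psi F0).
Proof.
have oS := open_slit oU'.
have sub w : U' w -> D (psi w) by move=> /(chart_from chart)/(chart_sub chart).
split => //.
- by move=> z eta l [Uz e0] l0; split => //; rewrite scaler_eq0 negb_or l0.
- have := finsler_slit_region oD (@subset_refl _ D) cF0 => FD.
  pose g (p : 'rV[C]_(n + n)) := row_mx (psi (lsubmx p)) (push psi (lsubmx p) (rsubmx p)).
  have sF := region_smooth FD.
  move=> k; have -> : (fun p : 'rV[C]_(n + n) => energy (in_chart psi F0) (lsubmx p) (rsubmx p)) =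
      fun p => flat (energy F0) (g p).
    by apply/funext => p; rewrite /g flat_row.
  apply: (Ck_comp (region_open FD) oS _ (sF k)) => [p [/= Up p0]|j].
    rewrite /Defs.total /= /slit row_mxKl row_mxKr; split; first exact: sub.
    exact: push_psi_neq0.
  case: (split_ordP j) => i ->.
    under eq_fun do rewrite row_mxEl.
    by apply: (bsmooth_base oS oU' _ (hpsi i).1) => ? ? [].
  under eq_fun do rewrite row_mxEr mxE.
  have sJ l : bsmooth (slit U') (fun z _ => jac psi i l z).
    by apply: (bsmooth_base oS oU' _ (holomorphic_jac i l oU' hpsi).1) => ? ? [].
  have : bsmooth (slit U') (fun z eta => \sum_l jac psi i l z * eta 0 l) by auto with bsm.
  by apply.
- move=> z eta l [Uz e0]; rewrite !in_chartE pushZ.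
  exact: (finsler_homog cF0 _ _ (sub z Uz)).
- move=> z eta [Uz e0]; rewrite in_chartE.
  by apply: contra_neq (push_psi_neq0 Uz e0) => /(finsler_eq0 cF0 _ (sub z Uz)).
Qed.

Hypothesis flat_chart : forall w w' zeta, U' w -> U' w' -> zeta != 0 ->
  fund (in_chart psi F0) w zeta = fund (in_chart psi F0) w' zeta.

Variables (z0 : V) (Uz0 : U z0).

(** Matrix of the identification of the tangent spaces at [z] and [z0] through equal chart
    components, written in the ambient coordinates. *)
Definition trans i l z : C := \sum_k jac psi i k (phi z0) * jac phi k l z.

Definition transport z (eta : V) : V := \row_i \sum_l trans i l z * eta 0 l.

Lemma transportE z eta : transport z eta = push psi (phi z0) (push phi z eta).
Proof.
apply/rowP => i; rewrite !mxE.
under [RHS]eq_bigr do rewrite mxE mulr_sumr.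
rewrite [RHS]exchange_big /=; apply: eq_bigr => l _; rewrite mulr_suml.
by apply: eq_bigr => k _; rewrite mulrA.
Qed.

Lemma transport_neq0 z eta : U z -> eta != 0 -> transport z eta != 0.
Proof.
move=> Uz e0; rewrite transportE; apply: push_psi_neq0; first exact: (chart_to chart).
exact: push_phi_neq0.
Qed.

(* By homogeneity the energy is determined by the fundamental tensor, which a
   Minkowski chart makes independent of the base point. *)
Lemma energy_transport z eta : U z -> eta != 0 ->
  energy F0 z eta = energy F0 z0 (transport z eta).
Proof.
move=> Uz e0; rewrite transportE.
have E w : U w -> energy F0 w (push psi (phi w) (push phi z eta)) =
    energy (in_chart psi F0) (phi w) (push phi z eta).
  by move=> Uw; rewrite /energy in_chartE (chartK chart Uw).
have p0 := push_phi_neq0 Uz e0.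
have Ur := chart_to chart.
have Q w : U' w -> energy (in_chart psi F0) w (push phi z eta) = _ :=
  fun Uw => energy_quadratic chart_energy_region (conj Uw p0).
rewrite -[in LHS](push_psi_phi eta Uz) (E z Uz) (E z0 Uz0) (Q _ (Ur _ Uz)) (Q _ (Ur _ Uz0)).
by rewrite (flat_chart (Ur _ Uz) (Ur _ Uz0) p0).
Qed.

(** Christoffel symbols of the flat connection for which the coordinate frame of the chart is
    parallel. *)
Definition chart_christoffel p l j z : C :=
  \sum_q jac psi p q (phi z) * dz j (jac phi q l) z.

Lemma holomorphic_christoffel p l j : holomorphic_on U (chart_christoffel p l j).
Proof.
apply: (holomorphic_sum _ oU) => q; apply: (holomorphicM oU).
  exact: (holomorphic_comp oU' oU (chart_to chart) (holomorphic_jac p q oU' hpsi) hphi).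
exact: (holomorphic_dz j oU (holomorphic_jac q l oU hphi)).
Qed.

Lemma christoffel_sym p l j z : U z -> chart_christoffel p l j z = chart_christoffel p j l z.
Proof.
move=> Uz; apply: eq_bigr => q _; apply: (congr1 (fun a => _ * a)).
have E a : jac phi q a = wirt (- ii) a (fun y => phi y 0 q).
  by apply/funext => y; exact: dzE.
by rewrite !dzE !E (wirtC _ _ _ _ oU ((hphi q).1 2%N) Uz).
Qed.

(** The equation of parallel transport for [trans]: the Jacobian of [phi] inside [trans] cancels the
    Jacobian of [psi] inside the Christoffel symbols. *)
Lemma trans_christoffel i l j z : U z ->
  \sum_p trans i p z * chart_christoffel p l j z = dz j (trans i l) z.
Proof.
move=> Uz; have hJ k a := holomorphic_jac k a oU hphi.
have -> : dz j (trans i l) z = \sum_k jac psi i k (phi z0) * dz j (jac phi k l) z.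
  rewrite dzE (wirt_sum _ _ _ oU Uz); last first.
    by move=> k; apply: (smoothM oU); [exact: (holomorphic_cst U _).1|exact: (hJ k l).1].
  apply: eq_bigr => k _.
  rewrite (wirtM _ _ (smooth_dd (holomorphic_cst U _).1 Uz) (smooth_dd (hJ k l).1 Uz)).
  by rewrite wirt_cst mul0r add0r -dzE.
under eq_bigr do rewrite mulr_suml.
rewrite exchange_big /=; apply: eq_bigr => k _.
rewrite /chart_christoffel.
under eq_bigr do rewrite mulr_sumr.
rewrite exchange_big /= -(sum_delta (fun q => dz j (jac phi q l) z) k) mulr_sumr.
apply: eq_bigr => q _; rewrite eq_sym -(jac_phi_psi k q Uz) !mulr_sumr.
have alg (a b c d : C) : a * b * (c * d) = a * (d * (b * c)) by ring.
by apply: eq_bigr => p _; exact: alg.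
Qed.

(** Differentiate [energy_transport] in [z] and in [eta]. Both derivatives are combinations of the
    same numbers [a i], the fibre derivatives at [z0], and [trans_christoffel] turns one combination
    into the other. *)
Lemma minkowski_parallel j z eta : slit U z eta -> Dz j (energy F0) z eta =
  \sum_i De i (energy F0) z eta * \sum_l chart_christoffel i l j z * eta 0 l.
Proof.
move=> [Uz e0].
have FD := finsler_slit_region oD (@subset_refl _ D) cF0.
have FU := finsler_slit_region oU (chart_sub chart) cF0.
have oS : open [set eta : V | slit D z0 eta] := @total_open_fibre _ _ _ (region_open FD) z0.
have sE : smooth_on [set eta : V | slit D z0 eta] (energy F0 z0).
  exact: (@smooth_fibre _ _ (slit D) (energy F0) z0 (region_open FD) (region_smooth FD)).
have Dz0 := chart_sub chart Uz0.
have hT i l : holomorphic_on U (trans i l).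
  apply: (holomorphic_sum _ oU) => k; apply: (holomorphicM oU); first exact: holomorphic_cst.
  exact: (holomorphic_jac k l oU hphi).
pose a i := dz i (energy F0 z0) (transport z eta).
have St : slit D z0 (transport z eta) by split => //; exact: transport_neq0.
have E1 : Dz j (energy F0) z eta = \sum_i a i * \sum_l dz j (trans i l) z * eta 0 l.
  have hg i : holomorphic_on U (fun z1 => transport z1 eta 0 i).
    have -> : (fun z1 => transport z1 eta 0 i) = fun z1 => \sum_l trans i l z1 * eta 0 l.
      by apply/funext => z1; rewrite mxE.
    apply: (holomorphic_sum _ oU) => l; apply: (holomorphicM oU) => //.
    exact: holomorphic_cst.
  rewrite -wirt_base.
  have := dz_comp_holomorphic (f := energy F0 z0) (g := fun z1 => transport z1 eta)
    j oS (sE 1%N) Uz St hg.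
  rewrite dzE => E.
  transitivity (wirt (- ii) j (fun z1 => energy F0 z0 (transport z1 eta)) z).
    apply: (wirt_near _ _ oU Uz) => [y Uy|v]; first exact: energy_transport.
    have := bsmooth_dd (region_smooth FU) (conj Uz e0 : slit U z eta) (row_mx v 0).
    rewrite /dderivable; congr curve_derivable; apply/funext => t.
    by rewrite scale_row_mx scaler0 add_row_mx addr0 flat_row.
  rewrite E; apply: eq_bigr => i _; apply: (congr1 (fun b => a i * b)).
  have -> : (fun z1 => transport z1 eta 0 i) = fun z1 => \sum_l trans i l z1 * eta 0 l.
    by apply/funext => z1; rewrite mxE.
  rewrite dzE (wirt_sum _ _ _ oU Uz); last first.
    by move=> l; apply: (smoothM oU); [exact: (hT i l).1|exact: (holomorphic_cst U _).1].
  apply: eq_bigr => l _.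
  rewrite (wirtM _ _ (smooth_dd (hT i l).1 Uz) (smooth_dd (holomorphic_cst U _).1 Uz)).
  by rewrite wirt_cst mulr0 addr0 -dzE.
have E2 p : De p (energy F0) z eta = \sum_i a i * trans i p z.
  have oz : open [set eta : V | slit U z eta] := @total_open_fibre _ _ _ (region_open FU) z.
  have hg i : holomorphic_on [set eta : V | slit U z eta] (fun e1 => transport z e1 0 i).
    have -> : (fun e1 => transport z e1 0 i) = fun e1 => \sum_l trans i l z * e1 0 l.
      by apply/funext => z1; rewrite mxE.
    apply: (holomorphic_sum _ oz) => l; apply: (holomorphicM oz).
      exact: holomorphic_cst.
    exact: holomorphic_coord.
  rewrite -(wirt_fibre (- ii) p (energy F0)).
  have Sz : slit U z eta by [].
  have := dz_comp_holomorphic (f := energy F0 z0) (g := fun e1 => transport z e1)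
    p oS (sE 1%N) (Sz : [set eta : V | slit U z eta] eta) St hg.
  rewrite dzE => E.
  transitivity (wirt (- ii) p (fun e1 => energy F0 z0 (transport z e1)) eta).
    apply: (wirt_near _ _ oz Sz) => [y [Uy y0]|]; first exact: energy_transport.
    by apply: (smooth_dd _ Sz); exact: (@smooth_fibre _ _ (slit U) (energy F0) z (region_open FU) (region_smooth FU)).
  rewrite E; apply: eq_bigr => i _; apply: (congr1 (fun b => a i * b)).
  have -> : (fun e1 => transport z e1 0 i) = fun e1 => \sum_l trans i l z * e1 0 l.
    by apply/funext => z1; rewrite mxE.
  rewrite dzE (wirt_sum _ _ _ openT (U := setT)) //; last first.
    move=> l; apply: (smoothM openT); first exact: (holomorphic_cst setT _).1.
    exact: (holomorphic_coord setT l).1.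
  rewrite -(sum_delta (fun l => trans i l z) p); apply: eq_bigr => l _.
  rewrite (wirtM _ _ (smooth_dd (U := setT) (holomorphic_cst setT _).1 I)
    (smooth_dd (U := setT) (holomorphic_coord setT l).1 I)).
  by rewrite wirt_cst mul0r add0r -dzE dz_coord.
rewrite E1; under [RHS]eq_bigr do rewrite E2 mulr_suml.
rewrite [RHS]exchange_big /=; apply: eq_bigr => i _.
under [RHS]eq_bigr do rewrite -mulrA.
rewrite -mulr_sumr; apply: (congr1 (fun b => a i * b)).
under [RHS]eq_bigr do rewrite mulr_sumr.
rewrite [RHS]exchange_big /=; apply: eq_bigr => l _.
rewrite -(trans_christoffel i l j Uz) mulr_suml; apply: eq_bigr => p _.
by rewrite mulrA.
Qed.

End Chart.

Lemma minkowski_flat z0 : locally_minkowski D F0 -> D z0 ->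
  exists (U : set V) (Gam : 'I_n -> 'I_n -> 'I_n -> V -> C),
  [/\ [/\ open U, U z0 & U `<=` D],
    forall i l j, holomorphic_on U (Gam i l j),
    forall i l j z, U z -> Gam i l j z = Gam i j l z &
    forall i j z eta, slit U z eta ->
      nonlin_conn F0 i j z eta = \sum_l Gam i l j z * eta 0 l].
Proof.
move=> mk Dz0; have [U [U' [phi [psi [ch Uz0 flat_ch]]]]] := mk z0 Dz0.
exists U, (chart_christoffel phi psi); split.
- by split => //; [exact: (chart_open ch)|exact: (chart_sub ch)].
- by move=> i l j; exact: (holomorphic_christoffel ch).
- by move=> i l j z Uz; exact: (christoffel_sym ch).
- have oU := chart_open ch; have oS := open_slit oU.
  have FU := finsler_slit_region oU (chart_sub ch) cF0.
  apply: (nonlin_of_parallel FU) => [i l j|j z eta Sz].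
    apply: (bsmooth_base oS oU _ (holomorphic_christoffel ch i l j).1).
    by move=> ? ? [].
  exact: (minkowski_parallel ch flat_ch Uz0 j Sz).
Qed.

End Minkowski.

#[local] Opaque conn_coef.

Section MinkowskiGlobal.
Context {R : realType} {n : nat}.
Local Notation C := R[i].
Local Notation V := 'rV[C]_n.

Lemma holomorphic_local (D : set V) (f : V -> C) :
  (forall z, D z -> exists U g, [/\ open U, U z, holomorphic_on U g &
     forall y, U y -> f y = g y]) -> holomorphic_on D f.
Proof.
move=> H; split.
  move=> k; apply: Ck_local => z /H [U [g [oU Uz hg fg]]]; exists U => //.
  by apply: Ck_ext oU _ (hg.1 k) => y Uy; rewrite fg.
move=> z /H [U [g [oU Uz hg fg]]] k.
rewrite dzbE -(wirt_near _ _ oU Uz (f := g)) -?dzbE ?(hg.2 z Uz)//.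
  by move=> y Uy; rewrite fg.
exact: smooth_dd hg.1 Uz.
Qed.

(** Each chart connection is recovered from [F0] as [conn_coef] at any nonzero vector ([conn_flat]).
    Taking the same vector [e] everywhere makes the local connections restrictions of one global
    family. *)
Lemma minkowski_global (D : set V) (F0 : V -> V -> R) : (0 < n)%N -> open D ->
  complex_finsler D F0 -> locally_minkowski D F0 ->
  exists Gam : 'I_n -> 'I_n -> 'I_n -> V -> C,
  [/\ forall i l j, holomorphic_on D (Gam i l j),
    forall i l j z, D z -> Gam i l j z = Gam i j l z &
    forall i j z eta, slit D z eta ->
      nonlin_conn F0 i j z eta = \sum_l Gam i l j z * eta 0 l].
Proof.
move=> n0 oD cF mk.
pose e : V := const_mx 1.
have e0 : e != 0.
  by apply/eqP => /rowP /(_ (Ordinal n0)); rewrite !mxE => /eqP; rewrite oner_eq0.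
pose Gam0 i l j z := conn_coef F0 i l j z e.
have loc z0 : D z0 -> exists (U : set V) (Gam : 'I_n -> 'I_n -> 'I_n -> V -> C),
  [/\ [/\ open U, U z0 & U `<=` D],
    forall i l j, holomorphic_on U (Gam i l j),
    forall i l j z, U z -> Gam i l j z = Gam i j l z,
    forall i j z eta, slit U z eta ->
      nonlin_conn F0 i j z eta = \sum_l Gam i l j z * eta 0 l &
    forall i l j z, U z -> Gam0 i l j z = Gam i l j z].
  move=> Dz0; have [U [Gam [[oU Uz0 UD] hG sG nG]]] := minkowski_flat oD cF mk Dz0.
  exists U, Gam; split => // i l j z Uz.
  have FU := finsler_slit_region oU UD cF.
  apply: (conn_flat FU _ nG) => [i' l' j'|]; last by split.
  by apply: (bsmooth_base (open_slit oU) oU _ (hG i' l' j').1) => ? ? [].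
exists Gam0; split.
- move=> i l j; apply: holomorphic_local => z /loc [U [Gam [[oU Uz _] hG _ _ E]]].
  by exists U, (Gam i l j); split => // y Uy; exact: E.
- move=> i l j z /loc [U [Gam [[oU Uz _] hG sG _ E]]].
  by rewrite !E//; exact: sG.
- move=> i j z eta [/loc [U [Gam [[oU Uz _] hG sG nG E]]] eta0].
  by rewrite nG//; apply: eq_bigr => l _; rewrite E.
Qed.

End MinkowskiGlobal.

(** * Hermitian metrics *)

Section SesquilinearZero.
Context {R : realType} {n : nat}.
Local Notation C := R[i].
Local Notation V := 'rV[C]_n.

Lemma smooth_coord (U : set V) j : smooth_on U (fun y => y 0 j).
Proof. by move=> k; exact: Ck_coord. Qed.

Lemma smooth_cst (U : set V) (c : C) : smooth_on U (fun=> c).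
Proof. by move=> k; exact: Ck_cst. Qed.

Lemma smooth_conj (U : set V) (f : V -> C) : open U -> smooth_on U f ->
  smooth_on U (fun y => (f y)^*).
Proof. by move=> oU sf k; exact: (Ck_conj oU (sf k)). Qed.

(** The second derivative in y^a and conj y^b of the form is the constant [M a b]. *)
Lemma sesquilinear_zero (U : set V) (M : 'I_n -> 'I_n -> C) (eta : V) : open U -> U eta ->
  (forall y, U y -> \sum_j \sum_l M j l * y 0 j * (y 0 l)^* = 0) ->
  forall a b, M a b = 0.
Proof.
move=> oU Ueta H a b.
have sc j := smooth_coord setT j.
have scc j := smooth_conj openT (sc j).
have sM j l : smooth_on setT (fun y : V => M j l * y 0 j * (y 0 l)^*).
  by apply: (smoothM openT) => //; apply: (smoothM openT) => //; exact: smooth_cst.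
pose f (y : V) := \sum_j \sum_l M j l * y 0 j * (y 0 l)^*.
have sf : smooth_on setT f.
  by apply: (smooth_sum _ openT) => j; apply: (smooth_sum _ openT) => l; exact: sM.
have E1 y : wirt ii b f y = \sum_j M j b * y 0 j.
  rewrite (wirt_sum _ _ _ openT I); last first.
    by move=> j; apply: (smooth_sum _ openT) => l; exact: sM.
  apply: eq_bigr => j _; rewrite (wirt_sum _ _ _ openT I (sM j)).
  rewrite -(sum_delta (fun l => M j l * y 0 j) b); apply: eq_bigr => l _.
  have sMc : smooth_on setT (fun y : V => M j l * y 0 j).
    by apply: (smoothM openT) => //; exact: smooth_cst.
  rewrite (wirtM _ _ (smooth_dd sMc I) (smooth_dd (scc l) I)).
  rewrite (wirtM _ _ (smooth_dd (smooth_cst setT _) I) (smooth_dd (sc j) I)).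
  rewrite wirt_cst wirt_coord iiM subrr mulr0 !mul0r mulr0 addr0 mul0r add0r.
  rewrite (wirt_conj _ _ (smooth_dd (sc l) I)) conjC_ii -dzE dz_coord.
  by rewrite conjc_nat.
have E2 y : wirt (- ii) a (wirt ii b f) y = M a b.
  have -> : wirt ii b f = fun y => \sum_j M j b * y 0 j by apply/funext => x; exact: E1.
  rewrite (wirt_sum _ _ _ openT I); last first.
    by move=> j; apply: (smoothM openT) => //; exact: smooth_cst.
  rewrite -(sum_delta (fun j => M j b) a); apply: eq_bigr => j _.
  rewrite (wirtM _ _ (smooth_dd (smooth_cst setT _) I) (smooth_dd (sc j) I)).
  by rewrite wirt_cst mul0r add0r -dzE dz_coord.
have sfU : smooth_on U f by move=> k; apply: Ck_sub (sf k).
have Z y : U y -> wirt ii b f y = 0.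
  move=> Uy; rewrite -[RHS](wirt_cst ii b 0 y).
  by apply: (wirt_near _ _ oU Uy) => [x Ux|]; [exact: H|exact: smooth_dd sfU Uy].
rewrite -(E2 eta) -[RHS](wirt_cst (- ii) a 0 eta).
apply: (wirt_near _ _ oU Ueta) => [x Ux|]; first exact: Z.
by apply: (@Ck_dd _ _ 0 U _ eta _ Ueta); apply: Ck_wirt oU _; exact: sfU.
Qed.

End SesquilinearZero.

Section Hermitian.
Context {R : realType} {n : nat}.
Local Notation C := R[i].
Local Notation V := 'rV[C]_n.
Implicit Types (z eta : V).

Lemma hformE (H : 'M[C]_n) eta : hform H eta = \sum_i \sum_j H i j * eta 0 i * (eta 0 j)^*.
Proof. by []. Qed.

Lemma posdef_real (H : 'M[C]_n) eta : posdef H -> (complex.Re (hform H eta))%:C = hform H eta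
  /\ 0 <= complex.Re (hform H eta).
Proof.
move=> pH; have [->|e0] := eqVneq eta 0.
  have -> : hform H 0 = 0.
    by rewrite hformE big1// => i _; rewrite big1// => j _; rewrite mxE mulr0 mul0r.
  by split.
have := pH eta e0; case: (hform H eta) => x y; rewrite ltcE /= => /andP[/eqP -> x0].
by split => //; exact: ltW.
Qed.

Lemma energy_herm (h : V -> 'M[C]_n) z eta : posdef (h z) ->
  energy (herm_norm h) z eta = hform (h z) eta.
Proof.
by move=> /(posdef_real eta)[<- h0]; rewrite /energy /herm_norm sqr_sqrtr.
Qed.

Lemma hformZ (H : 'M[C]_n) (l : C) eta : hform H (l *: eta) = l * l^* * hform H eta.
Proof.
rewrite !hformE mulr_sumr; apply: eq_bigr => i _; rewrite mulr_sumr; apply: eq_bigr => j _.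
rewrite !mxE conjCM; move: (H i j) (eta 0 i) (eta 0 j) => a b c; move: (l^*) (c^*) => *; ring.
Qed.

Variables (D : set V) (h : V -> 'M[C]_n).
Hypotheses (oD : open D) (hD : hermitian_metric D h).
Let oS := open_slit oD.
Local Notation F := (herm_norm h).

Lemma bsmooth_metric i j : bsmooth (slit D) (fun z _ => h z i j).
Proof.
by apply: (bsmooth_base oS oD _ (hermitian_smooth hD i j)) => ? ? [].
Qed.
#[local] Hint Resolve bsmooth_metric oS : bsm.

Definition herm_form z eta : C := \sum_i \sum_j h z i j * eta 0 i * (eta 0 j)^*.

Lemma bsmooth_herm_form : bsmooth (slit D) herm_form.
Proof.
have : bsmooth (slit D) (fun z eta => \sum_i \sum_j h z i j * eta 0 i * (eta 0 j)^*).
  by auto 8 with bsm.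
exact.
Qed.

Lemma energy_herm_form z eta : slit D z eta -> herm_form z eta = energy F z eta.
Proof. by move=> [zD _]; rewrite energy_herm//; exact: (hermitian_posdef hD zD). Qed.

Lemma herm_energy_region : energy_region (slit D) F.
Proof.
split=> //.
- by move=> z eta l [zD e0] l0; split => //; rewrite scaler_eq0 negb_or l0.
- exact: (bsmooth_ext oS energy_herm_form bsmooth_herm_form).
- move=> z eta l [zD e0]; rewrite /herm_norm.
  have := (posdef_real eta (hermitian_posdef hD zD)); have := hformZ (h z) l eta.
  move: (hform (h z) (l *: eta)) (hform (h z) eta) => X [x y] -> [[<-] /= x0].
  case: l => a b /=; rewrite -sqrtrM ?addr_ge0 ?sqr_ge0//.
  by congr Num.sqrt; ring.
- move=> z eta [zD e0]; rewrite gt_eqF// /herm_norm sqrtr_gt0.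
  have := hermitian_posdef hD zD e0; case: (hform (h z) eta) => x y.
  by rewrite ltcE /= => /andP[].
Qed.

Lemma bwirt_etabar (c : C) k j z eta : slit D z eta ->
  bwirt c k (fun _ eta : V => (eta 0 j)^*) z eta = (bwirt (c^*) k (fun _ eta => eta 0 j) z eta)^*.
Proof. by move=> S; rewrite (bwirt_conj _ _ (bsmooth_eta (slit D) j) S). Qed.

Lemma fund_herm z eta : slit D z eta -> fund F z eta = h z.
Proof.
move=> S; apply/matrixP => a b; rewrite fundE.
have s1 i j : bsmooth (slit D) (fun z eta => h z i j * eta 0 i) by auto with bsm.
have s2 j : bsmooth (slit D) (fun _ eta => (eta 0 j)^*) by auto with bsm.
have s3 i j : bsmooth (slit D) (fun z eta => h z i j * eta 0 i * (eta 0 j)^*).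
  by exact: (bsmoothM oS).
have s4 : bsmooth (slit D) (fun z eta => \sum_i h z i b * eta 0 i) by auto with bsm.
have E1 z' eta' : slit D z' eta' -> \sum_i h z' i b * eta' 0 i = Eb b (energy F) z' eta'.
  move=> S'.
  rewrite -(bwirt_ext oS _ _ energy_herm_form bsmooth_herm_form S').
  rewrite (bwirt_sum oS _ _ _ _ S'); last by auto 8 with bsm.
  apply: eq_bigr => i _; rewrite (bwirt_sum oS _ _ _ _ S'); last by auto 8 with bsm.
  rewrite -(sum_delta (fun j => h z' i j * eta' 0 i) b); apply: eq_bigr => j _.
  rewrite (bwirtM _ _ (s1 i j) (s2 j) S') (bwirtM _ _ (bsmooth_metric i j) (bsmooth_eta _ i) S').
  rewrite bwirt_base_fibre Eb_eta mul0r mulr0 addr0 mul0r add0r.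
  by rewrite (bwirt_etabar _ _ _ S') conjC_ii De_eta conjc_nat.
rewrite -(bwirt_ext oS _ _ E1 s4 S) (bwirt_sum oS _ _ _ _ S); last by auto with bsm.
rewrite -(sum_delta (fun i => h z i b) a); apply: eq_bigr => i _.
rewrite (bwirtM _ _ (bsmooth_metric i b) (bsmooth_eta _ i) S).
by rewrite bwirt_base_fibre De_eta mul0r add0r.
Qed.

Lemma herm_finsler_region : finsler_region (slit D) F.
Proof.
split; first exact: herm_energy_region.
by move=> z eta S; rewrite fund_herm//; apply/posdef_unitmx/(hermitian_posdef hD S.1).
Qed.
Let FS := herm_finsler_region.

Definition christoffel i l j z : C := \sum_m invmx (h z) m i * dz j (fun z => h z l m) z.

Lemma nonlin_herm i j z eta : slit D z eta ->
  nonlin_conn F i j z eta = \sum_l christoffel i l j z * eta 0 l.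
Proof.
Transparent nonlin_conn.
move=> S; rewrite /nonlin_conn exchange_big /=; apply: eq_bigr => l _.
rewrite mulr_suml; apply: eq_bigr => m _.
have -> : ginv F z eta m i = invmx (h z) m i by rewrite /ginv fund_herm.
congr (_ * _ * _); rewrite !dzE; apply/esym.
apply: (wirt_near _ _ (@total_open_base _ _ _ oS eta) S) => [y Sy|]; first by rewrite fund_herm.
by apply: (smooth_dd (hermitian_smooth hD l m)); exact: S.1.
Opaque nonlin_conn.
Qed.

Lemma bsmooth_christoffel i l j : bsmooth (slit D) (fun z _ => christoffel i l j z).
Proof.
have sg m : bsmooth (slit D) (fun z _ => invmx (h z) m i).
  apply: (bsmooth_ext oS _ (bsmooth_ginv FS m i)) => z eta S.
  by rewrite /ginv fund_herm.
have sd m : bsmooth (slit D) (fun z _ => dz j (fun z => h z l m) z).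
  apply: (bsmooth_ext oS (f := Dz j (fun z _ => h z l m))); last by auto with bsm.
  by move=> z eta S; rewrite bwirt_base_base dzE.
have : bsmooth (slit D)
    (fun z _ => \sum_m invmx (h z) m i * dz j (fun z => h z l m) z) by auto with bsm.
exact.
Qed.

Lemma lower_christoffel l j m z : D z ->
  \sum_i h z i m * christoffel i l j z = dz j (fun z => h z l m) z.
Proof.
move=> zD; have U := posdef_unitmx (hermitian_posdef hD zD).
under eq_bigr do rewrite mulr_sumr.
rewrite exchange_big /= -(sum_delta (fun p => dz j (fun z => h z l p) z) m).
apply: eq_bigr => p _.
have := mulVmx U => /matrixP /(_ p m); rewrite !mxE eq_sym => <-.
have alg (a b c : C) : a * (b * c) = c * (b * a) by ring.
by rewrite mulr_sumr; apply: eq_bigr => i _; exact: alg.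
Qed.

Lemma christoffel_kahler : kahler D h -> forall i l j z, D z ->
  christoffel i l j z = christoffel i j l z.
Proof.
move=> kh i l j z zD; apply: eq_bigr => m _; congr (_ * _).
by apply/eqP; rewrite -subr_eq0 (kh z zD l m j).1.
Qed.

Lemma kahler_herm : kahler D h -> weakly_kahler (slit D) F.
Proof.
move=> kh; apply: (flat_weakly_kahler FS bsmooth_christoffel nonlin_herm).
by move=> z eta [zD _] i j k; exact: christoffel_kahler.
Qed.

(** For a Hermitian metric the connection coefficients are independent of [eta], so the weak Kaehler
    condition is a sesquilinear form in [eta] whose coefficients are the type (2,1) Kaehler defects;
    type (1,2) follows by conjugation. *)
Lemma herm_weakly_kahler : (0 < n)%N -> weakly_kahler (slit D) F -> kahler D h.
Proof.
move=> n0 wk.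
have K1 z : D z -> forall i j k,
    dz k (fun z1 => h z1 i j) z - dz i (fun z1 => h z1 k j) z = 0.
  move=> zD i j k.
  pose M j' l := dz k (fun z1 => h z1 j' l) z - dz j' (fun z1 => h z1 k l) z.
  apply: (@sesquilinear_zero _ _ (slit D z) M (const_mx 1)).
  - exact: (@total_open_fibre _ _ _ oS z).
  - split => //; apply/eqP => /rowP /(_ (Ordinal n0)).
    by rewrite !mxE => /eqP; rewrite oner_eq0.
  move=> eta S; rewrite -[RHS](wk z eta S k) [RHS]exchange_big /= [LHS]exchange_big /=.
  apply: eq_bigr => l _; rewrite [RHS]exchange_big /=; apply: eq_bigr => j' _.
  rewrite /M -!lower_christoffel// -sumrB !mulr_suml; apply: eq_bigr => p _.
  rewrite (fund_herm S) !(conn_flat FS bsmooth_christoffel nonlin_herm _ _ _ S).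
  by rewrite mulrBr.
move=> z zD i j k; split; first exact: K1.
have E a b c : dzb c (fun z1 => h z1 a b) z = (dz c (fun z1 => h z1 b a) z)^*.
  rewrite dzbE dzE -conjC_ii.
  rewrite -(wirt_conj _ _ (smooth_dd (hermitian_smooth hD b a) zD)).
  apply: (wirt_near _ _ oD zD) => [y Dy|].
    by rewrite (hermitian_sym hD Dy).
  exact: smooth_dd (hermitian_smooth hD a b) zD.
by rewrite !E -conjCB K1// conjc0.
Qed.

End Hermitian.

#[local] Opaque spray.

(** * Projective changes and curvature *)

Section ProjectiveCoefficients.
Context {R : realType} {n : nat}.
Local Notation C := R[i].
Local Notation V := 'rV[C]_n.
Implicit Types (z eta : V).

Variables (A : V -> set V) (K : 'I_n -> 'I_n -> 'I_n -> V -> C) (P : V -> V -> C).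
Hypotheses (oA : open (Defs.total A)) (A0 : forall z eta, A z eta -> eta != 0).
Hypotheses (sK : forall i l j, bsmooth A (fun z _ => K i l j z)) (sP : bsmooth A P).
Hypothesis symK : forall i l j z eta, A z eta -> K i l j z = K i j l z.
Hypothesis KP : forall i z eta, A z eta ->
  2^-1 * \sum_j \sum_l K i l j z * eta 0 l * eta 0 j = P z eta * eta 0 i.

(** For K^i_ab = f_a delta^i_b + f_b delta^i_a the trace over i = a equals (n + 1) f_b; hence the
    normalization. *)
Definition proj_factor j z : C := n.+1%:R^-1 * \sum_i K i i j z.

Let linK i a z eta : C := \sum_j K i a j z * eta 0 j.

Let slinK i a : bsmooth A (linK i a).
Proof.
have : bsmooth A (fun z eta => \sum_j K i a j z * eta 0 j) by auto with bsm.
exact.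
Qed.

Lemma De_linear (c : 'I_n -> V -> C) a z eta : (forall j, bsmooth A (fun z _ => c j z)) ->
  A z eta -> De a (fun z eta => \sum_j c j z * eta 0 j) z eta = c a z.
Proof.
move=> sc Az; rewrite (bwirt_sum oA _ _ _ _ Az); last by auto with bsm.
rewrite -(sum_delta (fun j => c j z) a); apply: eq_bigr => j _.
by rewrite (bwirtM _ _ (sc j) (bsmooth_eta A j) Az) bwirt_base_fibre De_eta mul0r add0r.
Qed.

Lemma proj_first i a z eta : A z eta ->
  linK i a z eta = De a P z eta * eta 0 i + P z eta * (a == i)%:R.
Proof.
move=> Az.
have sPe : bsmooth A (fun z eta => P z eta * eta 0 i) by auto with bsm.
have E : De a (fun z eta => 2^-1 * \sum_j linK i j z eta * eta 0 j) z eta =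
    De a (fun z eta => P z eta * eta 0 i) z eta.
  apply/esym; apply: (bwirt_ext oA _ _ _ sPe Az) => z' eta' Az'.
  rewrite -(KP i Az'); congr (_ * _); apply: eq_bigr => j _.
  rewrite mulr_suml; apply: eq_bigr => l _.
  by rewrite (symK i l j Az').
have sl j : bsmooth A (fun z eta => linK i j z eta * eta 0 j).
  exact: (bsmoothM oA (slinK i j) (bsmooth_eta A j)).
have := E; rewrite (bwirtM _ _ sP (bsmooth_eta A i) Az) De_eta => <-.
rewrite (bwirtM _ _ (bsmooth_cst A _) (bsmooth_sum oA _ sl) Az) bwirt_cst mul0r add0r.
rewrite (bwirt_sum oA _ _ _ sl Az).
transitivity (2^-1 * (linK i a z eta + linK i a z eta)).
  have two0 : 2 != 0 :> C by rewrite pnatr_eq0.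
  by move: (linK i a z eta) => x; field.
congr (_ * _).
transitivity (\sum_j (K i j a z * eta 0 j + linK i j z eta * (a == j)%:R)); last first.
  apply: eq_bigr => j _; rewrite (bwirtM _ _ (slinK i j) (bsmooth_eta A j) Az) De_eta.
  by rewrite (De_linear _ (sK i j) Az).
rewrite big_split /= (sum_delta (fun j => linK i j z eta)); congr (_ + _).
by apply: eq_bigr => j _; rewrite (symK i j a Az).
Qed.

(** The relation [KP] forces [P] to have degree one: contracting [proj_first] with [eta] yields
    twice [KP] on one side and the Euler sum plus [P] on the other; a nonzero component of [eta] is
    then cancelled. *)
Lemma proj_euler z eta : A z eta -> \sum_a De a P z eta * eta 0 a = P z eta.
Proof.
move=> Az; have [i ei] := rV_neq0 (A0 Az).
have two0 : 2 != 0 :> C by rewrite pnatr_eq0.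
have := KP i Az.
have -> : \sum_j \sum_l K i l j z * eta 0 l * eta 0 j = \sum_j linK i j z eta * eta 0 j.
  apply: eq_bigr => j _; rewrite mulr_suml; apply: eq_bigr => l _.
  by rewrite (symK i l j Az).
under eq_bigr do rewrite (proj_first i _ Az) mulrDl.
rewrite big_split /= => E; apply: (mulIf ei).
have E' : \sum_a De a P z eta * eta 0 a * eta 0 i + P z eta * eta 0 i =
    2 * (P z eta * eta 0 i).
  apply: etrans _ (congr1 (fun x => 2 * x) E); rewrite mulrA divff// mul1r; congr (_ + _).
    by apply: eq_bigr => a _; rewrite mulrAC.
  rewrite -(sum_delta (fun j => P z eta * eta 0 j) i).
  by apply: eq_bigr => j _; rewrite eq_sym mulrAC.
by rewrite mulr_suml; apply: (addIr (P z eta * eta 0 i)); rewrite E' mulr_natl mulr2n.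
Qed.

(** The trace of [proj_first] is the Euler sum of [P] plus [n] copies of [P], that is [n.+1] times
    [P]. *)
Lemma proj_linear z eta : A z eta -> P z eta = \sum_j proj_factor j z * eta 0 j.
Proof.
move=> Az.
have n0 : n.+1%:R != 0 :> C by rewrite pnatr_eq0.
apply: (mulfI n0).
have -> : \sum_j proj_factor j z * eta 0 j = n.+1%:R^-1 * \sum_i linK i i z eta.
  rewrite exchange_big mulr_sumr /=; apply: eq_bigr => j _.
  by rewrite -mulrA mulr_suml.
rewrite mulrA divff// mul1r.
under eq_bigr do rewrite (proj_first _ _ Az) eqxx mulr1.
rewrite big_split /= (proj_euler Az) sumr_const card_ord -[_ *+ n]mulr_natl.
by rewrite -add1n natrD mulrDl mul1r.
Qed.

(** Once [P] is known to be linear in [eta], a second fibre derivative of the relation leaves only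
    functions of [z]. *)
Lemma proj_coefficients i a b z eta : A z eta ->
  K i a b z = proj_factor a z * (b == i)%:R + proj_factor b z * (a == i)%:R.
Proof.
move=> Az.
have sf j : bsmooth A (fun z _ => proj_factor j z).
  have : bsmooth A (fun z _ => n.+1%:R^-1 * \sum_i K i i j z) by auto with bsm.
  exact.
have DP c z' eta' : A z' eta' -> De c P z' eta' = proj_factor c z'.
  move=> Az'; rewrite -(De_linear c sf Az').
  by apply: (bwirt_ext oA _ _ _ sP Az') => *; exact: proj_linear.
have E z' eta' : A z' eta' -> linK i a z' eta' =
    proj_factor a z' * eta' 0 i + P z' eta' * (a == i)%:R.
  by move=> Az'; rewrite (proj_first i a Az') DP.
rewrite -(De_linear b (sK i a) Az) (bwirt_ext oA _ _ E (slinK i a) Az).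
have s1 : bsmooth A (fun z eta => proj_factor a z * eta 0 i) by auto with bsm.
have s2 : bsmooth A (fun z eta => P z eta * (a == i)%:R) by auto with bsm.
rewrite (bwirtD _ _ s1 s2 Az) (bwirtM _ _ (sf a) (bsmooth_eta A i) Az).
rewrite (bwirtM _ _ sP (bsmooth_cst A _) Az) bwirt_cst bwirt_base_fibre De_eta (DP _ _ _ Az).
by rewrite mul0r add0r mulr0 addr0.
Qed.

End ProjectiveCoefficients.

(** * Curvature of a Kaehler metric that differs projectively from a holomorphic connection *)

Section Curvature.
Context {R : realType} {n : nat}.
Local Notation C := R[i].
Local Notation V := 'rV[C]_n.
Implicit Types (z eta : V).

(** Restrict to the constant section (1, ..., 1), which avoids the zero section since [n > 0]. *)
Lemma smooth_of_bsmooth (D : set V) (f : V -> C) : (0 < n)%N -> open D ->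
  bsmooth (slit D) (fun z _ => f z) -> smooth_on D f.
Proof.
move=> n0 oD sf k.
have e0 : (const_mx 1 : V) != 0.
  by apply/eqP => /rowP /(_ (Ordinal n0)); rewrite !mxE => /eqP; rewrite oner_eq0.
have -> : f = fun z => flat (fun z _ => f z) (row_mx z (const_mx 1 : V)).
  by apply/funext => z; rewrite flat_row.
apply: (Ck_comp (open_slit oD) oD _ (sf k)) => [z Dz|j].
  by apply: total_row; split.
case: (split_ordP j) => i ->.
  by under eq_fun do rewrite row_mxEl; exact: Ck_coord.
by under eq_fun do rewrite row_mxEr mxE; exact: Ck_cst.
Qed.

(** The parallel rank-one tensor forces q_ir = b_i t_r. The Kaehler symmetry then yields t_r H_is =
    t_s H_ir for all i, and contraction with the inverse of [H] gives t_r = 0 as soon as some s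
    differs from r. *)
Lemma curvature_algebra (Rm : 'I_n -> 'I_n -> 'I_n -> 'I_n -> C) (q : 'I_n -> 'I_n -> C)
    (b : 'I_n -> C) (H : 'M[C]_n) k :
  (1 < n)%N -> H \in unitmx -> b k != 0 ->
  (forall p i m r, Rm p i m r = q i r * (m == p)%:R + q m r * (i == p)%:R) ->
  (forall i m r s, \sum_p H p s * Rm p i m r = \sum_p H p r * Rm p i m s) ->
  (forall i j m r, \sum_p Rm p i m r * (b p * (b j)^*) =
     \sum_q (Rm q j r m)^* * (b i * (b q)^*)) ->
  forall p i m r, Rm p i m r = 0.
Proof.
move=> n_gt1 U bk E sym par p i m r.
have sumE (c : 'I_n -> C) i' m' r' : \sum_p c p * Rm p i' m' r' =
    q i' r' * c m' + q m' r' * c i'.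
  rewrite -(sum_delta c m') -(sum_delta c i') !mulr_sumr -big_split /=.
  have alg (a x y u v : C) : a * (x * u + y * v) = x * (a * u) + y * (a * v) by ring.
  by apply: eq_bigr => a _; rewrite E; exact: alg.
have H1 i' j m' r' : (q i' r' * b m' + q m' r' * b i') * (b j)^* =
    (q j m' * b r' + q r' m' * b j)^* * b i'.
  rewrite -(sumE b i' m' r') -(sumE b j r' m') conjC_sum !mulr_suml.
  have alg1 (x y w : C) : x * y * w = y * (x * w) by ring.
  have alg2 (x y w : C) : x * (w * y) = y * x * w by ring.
  under eq_bigr do rewrite alg1.
  by rewrite par; apply: eq_bigr => a _; rewrite conjCM; exact: alg2.
(* For [j = m = k] the right side of [H1] is [b i'] times a factor independent of [i']; the case
   [i' = k] computes this factor. *)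
have qb i' r' : b k * q i' r' = b i' * q k r'.
  have X := H1 i' k k r'; have Y := H1 k k k r'.
  have bkc : (b k)^* != 0 by rewrite conjc_eq0.
  have X' : (q i' r' * b k + q k r' * b i') * (b k)^* * b k =
      (q k r' * b k + q k r' * b k) * (b k)^* * b i'.
    by rewrite X Y mulrAC.
  have nz : (b k)^* * b k != 0 by rewrite mulf_neq0.
  apply: (mulfI nz); move: X'.
  move: ((b k)^*) => x; move: (b k) (q k r') (b i') (q i' r') => y u v w X'.
  have : (w * y + u * v) * x * y - u * v * x * y = (u * y + u * y) * x * v - u * v * x * y.
    by rewrite X'.
  have -> : (w * y + u * v) * x * y - u * v * x * y = x * y * (y * w) by ring.
  by move=> ->; ring.
pose t r := q k r / b k.
have qt i' r' : q i' r' = b i' * t r'.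
  by apply: (mulfI bk); rewrite qb /t; field.
have H2 i' m' r' s : q i' r' * H m' s + q m' r' * H i' s =
    q i' s * H m' r' + q m' s * H i' r'.
  by rewrite -(sumE (fun p => H p s)) -(sumE (fun p => H p r')) sym.
have H3 r' s : t r' * H k s = t s * H k r'.
  have := H2 k k r' s; rewrite !qt => X.
  have : 2 * b k * (t r' * H k s) = 2 * b k * (t s * H k r').
    transitivity (b k * t r' * H k s + b k * t r' * H k s); first by ring.
    by rewrite X; ring.
  by apply: mulfI; rewrite mulf_neq0// pnatr_eq0.
(* The case [m = k] of [H2], where [H3] cancels the terms containing [b i']. *)
have H4 i' r' s : t r' * H i' s = t s * H i' r'.
  have := H2 i' k r' s; rewrite (qt i' r') (qt k r') (qt i' s) (qt k s).
  move: (H3 r' s); move: (t r') (t s) => t1 t2 E3.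
  by rewrite -![b i' * _ * _]mulrA E3 -![b k * _ * _]mulrA => /addrI /(mulfI bk).
have tr r' : t r' = 0.
  have n_gt0 : (0 < n)%N := ltnW n_gt1.
  have [s sr] : exists s : 'I_n, s != r'.
    have [->|] := eqVneq r' (Ordinal n_gt0).
      by exists (Ordinal n_gt1).
    by move=> ?; exists (Ordinal n_gt0); rewrite eq_sym.
  have VU a : \sum_i invmx H s i * H i a = (s == a)%:R.
    by have := mulVmx U => /matrixP /(_ s a); rewrite !mxE.
  have : t r' * \sum_i invmx H s i * H i s = t s * \sum_i invmx H s i * H i r'.
    rewrite !mulr_sumr; apply: eq_bigr => i' _.
    by rewrite mulrCA H4 mulrCA.
  by rewrite !VU eqxx mulr1 (negbTE sr) mulr0.
by rewrite E !qt !tr !mulr0 !mul0r addr0.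
Qed.

Variables (D : set V) (h : V -> 'M[C]_n).
Hypotheses (n_gt1 : (1 < n)%N) (oD : open D) (hD : hermitian_metric D h) (kh : kahler D h).
Local Notation Gam := (christoffel h).
Let n_gt0 : (0 < n)%N := ltnW n_gt1.

Lemma smooth_christoffel i l j : smooth_on D (Gam i l j).
Proof. exact: (smooth_of_bsmooth n_gt0 oD (bsmooth_christoffel oD hD i l j)). Qed.

(* [dzb r (Gam p i m)] is the curvature tensor of the Chern connection of h;
   the Kaehler condition makes it symmetric in the two conjugate indices. *)
Lemma curvature_sym i m r s z : D z ->
  \sum_p h z p s * dzb r (Gam p i m) z = \sum_p h z p r * dzb s (Gam p i m) z.
Proof.
move=> zD.
have sh a b := hermitian_smooth hD a b.
have E a b : \sum_p h z p a * dzb b (Gam p i m) z =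
    dz m (dzb b (fun z => h z i a)) z - \sum_p dzb b (fun z => h z p a) z * Gam p i m z.
  have -> : dz m (dzb b (fun z => h z i a)) z = dzb b (dz m (fun z => h z i a)) z.
    have Ez c : dz c (fun z => h z i a) = wirt (- ii) c (fun z => h z i a).
      by apply/funext => y; exact: dzE.
    have Ezb c : dzb c (fun z => h z i a) = wirt ii c (fun z => h z i a).
      by apply/funext => y; exact: dzbE.
    by rewrite dzE dzbE Ez Ezb (wirtC _ _ _ _ oD (sh i a 2%N) zD).
  have -> : dzb b (dz m (fun z => h z i a)) z = dzb b (fun z => \sum_p h z p a * Gam p i m z) z.
    rewrite !dzbE; apply/esym; apply: (wirt_near _ _ oD zD) => [y Dy|].
      exact: (lower_christoffel hD i m a Dy).
    apply: (smooth_dd _ zD); apply: (smooth_sum _ oD) => p.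
    by apply: (smoothM oD); [exact: sh|exact: smooth_christoffel].
  rewrite dzbE (wirt_sum _ _ _ oD zD); last first.
    by move=> p; apply: (smoothM oD); [exact: sh|exact: smooth_christoffel].
  rewrite -sumrB; apply: eq_bigr => p _.
  rewrite (wirtM _ _ (smooth_dd (sh p a) zD) (smooth_dd (smooth_christoffel p i m) zD)).
  by rewrite -!dzbE [RHS]addrC addKr.
have X1 : dz m (dzb r (fun z => h z i s)) z = dz m (dzb s (fun z => h z i r)) z.
  rewrite !dzE; apply: (wirt_near _ _ oD zD) => [y Dy|].
    by apply/eqP; rewrite -subr_eq0 (kh Dy i s r).2.
  have -> : dzb r (fun z => h z i s) = wirt ii r (fun z => h z i s).
    by apply/funext => y; exact: dzbE.
  by apply: (@Ck_dd _ _ 0 D _ z _ zD); apply: Ck_wirt oD _; exact: sh.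
have X2 : \sum_p dzb r (fun z => h z p s) z * Gam p i m z =
    \sum_p dzb s (fun z => h z p r) z * Gam p i m z.
  apply: eq_bigr => p _; apply: (congr1 (fun x => x * _)).
  by apply/eqP; rewrite -subr_eq0 (kh zD p s r).2.
exact: etrans (E s r) (etrans (congr2 (fun x y => x - y) X1 X2) (esym (E r s))).
Qed.

Variable b : 'I_n -> V -> C.
Hypothesis sb : forall i, smooth_on D (b i).
Local Notation BB i j := (fun z => b i z * (b j z)^*).
Hypothesis parallel_b : forall i j m z, D z ->
  dz m (BB i j) z = \sum_p Gam p i m z * (b p z * (b j z)^*).

Let sBB i j : smooth_on D (BB i j).
Proof. by apply: (smoothM oD (sb i)); exact: (smooth_conj oD). Qed.

Lemma dzb_conj (f : V -> C) k z : smooth_on D f -> D z ->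
  dzb k (fun y => (f y)^*) z = (dz k f z)^*.
Proof.
by move=> sf zD; rewrite dzbE dzE (wirt_conj _ _ (smooth_dd sf zD)) conjC_ii.
Qed.

Lemma dz_conj (f : V -> C) k z : smooth_on D f -> D z ->
  dz k (fun y => (f y)^*) z = (dzb k f z)^*.
Proof.
by move=> sf zD; rewrite dzbE dzE (wirt_conj _ _ (smooth_dd sf zD)) conjCN conjC_ii opprK.
Qed.

Lemma parallel_b_conj i j r z : D z ->
  dzb r (BB i j) z = \sum_p (Gam p j r z)^* * (b i z * (b p z)^*).
Proof.
move=> zD.
have -> : dzb r (BB i j) z = dzb r (fun y => (b j y * (b i y)^*)^*) z.
  congr (dzb r _ z); apply/funext => y.
  by rewrite conjCM conjcK mulrC.
rewrite (dzb_conj r (sBB j i) zD) parallel_b// conjC_sum; apply: eq_bigr => p _.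
by rewrite !conjCM conjcK [X in _ * X]mulrC.
Qed.

(** Integrability condition of the parallel tensor: the two orders of differentiation agree, and the
    terms quadratic in the connection are the same double sum on both sides. *)
Lemma curvature_parallel i j m r z : D z ->
  \sum_p dzb r (Gam p i m) z * (b p z * (b j z)^*) =
  \sum_q (dzb m (Gam q j r) z)^* * (b i z * (b q z)^*).
Proof.
move=> zD.
have sG := smooth_christoffel.
have sGc a c d := smooth_conj oD (sG a c d).
have L : dzb r (dz m (BB i j)) z = \sum_p dzb r (Gam p i m) z * (b p z * (b j z)^*) +
    \sum_p \sum_q Gam p i m z * ((Gam q j r z)^* * (b p z * (b q z)^*)).
  transitivity (dzb r (fun z => \sum_p Gam p i m z * (b p z * (b j z)^*)) z).
    rewrite !dzbE; apply: (wirt_near _ _ oD zD) => [y Dy|]; first exact: parallel_b.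
    have -> : dz m (BB i j) = wirt (- ii) m (BB i j) by apply/funext => y; exact: dzE.
    by apply: (@Ck_dd _ _ 0 D _ z _ zD); apply: Ck_wirt oD _; exact: sBB.
  rewrite dzbE (wirt_sum _ _ _ oD zD); last by move=> p; exact: (smoothM oD (sG _ _ _) (sBB p j)).
  rewrite -big_split /=; apply: eq_bigr => p _.
  rewrite (wirtM _ _ (smooth_dd (sG p i m) zD) (smooth_dd (sBB p j) zD)).
  by rewrite -!dzbE parallel_b_conj// mulr_sumr.
have Rr : dz m (dzb r (BB i j)) z = \sum_q (dzb m (Gam q j r) z)^* * (b i z * (b q z)^*) +
    \sum_p \sum_q Gam p i m z * ((Gam q j r z)^* * (b p z * (b q z)^*)).
  transitivity (dz m (fun z => \sum_q (Gam q j r z)^* * (b i z * (b q z)^*)) z).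
    rewrite !dzE; apply: (wirt_near _ _ oD zD) => [y Dy|]; first exact: parallel_b_conj.
    have -> : dzb r (BB i j) = wirt ii r (BB i j) by apply/funext => y; exact: dzbE.
    by apply: (@Ck_dd _ _ 0 D _ z _ zD); apply: Ck_wirt oD _; exact: sBB.
  rewrite dzE (wirt_sum _ _ _ oD zD); last by move=> q; exact: (smoothM oD (sGc _ _ _) (sBB i q)).
  rewrite [X in _ + X]exchange_big /= -big_split /=; apply: eq_bigr => q _.
  rewrite (wirtM _ _ (smooth_dd (sGc q j r) zD) (smooth_dd (sBB i q) zD)).
  rewrite -!dzE (dz_conj _ (sG _ _ _) zD) parallel_b// mulr_sumr.
  by congr (_ + _); apply: eq_bigr => p _; rewrite mulrCA.
have Cm : dzb r (dz m (BB i j)) z = dz m (dzb r (BB i j)) z.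
  have -> : dz m (BB i j) = wirt (- ii) m (BB i j) by apply/funext => y; exact: dzE.
  have -> : dzb r (BB i j) = wirt ii r (BB i j) by apply/funext => y; exact: dzbE.
  by rewrite dzE dzbE (wirtC _ _ _ _ oD (sBB i j 2%N) zD).
by move: Cm; rewrite L Rr => /addIr.
Qed.

Variables (Gam0 : 'I_n -> 'I_n -> 'I_n -> V -> C) (f : 'I_n -> V -> C).
Hypothesis hG0 : forall i l j, holomorphic_on D (Gam0 i l j).
Hypothesis sf : forall i, smooth_on D (f i).
Hypothesis G0f : forall p i m z, D z ->
  Gam0 p i m z - Gam p i m z = f i z * (m == p)%:R + f m z * (i == p)%:R.

Lemma curvature_proj p i m r z : D z -> dzb r (Gam p i m) z =
  - (dzb r (f i) z * (m == p)%:R + dzb r (f m) z * (i == p)%:R).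
Proof.
move=> zD.
have sc (c : C) := smooth_cst D c.
have s1 a c : smooth_on D (fun z => f a z * c) by apply: (smoothM oD (sf a)); exact: sc.
have sm (c : C) a : smooth_on D (fun z => c * f a z) by apply: (smoothM oD _ (sf a)); exact: sc.
pose g z := -1 * (f i z * (m == p)%:R + f m z * (i == p)%:R).
have sS : smooth_on D (fun z => f i z * (m == p)%:R + f m z * (i == p)%:R).
  by move=> k; exact: (CkD oD (s1 _ _ k) (s1 _ _ k)).
have sg : smooth_on D g by exact: (smoothM oD (sc (-1)) sS).
have -> : dzb r (Gam p i m) z = dzb r (fun z => Gam0 p i m z + g z) z.
  rewrite !dzbE; apply: (wirt_near _ _ oD zD) => [y Dy|].
    by rewrite /g -G0f// mulN1r opprB addrC subrK.
  by apply: smooth_dd zD; exact: smooth_christoffel.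
rewrite dzbE (wirtD _ _ (smooth_dd (hG0 p i m).1 zD) (smooth_dd sg zD)) -dzbE.
rewrite (hG0 p i m).2// add0r.
rewrite (wirtM _ _ (smooth_dd (sc _) zD) (smooth_dd sS zD)) wirt_cst mul0r add0r mulN1r.
rewrite (wirtD _ _ (smooth_dd (s1 _ _) zD) (smooth_dd (s1 _ _) zD)).
rewrite (wirtM _ _ (smooth_dd (sf i) zD) (smooth_dd (sc _) zD)).
rewrite (wirtM _ _ (smooth_dd (sf m) zD) (smooth_dd (sc _) zD)).
by rewrite !wirt_cst !mulr0 !addr0 -!dzbE.
Qed.

Lemma curvature_zero z p i m r : D z -> (exists k, b k z != 0) -> dzb r (Gam p i m) z = 0.
Proof.
move=> zD [k bk].
apply: (@curvature_algebra (fun p i m r => dzb r (Gam p i m) z) (fun i r => - dzb r (f i) z)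
  (fun i => b i z) (h z) k n_gt1 (posdef_unitmx (hermitian_posdef hD zD)) bk).
- move=> p' i' m' r'; rewrite (curvature_proj _ _ _ _ zD) opprD.
  by apply: congr2; rewrite mulNr.
- by move=> i' m' r' s; exact: curvature_sym.
- by move=> i' j m' r'; exact: curvature_parallel.
Qed.

End Curvature.

(** * Complex Randers metrics *)

Section HermitianForms.
Context {R : realType} {n : nat}.
Local Notation C := R[i].
Local Notation V := 'rV[C]_n.

Lemma conj_mul_ge0 (x : C) : 0 <= x * x^*.
Proof. exact: mulcJ_ge0. Qed.

Definition sesqui (H : 'M[C]_n) (v w : V) : C := \sum_i \sum_j H i j * v 0 i * (w 0 j)^*.

Lemma sesquiDl (H : 'M[C]_n) (x y : C) (v v' w : V) :
  sesqui H (x *: v + y *: v') w = x * sesqui H v w + y * sesqui H v' w.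
Proof.
rewrite !mulr_sumr -big_split /=; apply: eq_bigr => i _.
rewrite !mulr_sumr -big_split /=; apply: eq_bigr => j _.
by rewrite !mxE; ring.
Qed.

Lemma sesqui_conj (H : 'M[C]_n) (v w : V) : (forall i j, H j i = (H i j)^*) ->
  (sesqui H v w)^* = sesqui H w v.
Proof.
move=> sH; rewrite conjC_sum [RHS]exchange_big /=; apply: eq_bigr => i _.
rewrite conjC_sum; apply: eq_bigr => j _.
by rewrite !conjCM conjcK -sH mulrAC.
Qed.

Lemma sesquiDr (H : 'M[C]_n) (x y : C) (v w w' : V) : (forall i j, H j i = (H i j)^*) ->
  sesqui H v (x *: w + y *: w') = x^* * sesqui H v w + y^* * sesqui H v w'.
Proof.
move=> sH; rewrite -(sesqui_conj _ _ sH) sesquiDl conjCD !conjCM.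
by rewrite !(sesqui_conj _ _ sH).
Qed.

Lemma hform_ge0 (H : 'M[C]_n) (v : V) : posdef H -> 0 <= hform H v.
Proof.
by move=> pH; have [<- r0] := posdef_real v pH; rewrite -[0]/(0%:C) lecR.
Qed.

Lemma cauchy_schwarz (H : 'M[C]_n) (v w : V) : posdef H -> (forall i j, H j i = (H i j)^*) ->
  sesqui H v w * (sesqui H v w)^* <= hform H v * hform H w.
Proof.
move=> pH sH; have [->|w0] := eqVneq w 0.
  have -> : sesqui H v 0 = 0.
    rewrite /sesqui big1// => i _; rewrite big1// => j _.
    by rewrite mxE conjc0 mulr0.
  have -> : hform H 0 = 0.
    by rewrite hformE big1// => i _; rewrite big1// => j _; rewrite mxE mulr0 mul0r.
  by rewrite mul0r mulr0.
have ww : 0 < hform H w := pH w w0.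
(* [x *: v + y *: w] is a multiple of the component of [v] orthogonal to [w]; its square norm gives
   the inequality. *)
pose x := hform H w; pose y := - sesqui H v w.
have := hform_ge0 (x *: v + y *: w) pH.
rewrite -[hform H (_ + _)]/(sesqui H _ _) sesquiDl !(sesquiDr _ _ _ _ _ sH).
rewrite -[sesqui H w v](sesqui_conj v w sH) -/(sesqui H v v) -[sesqui H w w]/x.
have -> : x^* = x.
  by rewrite /x; have [<- _] := posdef_real w pH; exact: conjc_real.
rewrite /y conjCN; move: (sesqui H v w) => c.
rewrite -[sesqui H v v]/(hform H v); move: ww; rewrite -/x => xpos.
have -> : x * (x * hform H v + - c^* * c) + - c * (x * c^* + - c^* * x) =
   x * (hform H v * x - c * c^*) by ring.
by rewrite pmulr_rge0// subr_ge0.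
Qed.

End HermitianForms.

Section RandersData.
Context {R : realType} {n : nat}.
Local Notation C := R[i].
Local Notation V := 'rV[C]_n.
Implicit Types (z eta : V).

Lemma bsmooth_sub (A A' : V -> set V) (f : V -> V -> C) :
  (forall z eta, A' z eta -> A z eta) -> bsmooth A f -> bsmooth A' f.
Proof. by move=> AA sf k; apply: Ck_sub (sf k) => p /AA. Qed.

Variables (D : set V) (h : V -> 'M[C]_n) (u : V -> R) (W : V -> V).
Hypotheses (oD : open D) (data : zermelo_data D h u W).
Let hD := zermelo_hermitian data.
Local Notation eps z := (zermelo_eps h u W z).
Local Notation low z i := (zermelo_low h W z i).
Local Notation beta := (zermelo_beta h u W).
Local Notation AF := (beta_neq0 D h u W).
Local Notation a := (zermelo_a h u W).
Local Notation F := (zermelo_randers h u W).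

Lemma eps_gt0 z : D z -> 0 < eps z.
Proof.
move=> zD; rewrite /zermelo_eps subr_gt0; have W0 := zermelo_W_gt0 data zD.
have Wu := zermelo_W_lt data zD.
by rewrite ltr_pXn2r// nnegrE ltW//; exact: lt_trans Wu.
Qed.

Definition einv z : C := (eps z)%:C^-1.

Definition bcoef i z : C := low z i * einv z.

Lemma smooth_low i : smooth_on D (fun z => low z i).
Proof.
apply: (smooth_sum _ oD) => j; apply: (smoothM oD); first exact: hermitian_smooth hD i j.
by apply: (smooth_conj oD); exact: zermelo_smooth_W data j.
Qed.

Lemma smooth_eps : smooth_on D (fun z => (eps z)%:C).
Proof.
have sh i j := hermitian_smooth hD i j.
have sW j := zermelo_smooth_W data j.
have su := zermelo_smooth_u data.
pose f z : C := \sum_i low z i * W z 0 i.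
have sf : smooth_on D f.
  by apply: (smooth_sum _ oD) => i; apply: (smoothM oD) => //; exact: smooth_low.
have suu := smoothM oD su su.
move=> k; apply: (Ck_ext oD (f := fun z => (u z)%:C * (u z)%:C - f z)); last first.
  exact: (CkD oD (suu k) (CkN oD (sf k))).
move=> z zD; rewrite /zermelo_eps rmorphB /= expr2 rmorphM /=; congr (_ - _).
rewrite -/(energy (herm_norm h) z (W z)) (energy_herm _ (hermitian_posdef hD zD)).
rewrite hformE /f; apply: eq_bigr => i _; rewrite mulr_suml; apply: eq_bigr => j _.
exact: mulrAC.
Qed.

Lemma epsC_neq0 z : D z -> (eps z)%:C != 0 :> C.
Proof.
by move=> /eps_gt0 e0; rewrite -[0]/(0%:C) (inj_eq (@complexI _)) gt_eqF.
Qed.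

Lemma einv_gt0 z : D z -> 0 < einv z.
Proof. by move=> /eps_gt0 e0; rewrite invr_gt0 -[0]/(0%:C) ltcR. Qed.

Lemma einv_neq0 z : D z -> einv z != 0.
Proof. by move=> zD; rewrite invr_eq0 epsC_neq0. Qed.

Lemma smooth_einv : smooth_on D einv.
Proof. by move=> k; exact: (CkV oD epsC_neq0 (smooth_eps k)). Qed.

Lemma smooth_bcoef i : smooth_on D (bcoef i).
Proof. exact: (smoothM oD (smooth_low i) smooth_einv). Qed.

Lemma einv_conj z : (einv z)^* = einv z.
Proof. by rewrite /einv conjc_inv conjc_real. Qed.

Lemma aE z i j : a z i j = h z i j * einv z + bcoef i z * (bcoef j z)^*.
Proof.
rewrite mxE /bcoef conjCM einv_conj; congr (_ + _).
by rewrite -[einv z]/((eps z)%:C^-1) expr2 rmorphM /= invfM; ring.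
Qed.

Lemma betaE z eta : beta z eta = \sum_i bcoef i z * eta 0 i.
Proof. by []. Qed.

Definition BB z eta : C := beta z eta * (beta z eta)^*.

Definition EH z eta : C := einv z * herm_form h z eta.

Lemma hform_a z eta : hform (a z) eta = EH z eta + BB z eta.
Proof.
rewrite hformE /EH /BB betaE conjC_sum /herm_form mulr_sumr mulr_suml -big_split /=.
apply: eq_bigr => i _; rewrite !mulr_sumr -big_split /=; apply: eq_bigr => j _.
rewrite aE (conjCM (bcoef j z) (eta 0 j)); move: (h z i j) (einv z) (bcoef i z) (eta 0 i) => x y b e.
move: ((bcoef j z)^*) ((eta 0 j)^*) => b' e'. ring.
Qed.

Lemma bundle_open : open (Defs.total (bundle D)).
Proof. exact: open_base. Qed.

Lemma bsmooth_beta_bundle : bsmooth (bundle D) beta.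
Proof.
have oB := bundle_open.
have sb i : bsmooth (bundle D) (fun z _ => bcoef i z).
  by apply: (bsmooth_base oB oD _ (smooth_bcoef i)).
have : bsmooth (bundle D) (fun z eta => \sum_i bcoef i z * eta 0 i) by auto with bsm.
exact.
Qed.

Lemma open_AF : open (Defs.total AF).
Proof.
apply: (@open_neq0 _ _ (Defs.total (bundle D)) (flat beta) bundle_open) => p Dp.
exact: (Ck_cont (bsmooth_beta_bundle 0) Dp).
Qed.

Lemma AF_slit z eta : AF z eta -> slit D z eta.
Proof.
move=> [zD b0]; split => //; apply: contra_neq b0 => ->.
by rewrite betaE big1// => i _; rewrite mxE mulr0.
Qed.

Lemma beta_scale z eta (l : C) : beta z (l *: eta) = l * beta z eta.
Proof.
by rewrite !betaE mulr_sumr; apply: eq_bigr => i _; rewrite mxE mulrCA.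
Qed.

Lemma bsmooth_coef (A : V -> set V) (f : V -> C) : open (Defs.total A) ->
  (forall z eta, A z eta -> D z) -> smooth_on D f -> bsmooth A (fun z _ => f z).
Proof. by move=> oA AD sf; exact: (bsmooth_base oA oD AD sf). Qed.

Lemma bsmooth_EH : bsmooth (slit D) EH.
Proof.
have oS := open_slit oD.
apply: (bsmoothM oS) (bsmooth_herm_form oD hD).
by apply: bsmooth_coef => //; [move=> ? ? []|exact: smooth_einv].
Qed.

Lemma bsmooth_BB : bsmooth (slit D) BB.
Proof.
have oS := open_slit oD.
have sb : bsmooth (slit D) beta.
  by apply: bsmooth_sub bsmooth_beta_bundle => ? ? [].
exact: (bsmoothM oS sb (bsmooth_conj oS sb)).
Qed.

Lemma a_hermitian : hermitian_metric D a.
Proof.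
have sb := smooth_bcoef.
split.
- move=> i j.
  have s1 := smoothM oD (hermitian_smooth hD i j) smooth_einv.
  have s2 := smoothM oD (sb i) (smooth_conj oD (sb j)).
  move=> k; apply: (Ck_ext oD _ (CkD oD (s1 k) (s2 k))) => z zD.
  by rewrite aE.
- move=> z zD i j; rewrite !aE conjCD (conjCM (h z i j)) (conjCM (bcoef i z)) conjcK einv_conj.
  by rewrite (hermitian_sym hD zD i j) [X in _ + X]mulrC.
- move=> z zD eta e0; rewrite hform_a; apply: ltr_wpDr; first exact: conj_mul_ge0.
  by rewrite mulr_gt0 ?einv_gt0//; exact: (hermitian_posdef hD zD).
Qed.

Definition alphaC z eta : C := (herm_norm a z eta)%:C.
Definition rhoC z eta : C := (Normc.normc (beta z eta))%:C.

Lemma alphaC_sqr z eta : D z -> alphaC z eta * alphaC z eta = EH z eta + BB z eta.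
Proof.
move=> zD; rewrite /alphaC -rmorphM -expr2 -hform_a /=.
exact: (energy_herm _ (hermitian_posdef a_hermitian zD)).
Qed.

Lemma rhoC_sqr z eta : rhoC z eta * rhoC z eta = BB z eta.
Proof.
rewrite /BB -sqr_normc expr2.
have -> : rhoC z eta = `|beta z eta| by rewrite normc_def /rhoC; case: (beta z eta).
by [].
Qed.

Lemma energy_randers z eta :
  energy F z eta = (alphaC z eta + rhoC z eta) * (alphaC z eta + rhoC z eta).
Proof. by rewrite /energy expr2 rmorphM rmorphD. Qed.

Lemma alphaC_gt0 z eta : slit D z eta -> 0 < alphaC z eta.
Proof.
move=> [zD e0]; rewrite -[0]/(0%:C) ltcR /herm_norm sqrtr_gt0.
have := hermitian_posdef a_hermitian zD e0; case: (hform (a z) eta) => x y.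
by rewrite ltcE /= => /andP[].
Qed.

Lemma rhoC_gt0 z eta : AF z eta -> 0 < rhoC z eta.
Proof.
move=> [_ b0]; rewrite lt_def; apply/andP; split.
  have : rhoC z eta * rhoC z eta != 0 by rewrite rhoC_sqr mulf_neq0// conjc_eq0.
  by rewrite mulf_eq0 orbb.
by rewrite -[0]/(0%:C) lecR /Normc.normc; case: (beta z eta) => ? ?; rewrite sqrtr_ge0.
Qed.

Lemma bsmooth_alphaC : bsmooth (slit D) alphaC.
Proof.
have oS := open_slit oD.
apply: (bsmooth_sqrt oS (r := fun z eta => complex.Re (hform (a z) eta))).
  move=> z eta [zD e0]; have := hermitian_posdef a_hermitian zD e0.
  by case: (hform (a z) eta) => x y; rewrite ltcE /= => /andP[].
apply: (bsmooth_ext oS _ (bsmoothD oS bsmooth_EH bsmooth_BB)) => z eta [zD e0].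
by rewrite -hform_a; have [-> _] := posdef_real eta (hermitian_posdef a_hermitian zD).
Qed.

Lemma bsmooth_rhoC : bsmooth AF rhoC.
Proof.
have oA := open_AF.
pose r z eta := complex.Re (beta z eta) ^+ 2 + complex.Im (beta z eta) ^+ 2.
have rE z eta : (r z eta)%:C = BB z eta.
  by rewrite /r add_Re2_Im2 /BB sqr_normc.
apply: (bsmooth_ext oA (f := fun z eta => (Num.sqrt (r z eta))%:C)).
  by move=> z eta _; rewrite /rhoC /r; case: (beta z eta).
apply: (bsmooth_sqrt oA).
  move=> z eta AFz; have r0 := rhoC_gt0 AFz; rewrite -ltcR rE -rhoC_sqr.
  exact: (mulr_gt0 r0 r0).
apply: (bsmooth_ext oA (f := BB)); last exact: bsmooth_sub AF_slit bsmooth_BB.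
by move=> z eta _; rewrite rE.
Qed.

Let sA : bsmooth AF alphaC := bsmooth_sub AF_slit bsmooth_alphaC.
Let sR : bsmooth AF rhoC := bsmooth_rhoC.
Let sEH : bsmooth AF EH := bsmooth_sub AF_slit bsmooth_EH.
Let sBB : bsmooth AF BB := bsmooth_sub AF_slit bsmooth_BB.
Let oA : open (Defs.total AF) := open_AF.

Lemma randers_energy_region : energy_region AF F.
Proof.
split.
- exact: oA.
- by move=> z eta l [zD b0] l0; split => //; rewrite beta_scale mulf_neq0.
- have sF := bsmoothD oA sA sR.
  apply: (bsmooth_ext oA _ (bsmoothM oA sF sF)) => z eta _.
  by rewrite energy_randers.
- move=> z eta l AFz; rewrite /zermelo_randers.
  have -> := region_homog (herm_energy_region oD a_hermitian) l (AF_slit AFz).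
  by rewrite beta_scale Normc.normcM mulrDr.
- move=> z eta AFz; have : alphaC z eta + rhoC z eta != 0.
    by rewrite gt_eqF// addr_gt0 ?rhoC_gt0 ?alphaC_gt0//; exact: AF_slit.
  rewrite /alphaC /rhoC -rmorphD; apply: contra_neq => H.
  by rewrite -[herm_norm a z eta + _]/(F z eta) H.
Qed.

Lemma bwirt_alphaC (c : C) k z eta : AF z eta ->
  2 * (alphaC z eta * bwirt c k alphaC z eta) = bwirt c k EH z eta + bwirt c k BB z eta.
Proof.
move=> AFz; rewrite -(bwirtD _ _ sEH sBB AFz).
have E z' eta' : AF z' eta' -> EH z' eta' + BB z' eta' = alphaC z' eta' * alphaC z' eta'.
  by move=> [zD _]; rewrite alphaC_sqr.
rewrite (bwirt_ext oA _ _ E (bsmoothD oA sEH sBB) AFz) (bwirtM _ _ sA sA AFz).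
by move: (bwirt _ _ _ _ _) (alphaC _ _) => x y; ring.
Qed.

Lemma bwirt_rhoC (c : C) k z eta : AF z eta ->
  2 * (rhoC z eta * bwirt c k rhoC z eta) = bwirt c k BB z eta.
Proof.
move=> AFz.
have E z' eta' : AF z' eta' -> BB z' eta' = rhoC z' eta' * rhoC z' eta'.
  by move=> _; rewrite rhoC_sqr.
rewrite (bwirt_ext oA _ _ E sBB AFz) (bwirtM _ _ sR sR AFz).
by move: (bwirt _ _ _ _ _) (rhoC _ _) => x y; ring.
Qed.

Lemma bwirt_randers (c : C) k z eta : AF z eta ->
  bwirt c k (energy F) z eta =
  2 * ((alphaC z eta + rhoC z eta) * (bwirt c k alphaC z eta + bwirt c k rhoC z eta)).
Proof.
move=> AFz; have sF := bsmoothD oA sA sR.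
have E z' eta' : AF z' eta' -> energy F z' eta' =
    (alphaC z' eta' + rhoC z' eta') * (alphaC z' eta' + rhoC z' eta').
  by move=> _; rewrite energy_randers.
rewrite (bwirt_ext oA _ _ E (region_smooth randers_energy_region) AFz).
rewrite (bwirtM _ _ sF sF AFz) (bwirtD _ _ sA sR AFz).
move: (bwirt _ _ _ _ _) (bwirt _ _ _ _ _) (alphaC _ _) (rhoC _ _) => x y v w; ring.
Qed.

(** Implicit differentiation of [alphaC^2 = EH + BB] and [rhoC^2 = BB], cleared of denominators.
    Every first derivative of [L] is thus the same combination of derivatives of two sesquilinear
    forms. *)
Lemma bwirt_energy_randers (c : C) k z eta : AF z eta ->
  alphaC z eta * rhoC z eta * bwirt c k (energy F) z eta =
  (alphaC z eta + rhoC z eta) * (rhoC z eta * bwirt c k EH z eta +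
    (alphaC z eta + rhoC z eta) * bwirt c k BB z eta).
Proof.
move=> AFz; rewrite (bwirt_randers _ _ AFz).
have E1 := bwirt_alphaC c k AFz; have E2 := bwirt_rhoC c k AFz.
move: E1 E2; move: (bwirt c k alphaC z eta) (bwirt c k rhoC z eta) (bwirt c k EH z eta).
move: (bwirt c k BB z eta) (alphaC z eta) (rhoC z eta) => B al rh x y E E1 E2.
have -> : E = 2 * (al * x) - B by rewrite E1 addrK.
by rewrite -E2; ring.
Qed.

End RandersData.

Section SesquilinearForms.
Context {R : realType} {n : nat}.
Local Notation C := R[i].
Local Notation V := 'rV[C]_n.
Variables (D : set V) (A : V -> set V) (c : 'I_n -> 'I_n -> V -> C).
Hypotheses (oD : open D) (oA : open (Defs.total A)) (AD : forall z eta, A z eta -> D z).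
Hypothesis sc : forall i j, smooth_on D (c i j).
Implicit Types (z eta : V).

Definition sform (c : 'I_n -> 'I_n -> V -> C) z eta : C :=
  \sum_i \sum_j c i j z * eta 0 i * (eta 0 j)^*.

Let sb i j : bsmooth A (fun z _ => c i j z) := bsmooth_base oA oD AD (sc i j).
Let sbar j : bsmooth A (fun _ eta => (eta 0 j)^*) := bsmooth_conj oA (bsmooth_eta A j).
Let s1 i j : bsmooth A (fun z eta => c i j z * eta 0 i) := bsmoothM oA (sb i j) (bsmooth_eta A i).
Let s2 i j : bsmooth A (fun z eta => c i j z * eta 0 i * (eta 0 j)^*) :=
  bsmoothM oA (s1 i j) (sbar j).

Lemma De_etabar k j z eta : A z eta -> De k (fun _ eta : V => (eta 0 j)^*) z eta = 0.
Proof.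
move=> Az; rewrite (bwirt_conj _ _ (bsmooth_eta A j) Az) conjCN conjC_ii opprK.
by rewrite Eb_eta conjc0.
Qed.

Lemma Eb_etabar k j z eta : A z eta -> Eb k (fun _ eta : V => (eta 0 j)^*) z eta = (k == j)%:R.
Proof.
by move=> Az; rewrite (bwirt_conj _ _ (bsmooth_eta A j) Az) conjC_ii De_eta conjc_nat.
Qed.

Lemma Dz_sform m z eta : A z eta ->
  Dz m (sform c) z eta = sform (fun i j => dz m (c i j)) z eta.
Proof.
move=> Az; rewrite (bwirt_sum oA _ _ _ _ Az); last first.
  by move=> i; apply: (bsmooth_sum oA) => j; exact: s2.
apply: eq_bigr => i _; rewrite (bwirt_sum oA _ _ _ (s2 i) Az); apply: eq_bigr => j _.
rewrite (bwirtM _ _ (s1 i j) (sbar j) Az) (bwirtM _ _ (sb i j) (bsmooth_eta A i) Az).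
rewrite (bwirt_conj _ _ (bsmooth_eta A j) Az) !bwirt_eta_base conjc0 !mulr0 !addr0.
by rewrite bwirt_base_base dzE.
Qed.

Lemma De_sform p z eta : A z eta ->
  De p (sform c) z eta = \sum_j c p j z * (eta 0 j)^*.
Proof.
move=> Az; rewrite (bwirt_sum oA _ _ _ _ Az); last first.
  by move=> i; apply: (bsmooth_sum oA) => j; exact: s2.
rewrite -(sum_delta (fun p => \sum_j c p j z * (eta 0 j)^*) p).
apply: eq_bigr => i _; rewrite (bwirt_sum oA _ _ _ (s2 i) Az) mulr_suml; apply: eq_bigr => j _.
rewrite (bwirtM _ _ (s1 i j) (sbar j) Az) (bwirtM _ _ (sb i j) (bsmooth_eta A i) Az).
by rewrite (De_etabar _ _ Az) De_eta bwirt_base_fibre mul0r add0r mulr0 addr0 mulrAC.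
Qed.

Lemma Eb_sform p z eta : A z eta ->
  Eb p (sform c) z eta = \sum_i c i p z * eta 0 i.
Proof.
move=> Az; rewrite (bwirt_sum oA _ _ _ _ Az); last first.
  by move=> i; apply: (bsmooth_sum oA) => j; exact: s2.
apply: eq_bigr => i _; rewrite (bwirt_sum oA _ _ _ (s2 i) Az).
rewrite -(sum_delta (fun p => c i p z * eta 0 i) p); apply: eq_bigr => j _.
rewrite (bwirtM _ _ (s1 i j) (sbar j) Az) (bwirtM _ _ (sb i j) (bsmooth_eta A i) Az).
by rewrite (Eb_etabar _ _ Az) Eb_eta bwirt_base_fibre mul0r add0r mulr0 mul0r add0r.
Qed.

Lemma De_Eb_sform p q z eta : A z eta -> De p (Eb q (sform c)) z eta = c p q z.
Proof.
move=> Az; have s3 i : bsmooth A (fun z eta => c i q z * eta 0 i) := s1 i q.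
rewrite -(bwirt_ext oA _ _ (fun z eta Az => esym (@Eb_sform q z eta Az)) (bsmooth_sum oA _ s3) Az).
rewrite (bwirt_sum oA _ _ _ s3 Az) -(sum_delta (fun p => c p q z) p); apply: eq_bigr => i _.
by rewrite (bwirtM _ _ (sb i q) (bsmooth_eta A i) Az) De_eta bwirt_base_fibre mul0r add0r.
Qed.

End SesquilinearForms.

Section RandersRegion.
Context {R : realType} {n : nat}.
Local Notation C := R[i].
Local Notation V := 'rV[C]_n.
Implicit Types (z eta : V).
Variables (D : set V) (h : V -> 'M[C]_n) (u : V -> R) (W : V -> V).
Hypotheses (oD : open D) (data : zermelo_data D h u W).
Let hD := zermelo_hermitian data.
Local Notation beta := (zermelo_beta h u W).
Local Notation AF := (beta_neq0 D h u W).
Local Notation a := (zermelo_a h u W).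
Local Notation F := (zermelo_randers h u W).
Local Notation b := (bcoef h u W).
Local Notation al := (alphaC h u W).
Local Notation rh := (rhoC h u W).
Let aD := a_hermitian oD data.
Let oA : open (Defs.total AF) := open_AF oD data.
Let oS := open_slit oD.
Let AS := @AF_slit R n D h u W.
Let AD z eta : AF z eta -> D z := fun Az => Az.1.

Lemma BB_sform : BB h u W = sform (fun i j z => b i z * (b j z)^*).
Proof.
apply/funext => z; apply/funext => eta; rewrite /BB betaE conjC_sum mulr_suml.
apply: eq_bigr => i _; rewrite mulr_sumr; apply: eq_bigr => j _.
rewrite (conjCM (b j z) (eta 0 j)); move: (b i z) ((b j z)^*) ((eta 0 j)^*) => x y w; ring.
Qed.

Lemma EH_sform : EH h u W = sform (fun i j z => einv h u W z * h z i j).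
Proof.
apply/funext => z; apply/funext => eta; rewrite /EH mulr_sumr.
apply: eq_bigr => i _; rewrite mulr_sumr; apply: eq_bigr => j _; by rewrite !mulrA.
Qed.

Let sA : bsmooth AF al := bsmooth_sub AS (bsmooth_alphaC oD data).
Let sR : bsmooth AF rh := bsmooth_rhoC oD data.
Let sL : bsmooth AF (energy F) := region_smooth (randers_energy_region oD data).
Lemma De_Eb_square (f g : V -> V -> C) i j z eta : bsmooth AF f -> bsmooth AF g ->
  (forall z eta, AF z eta -> g z eta = f z eta * f z eta) -> AF z eta ->
  De i (Eb j g) z eta =
  2 * (De i f z eta * Eb j f z eta + f z eta * De i (Eb j f) z eta).
Proof.
move=> sf sg E Az.
have sE := bsmooth_bwirt oA ii (rshift n j) sf.
have E1 z' eta' : AF z' eta' -> Eb j g z' eta' = 2 * (f z' eta' * Eb j f z' eta').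
  move=> Az'; rewrite (bwirt_ext oA _ _ E sg Az') (bwirtM _ _ sf sf Az').
  by move: (Eb j f z' eta') (f z' eta') => x y; ring.
rewrite (bwirt_ext oA _ _ E1 (bsmooth_bwirt oA _ _ sg) Az).
rewrite (bwirtM _ _ (bsmooth_cst _ 2) (bsmoothM oA sf sE) Az) bwirt_cst mul0r add0r.
by rewrite (bwirtM _ _ sf sE Az).
Qed.

Lemma De_Eb_alphaC i j z eta : AF z eta ->
  2 * (De i al z eta * Eb j al z eta + al z eta * De i (Eb j al) z eta) = a z i j.
Proof.
move=> Az; have ra := herm_energy_region oD aD.
have sa : bsmooth AF (energy (herm_norm a)) := bsmooth_sub AS (region_smooth ra).
have E z' eta' : AF z' eta' -> energy (herm_norm a) z' eta' = al z' eta' * al z' eta'.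
  by move=> _; rewrite /energy expr2 rmorphM.
by rewrite -(De_Eb_square i j sA sa E Az) -fundE (fund_herm oD aD (AS Az)).
Qed.

Lemma De_Eb_rhoC i j z eta : AF z eta ->
  2 * (De i rh z eta * Eb j rh z eta + rh z eta * De i (Eb j rh) z eta) =
  b i z * (b j z)^*.
Proof.
move=> Az.
have sBB : bsmooth AF (BB h u W) := bsmooth_sub AS (bsmooth_BB oD data).
have E z' eta' : AF z' eta' -> BB h u W z' eta' = rh z' eta' * rh z' eta'.
  by move=> _; rewrite rhoC_sqr.
rewrite -(De_Eb_square i j sR sBB E Az) BB_sform.
apply: (De_Eb_sform oD oA AD _ _ _ Az) => i' j'.
by apply: (smoothM oD (smooth_bcoef oD data i')); exact: (smooth_conj oD (smooth_bcoef oD data j')).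
Qed.

Lemma fund_randers i j z eta : AF z eta -> fund F z eta i j =
  2 * ((De i al z eta + De i rh z eta) * (Eb j al z eta + Eb j rh z eta) +
    (al z eta + rh z eta) * (De i (Eb j al) z eta + De i (Eb j rh) z eta)).
Proof.
move=> Az; rewrite fundE.
have sF := bsmoothD oA sA sR.
have E z' eta' : AF z' eta' -> energy F z' eta' =
    (al z' eta' + rh z' eta') * (al z' eta' + rh z' eta').
  by move=> _; rewrite energy_randers.
rewrite (De_Eb_square i j sF sL E Az) (bwirtD _ _ sA sR Az) (bwirtD _ _ sA sR Az).
have E2 z' eta' : AF z' eta' -> Eb j (fun z eta => al z eta + rh z eta) z' eta' =
    Eb j al z' eta' + Eb j rh z' eta'.
  by move=> Az'; rewrite (bwirtD _ _ sA sR Az').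
rewrite (bwirt_ext oA _ _ E2 (bsmooth_bwirt oA _ _ sF) Az).
by rewrite (bwirtD _ _ (bsmooth_bwirt oA _ _ sA) (bsmooth_bwirt oA _ _ sR) Az).
Qed.

Let bil (M : 'I_n -> 'I_n -> C) (v : V) : C := \sum_i \sum_j M i j * v 0 i * (v 0 j)^*.

Let bilM (p q : 'I_n -> C) (v : V) :
  bil (fun i j => p i * q j) v = (\sum_i p i * v 0 i) * (\sum_j q j * (v 0 j)^*).
Proof.
rewrite mulr_suml; apply: eq_bigr => i _; rewrite mulr_sumr; apply: eq_bigr => j _.
by rewrite mulrACA mulrA.
Qed.

Let bilD (M M' : 'I_n -> 'I_n -> C) (v : V) :
  bil (fun i j => M i j + M' i j) v = bil M v + bil M' v.
Proof.
rewrite -big_split; apply: eq_bigr => i _; rewrite -big_split; apply: eq_bigr => j _.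
by rewrite !mulrDl.
Qed.

Let bilZ (x : C) (M : 'I_n -> 'I_n -> C) (v : V) :
  bil (fun i j => x * M i j) v = x * bil M v.
Proof.
rewrite mulr_sumr; apply: eq_bigr => i _; rewrite mulr_sumr; apply: eq_bigr => j _.
by rewrite !mulrA.
Qed.

Let De_real_conj (r : V -> V -> R) k z eta : bsmooth AF (fun z eta => (r z eta)%:C) ->
  AF z eta -> Eb k (fun z eta => (r z eta)%:C) z eta = (De k (fun z eta => (r z eta)%:C) z eta)^*.
Proof.
move=> sr Az; rewrite (De_conj _ sr Az); congr (Eb k _ z eta).
by apply/funext => ?; apply/funext => ?; rewrite conjc_real.
Qed.

(** The complex Hessian of (alpha + rho)^2 is 2 |d(alpha + rho)|^2 plus 2 (alpha + rho) times the
    Hessians of alpha and of rho = |beta|. The first of these is positive by Cauchy-Schwarz for [a],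
    the second is nonnegative. *)
Lemma randers_posdef z eta : AF z eta -> posdef (fund F z eta).
Proof.
move=> Az v v0; have zD : D z := Az.1.
have al0 : 0 < al z eta := alphaC_gt0 oD data (AS Az).
have rh0 : 0 < rh z eta := rhoC_gt0 Az.
pose X := hform (a z) v; pose y := \sum_i b i z * v 0 i.
have X0 : 0 < X := hermitian_posdef aD zD v0.
pose Da := \sum_i De i al z eta * v 0 i; pose Dr := \sum_i De i rh z eta * v 0 i.
pose Ha := bil (fun i j => De i (Eb j al) z eta) v.
pose Hr := bil (fun i j => De i (Eb j rh) z eta) v.
have cDa : \sum_j Eb j al z eta * (v 0 j)^* = Da^*.
  rewrite conjC_sum; apply: eq_bigr => j _; rewrite conjCM.
  by apply: (congr1 (fun x => x * _)); exact: De_real_conj sA Az.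
have cDr : \sum_j Eb j rh z eta * (v 0 j)^* = Dr^*.
  rewrite conjC_sum; apply: eq_bigr => j _; rewrite conjCM.
  by apply: (congr1 (fun x => x * _)); exact: De_real_conj sR Az.
have ext M M' : (forall i j, M i j = M' i j) -> bil M v = bil M' v.
  by move=> E; apply: eq_bigr => i _; apply: eq_bigr => j _; rewrite E.
have QE : hform (fund F z eta) v =
    2 * ((Da + Dr) * (Da + Dr)^* + (al z eta + rh z eta) * (Ha + Hr)).
  transitivity (bil (fun i j => fund F z eta i j) v); first by [].
  rewrite (ext _ _ (fun i j => fund_randers i j Az)) bilZ bilD bilM bilZ bilD.
  rewrite (conjCD Da) -cDa -cDr -!big_split; congr (2 * (_ * _ + _)).
    by apply: eq_bigr => i _; exact: mulrDl.
  by apply: eq_bigr => i _; exact: mulrDl.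
have XE : 2 * (Da * Da^* + al z eta * Ha) = X.
  rewrite -[RHS](ext _ _ (fun i j => De_Eb_alphaC i j Az)) bilZ bilD bilM bilZ.
  by rewrite cDa.
have yE : 2 * (Dr * Dr^* + rh z eta * Hr) = y * y^*.
  transitivity (bil (fun i j => b i z * (b j z)^*) v); last first.
    rewrite bilM (conjC_sum _ _ (fun i => b i z * v 0 i)); congr (_ * _).
    by apply: eq_bigr => j _; rewrite (conjCM (b j z)).
  rewrite -(ext _ _ (fun i j => De_Eb_rhoC i j Az)) bilZ bilD bilM bilZ.
  by rewrite cDr.
have sE : 2 * (al z eta * Da) = sesqui (a z) v eta.
  have ra := herm_energy_region oD aD.
  have sa : bsmooth AF (energy (herm_norm a)) := bsmooth_sub AS (region_smooth ra).
  have E z' eta' : AF z' eta' -> energy (herm_norm a) z' eta' = al z' eta' * al z' eta'.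
    by move=> _; rewrite /energy expr2 rmorphM.
  rewrite !mulr_sumr; apply: eq_bigr => i _.
  transitivity (De i (energy (herm_norm a)) z eta * v 0 i).
    rewrite (bwirt_ext oA _ _ E sa Az) (bwirtM _ _ sA sA Az).
    by move: (De i al z eta) (al z eta) (v 0 i) => x1 x2 x3; ring.
  rewrite -(fund_eta_conj ra _ (AS Az)) (fund_herm oD aD (AS Az)) mulr_suml.
  by apply: eq_bigr => j _; rewrite mulrAC.
have rE : 2 * (rh z eta * Dr) = y * (beta z eta)^*.
  have sBB : bsmooth AF (BB h u W) := bsmooth_sub AS (bsmooth_BB oD data).
  have E z' eta' : AF z' eta' -> BB h u W z' eta' = rh z' eta' * rh z' eta'.
    by move=> _; rewrite rhoC_sqr.
  rewrite !mulr_sumr mulr_suml; apply: eq_bigr => i _.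
  transitivity (De i (BB h u W) z eta * v 0 i).
    rewrite (bwirt_ext oA _ _ E sBB Az) (bwirtM _ _ sR sR Az).
    by move: (De i rh z eta) (rh z eta) (v 0 i) => x1 x2 x3; ring.
  rewrite BB_sform (De_sform oD oA AD _ _ Az); last first.
    move=> i' j'; apply: (smoothM oD (smooth_bcoef oD data i')).
    exact: (smooth_conj oD (smooth_bcoef oD data j')).
  rewrite betaE conjC_sum mulr_suml mulr_sumr; apply: eq_bigr => j _.
  rewrite (conjCM (b j z)); move: (b i z) (v 0 i) ((b j z)^*) ((eta 0 j)^*) => x1 x2 x3 x4.
  by ring.
have cal : (al z eta)^* = al z eta by exact: conjc_real.
have crh : (rh z eta)^* = rh z eta by exact: conjc_real.
(* 2 alpha [Da] is the [a]-product of [v] with [eta], and alpha^2 is the square norm of [eta]. *)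
have DaX : 4 * (Da * Da^*) <= X.
  have al2 : 0 < al z eta * al z eta by rewrite mulr_gt0.
  rewrite -(ler_pM2r al2).
  have -> : 4 * (Da * Da^*) * (al z eta * al z eta) =
      sesqui (a z) v eta * (sesqui (a z) v eta)^*.
    rewrite -sE (conjCM 2) (conjCM (al z eta)) cal conjc_nat.
    by move: (Da^*) (Da) (al z eta) => x1 x2 x3; ring.
  rewrite (alphaC_sqr oD data _ zD) -(hform_a h u W).
  by apply: cauchy_schwarz; [exact: (hermitian_posdef aD zD)|exact: (hermitian_sym aD zD)].
have DrY : 4 * (Dr * Dr^*) = y * y^*.
  have rh2 : rh z eta * rh z eta != 0 by rewrite mulf_neq0// gt_eqF.
  apply: (mulIf rh2); transitivity (2 * (rh z eta * Dr) * (2 * (rh z eta * Dr))^*).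
    rewrite (conjCM 2) (conjCM (rh z eta)) crh conjc_nat.
    by move: (Dr^*) (Dr) (rh z eta) => x1 x2 x3; ring.
  rewrite rE rhoC_sqr /BB (conjCM y) conjcK.
  by move: (y^*) (y) (beta z eta) ((beta z eta)^*) => x1 x2 x3 x4; ring.
have Ha0 : 0 < al z eta * Ha.
  have : 0 < 4 * (al z eta * Ha).
    have -> : 4 * (al z eta * Ha) = X + (X - 4 * (Da * Da^*)).
      by rewrite -XE; move: (Da * Da^*) (al z eta * Ha) => x1 x2; ring.
    by apply: ltr_wpDr => //; rewrite subr_ge0.
  by rewrite pmulr_rgt0// ltr0n.
have Hr0 : 0 <= rh z eta * Hr.
  have : 0 <= 4 * (rh z eta * Hr).
    have -> : 4 * (rh z eta * Hr) = y * y^*.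
      have -> : 4 * (rh z eta * Hr) = 2 * (y * y^*) - 4 * (Dr * Dr^*).
        by rewrite -yE; move: (Dr * Dr^*) (rh z eta * Hr) => x1 x2; ring.
      by rewrite DrY; move: (y * y^*) => x1; ring.
    exact: conj_mul_ge0.
  by rewrite pmulr_rge0// ltr0n.
rewrite QE; apply: mulr_gt0; first by rewrite ltr0n.
apply: ltr_wpDl; first exact: conj_mul_ge0.
have pos (x1 x2 x3 x4 : C) : 0 < x1 -> 0 < x2 -> 0 < x1 * x3 -> 0 <= x2 * x4 ->
    0 < (x1 + x2) * (x3 + x4).
  move=> p1 p2; rewrite pmulr_rgt0// pmulr_rge0// => p3 p4.
  by apply: mulr_gt0; [exact: addr_gt0|exact: ltr_wpDr].
exact: pos al0 rh0 Ha0 Hr0.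
Qed.

Lemma randers_finsler_region : finsler_region AF F.
Proof.
split; first exact: randers_energy_region.
by move=> z eta Az; exact/posdef_unitmx/randers_posdef.
Qed.

End RandersRegion.

(* A form in the conjugate fibre coordinates whose coefficients are holomorphic
   along the fibres vanishes identically as soon as it vanishes at
   [zeta = conj eta]: apply the antiholomorphic derivatives. *)
Section Polarization.
Context {R : realType} {n : nat}.
Local Notation C := R[i].
Local Notation V := 'rV[C]_n.
Variables (A : V -> set V).
Hypothesis oA : open (Defs.total A).
Implicit Types (z eta : V) (w : 'I_n -> C) (f : V -> V -> C).

Definition fibre_holo f : Prop :=
  bsmooth A f /\ forall r z eta, A z eta -> Eb r f z eta = 0.

Lemma fibre_holoD f g : fibre_holo f -> fibre_holo g ->
  fibre_holo (fun z eta => f z eta + g z eta).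
Proof.
move=> [sf hf] [sg hg]; split; first exact: bsmoothD.
by move=> r z eta Az; rewrite (bwirtD _ _ sf sg Az) hf// hg// addr0.
Qed.

Lemma fibre_holoM f g : fibre_holo f -> fibre_holo g ->
  fibre_holo (fun z eta => f z eta * g z eta).
Proof.
move=> [sf hf] [sg hg]; split; first exact: bsmoothM.
by move=> r z eta Az; rewrite (bwirtM _ _ sf sg Az) hf// hg// mul0r mulr0 addr0.
Qed.

Lemma fibre_holo_base (D : set V) (c : V -> C) : open D ->
  (forall z eta, A z eta -> D z) -> smooth_on D c -> fibre_holo (fun z _ => c z).
Proof.
move=> oD AD sc; split; first exact: (bsmooth_base oA oD AD sc).
by move=> r z eta _; rewrite bwirt_base_fibre.
Qed.

Lemma fibre_holo_cst (c : C) : fibre_holo (fun _ _ => c).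
Proof. by split; [exact: bsmooth_cst|move=> *; rewrite bwirt_cst]. Qed.

Lemma fibre_holo_eta j : fibre_holo (fun _ eta => eta 0 j).
Proof. by split; [exact: bsmooth_eta|move=> *; rewrite Eb_eta]. Qed.

Lemma fibre_holo_sum (f : 'I_n -> V -> V -> C) : (forall i, fibre_holo (f i)) ->
  fibre_holo (fun z eta => \sum_i f i z eta).
Proof.
move=> hf; have sf i := (hf i).1; split; first exact: bsmooth_sum.
by move=> r z eta Az; rewrite (bwirt_sum oA _ _ _ sf Az) big1// => i _; exact: (hf i).2.
Qed.

Let sbar j : bsmooth A (fun _ eta => (eta 0 j)^*) := bsmooth_conj oA (bsmooth_eta A j).

Lemma Eb_zero f r z eta : (forall z eta, A z eta -> f z eta = 0) -> bsmooth A f ->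
  A z eta -> Eb r f z eta = 0.
Proof.
move=> f0 sf Az; rewrite -[RHS](bwirt_cst ii (rshift n r) 0 z eta).
exact: (bwirt_ext oA _ _ f0 sf Az).
Qed.

Lemma Eb_bar (f : 'I_n -> V -> V -> C) r z eta : (forall j, bsmooth A (f j)) -> A z eta ->
  Eb r (fun z eta => \sum_j f j z eta * (eta 0 j)^*) z eta =
  \sum_j Eb r (f j) z eta * (eta 0 j)^* + f r z eta.
Proof.
move=> sf Az; have sfb j := bsmoothM oA (sf j) (sbar j).
rewrite (bwirt_sum oA _ _ _ sfb Az) -(sum_delta (fun j => f j z eta) r) -big_split /=.
by apply: eq_bigr => j _; rewrite (bwirtM _ _ (sf j) (sbar j) Az) (Eb_etabar _ _ Az).
Qed.

Lemma polar1 (c : 'I_n -> V -> V -> C) : (forall j, fibre_holo (c j)) ->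
  (forall z eta, A z eta -> \sum_j c j z eta * (eta 0 j)^* = 0) ->
  forall j z eta, A z eta -> c j z eta = 0.
Proof.
move=> hc c0 j z eta Az; have sc j' := (hc j').1.
have := Eb_bar j sc Az.
rewrite (Eb_zero _ c0 _ Az); last first.
  by apply: (bsmooth_sum oA) => k; exact: (bsmoothM oA (sc k) (sbar k)).
rewrite big1 ?add0r => [<-//|k _].
by rewrite (hc k).2// mul0r.
Qed.

(** For coefficients that are not symmetric only [c r j + c j r] can be shown to vanish; the
    conclusion is therefore a quadratic form in [w], obtained after doubling. *)
Lemma polar2 (c : 'I_n -> 'I_n -> V -> V -> C) : (forall i j, fibre_holo (c i j)) ->
  (forall z eta, A z eta -> \sum_i \sum_j c i j z eta * (eta 0 i)^* * (eta 0 j)^* = 0) ->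
  forall w z eta, A z eta -> \sum_i \sum_j c i j z eta * w i * w j = 0.
Proof.
move=> hc c0 w z eta Az; have sc i j := (hc i j).1.
pose f j z eta := \sum_i c i j z eta * (eta 0 i)^*.
have sf j : bsmooth A (f j).
  by apply: (bsmooth_sum oA) => i; exact: (bsmoothM oA (sc i j) (sbar i)).
have f0 z' eta' : A z' eta' -> \sum_j f j z' eta' * (eta' 0 j)^* = 0.
  move=> Az'; rewrite -[RHS](c0 z' eta' Az') [RHS]exchange_big /=.
  by apply: eq_bigr => j _; rewrite mulr_suml.
have Ebf r j z' eta' : A z' eta' -> Eb r (f j) z' eta' = c r j z' eta'.
  move=> Az'; rewrite (Eb_bar r (fun i => sc i j) Az') big1 ?add0r// => i _.
  by rewrite (hc i j).2// mul0r.
have sym r j : c r j z eta + c j r z eta = 0.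
  apply: (polar1 (c := fun j z eta => c r j z eta + c j r z eta)) Az => {j}.
    by move=> j; exact: fibre_holoD.
  move=> z' eta' Az'.
  have := Eb_bar r sf Az'; rewrite (Eb_zero _ f0 _ Az'); last first.
    by apply: (bsmooth_sum oA) => k; exact: (bsmoothM oA (sf k) (sbar k)).
  move=> E; apply: etrans _ (esym E); rewrite -big_split /=; apply: eq_bigr => j _.
  by rewrite Ebf// mulrDl.
have two0 : 2 != 0 :> C by rewrite pnatr_eq0.
apply: (mulfI two0); rewrite mulr0.
have -> (x : C) : 2 * x = x + x by ring.
rewrite {2}exchange_big /= -big_split big1// => i _ /=.
rewrite -big_split big1// => j _ /=.
have -> (x y v v' : C) : x * v * v' + y * v' * v = (x + y) * (v * v') by ring.
by rewrite sym mul0r.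
Qed.

Lemma polar3 (c : 'I_n -> 'I_n -> 'I_n -> V -> V -> C) :
  (forall i j k, fibre_holo (c i j k)) ->
  (forall z eta, A z eta -> \sum_i \sum_j \sum_k
     c i j k z eta * (eta 0 i)^* * (eta 0 j)^* * (eta 0 k)^* = 0) ->
  forall w z eta, A z eta -> \sum_i \sum_j \sum_k c i j k z eta * w i * w j * w k = 0.
Proof.
move=> hc c0 w z eta Az; have sc i j k := (hc i j k).1.
pose f k z eta := \sum_i \sum_j c i j k z eta * (eta 0 i)^* * (eta 0 j)^*.
have sf k : bsmooth A (f k).
  apply: (bsmooth_sum oA) => i; apply: (bsmooth_sum oA) => j.
  exact: (bsmoothM oA (bsmoothM oA (sc i j k) (sbar i)) (sbar j)).
have f0 z' eta' : A z' eta' -> \sum_k f k z' eta' * (eta' 0 k)^* = 0.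
  move=> Az'; rewrite -[RHS](c0 z' eta' Az').
  under [RHS]eq_bigr do rewrite exchange_big /=.
  rewrite [RHS]exchange_big /=; apply: eq_bigr => k _; rewrite mulr_suml.
  by apply: eq_bigr => i _; rewrite mulr_suml.
have Ebf r k z' eta' : A z' eta' -> Eb r (f k) z' eta' =
    \sum_i (c r i k z' eta' + c i r k z' eta') * (eta' 0 i)^*.
  move=> Az'; pose g j z eta := \sum_i c i j k z eta * (eta 0 i)^*.
  have sg j : bsmooth A (g j).
    by apply: (bsmooth_sum oA) => i; exact: (bsmoothM oA (sc i j k) (sbar i)).
  have fg : f k = fun z eta => \sum_j g j z eta * (eta 0 j)^*.
    apply/funext => x; apply/funext => y; rewrite /f exchange_big /=.
    by apply: eq_bigr => j _; rewrite mulr_suml.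
  rewrite fg (Eb_bar r sg Az') -big_split /=; apply: eq_bigr => i _.
  rewrite (Eb_bar r (fun i' => sc i' i k) Az') big1 ?add0r ?mulrDl// => i' _.
  by rewrite (hc i' i k).2// mul0r.
(* [Eb r] of the cubic form is the quadratic form with coefficients [d r], one term for each
   position of [r]; contracting it with [w r] gives three times the cubic form. *)
pose d r i j z eta := c r i j z eta + c i r j z eta + c i j r z eta.
have H r : \sum_i \sum_j d r i j z eta * w i * w j = 0.
  apply: polar2 Az => [i j|z' eta' Az'].
    by apply: fibre_holoD => //; exact: fibre_holoD.
  have := Eb_bar r sf Az'; rewrite (Eb_zero _ f0 _ Az'); last first.
    by apply: (bsmooth_sum oA) => k; exact: (bsmoothM oA (sf k) (sbar k)).
  move=> E; apply: etrans _ (esym E).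
  under [X in _ = X + _]eq_bigr => k _ do rewrite (Ebf _ _ _ _ Az') mulr_suml.
  rewrite [LHS]exchange_big [f r z' eta']exchange_big -big_split /=; apply: eq_bigr => k _.
  rewrite -big_split /=; apply: eq_bigr => i _.
  rewrite /d; move: (c r i k z' eta') (c i r k z' eta') (c i k r z' eta').
  by move: ((eta' 0 i)^*) ((eta' 0 k)^*) => *; ring.
have three0 : 3 != 0 :> C by rewrite pnatr_eq0.
apply: (mulfI three0); rewrite mulr0.
transitivity (\sum_r (\sum_i \sum_j d r i j z eta * w i * w j) * w r); last first.
  by rewrite big1// => r _; rewrite H mul0r.
pose S := \sum_i \sum_j \sum_k c i j k z eta * w i * w j * w k.
have S1 : S = \sum_i \sum_j \sum_k c j i k z eta * w i * w j * w k.
  rewrite /S exchange_big /=; apply: eq_bigr => i _; apply: eq_bigr => j _.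
  by apply: eq_bigr => k _; rewrite [_ * w j * w i]mulrAC.
have S2 : S = \sum_i \sum_j \sum_k c j k i z eta * w i * w j * w k.
  rewrite S1; transitivity (\sum_j \sum_i \sum_k c i j k z eta * w j * w i * w k) => //.
  rewrite exchange_big /=.
  under eq_bigr do rewrite exchange_big /=.
  rewrite exchange_big /=; apply: eq_bigr => k _; apply: eq_bigr => i _.
  apply: eq_bigr => j _; move: (c i j k z eta) (w i) (w j) (w k) => *; ring.
have -> : 3 * S = S + S + S by ring.
rewrite {3}S2 {2}S1 /S -!big_split /=; apply: eq_bigr => r _.
rewrite mulr_suml -!big_split /=; apply: eq_bigr => i _.
rewrite mulr_suml -!big_split /=; apply: eq_bigr => j _.
rewrite /d; move: (c r i j z eta) (c i r j z eta) (c i j r z eta) (w r) (w i) (w j) => *.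
by ring.
Qed.

End Polarization.

(** Comparison of the coefficients of two cubics in [s] and [t]: s^3 gives [V1 = 0], then s^2 t
    gives [T1 = 0], then s t^2 gives [V2 = 0], and finally t^3 gives [T2 = 0]. *)
Lemma plane_algebra (K : numFieldType) (P2 E1 E2 T1 T2 V1 V2 : K) : P2 != 0 -> E1 != 0 ->
  (forall s t, t * P2 * ((s * T1 + t * T2) * (s * T1 + t * T2) +
      2 * ((s * T1 + t * T2) * (s * V1 + t * V2))) =
    (s * E1 + t * E2) * ((s * V1 + t * V2) * (s * V1 + t * V2))) ->
  T2 = 0 /\ V2 = 0.
Proof.
move=> P0 E0 H; have two0 : 2 != 0 :> K by rewrite pnatr_eq0.
have sq0 (x y : K) : x != 0 -> x * (y * y) = 0 -> y = 0.
  by move=> x0 /eqP; rewrite mulf_eq0 (negbTE x0) mulf_eq0 orbb => /eqP.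
have V10 : V1 = 0.
  apply: (sq0 E1) => //; have := H 1 0.
  by rewrite !mul0r !mul1r !addr0 => <-.
move: H; rewrite V10 => H {V10}.
have T10 : T1 = 0.
  apply: (sq0 (2 * P2)); first by rewrite mulf_neq0.
  have H0 := H 0 1; have H1 := H 1 1; have H2 := H (-1) 1.
  (* Second difference in [s] at [t = 1]: the right side is affine in [s] once [V1 = 0], so only 2
     P2 T1^2 survives. *)
  have : 1 * P2 * ((1 * T1 + 1 * T2) * (1 * T1 + 1 * T2) + 2 * ((1 * T1 + 1 * T2) * (1 * 0 + 1 * V2)))
    + 1 * P2 * ((-1 * T1 + 1 * T2) * (-1 * T1 + 1 * T2) + 2 * ((-1 * T1 + 1 * T2) * (-1 * 0 + 1 * V2)))
    - 2 * (1 * P2 * ((0 * T1 + 1 * T2) * (0 * T1 + 1 * T2) + 2 * ((0 * T1 + 1 * T2) * (0 * 0 + 1 * V2)))) = 0.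
    by rewrite H0 H1 H2; ring.
  by move=> <-; ring.
move: H; rewrite T10 => H {T10}.
have V20 : V2 = 0.
  apply: (sq0 E1) => //.
  have H0 := H 0 1; have H1 := H 1 1.
  have : (1 * E1 + 1 * E2) * ((1 * 0 + 1 * V2) * (1 * 0 + 1 * V2)) -
    (0 * E1 + 1 * E2) * ((0 * 0 + 1 * V2) * (0 * 0 + 1 * V2)) = 0.
    by rewrite -H0 -H1; ring.
  by move=> <-; ring.
split=> //; apply: (sq0 P2) => //; have := H 0 1; rewrite V20 => H0.
have -> : P2 * (T2 * T2) = 1 * P2 * ((0 * 0 + 1 * T2) * (0 * 0 + 1 * T2) + 2 * ((0 * 0 + 1 * T2) * (0 * 0 + 1 * 0))) by ring.
by rewrite H0; ring.
Qed.

(** * Complex Berwald Randers metrics over a Kaehler metric *)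

Section RandersBerwald.
Context {R : realType} {n : nat}.
Local Notation C := R[i].
Local Notation V := 'rV[C]_n.
Implicit Types (z eta : V).
Variables (D : set V) (h : V -> 'M[C]_n) (u : V -> R) (W : V -> V).
Hypotheses (n_gt1 : (1 < n)%N) (oD : open D) (data : zermelo_data D h u W).
Let hD := zermelo_hermitian data.
Local Notation beta := (zermelo_beta h u W).
Local Notation AF := (beta_neq0 D h u W).
Local Notation F := (zermelo_randers h u W).
Local Notation b := (bcoef h u W).
Local Notation e := (einv h u W).
Local Notation al := (alphaC h u W).
Local Notation rh := (rhoC h u W).
Local Notation G i := (spray F i).
Local Notation Gam := (christoffel h).
Hypotheses (kh : kahler D h) (cb : complex_berwald AF F).
Let oA : open (Defs.total AF) := open_AF oD data.
Let AS := @AF_slit R n D h u W.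
Let AD z eta : AF z eta -> D z := fun Az => Az.1.
Let FA := randers_finsler_region oD data.
Let sL := region_smooth FA.
Let sG i : bsmooth AF (G i) := bsmooth_spray FA i.
Let sb i : smooth_on D (b i) := smooth_bcoef oD data i.

Let bs i j : V -> C := fun z => b i z * (b j z)^*.
Let hs i j : V -> C := fun z => e z * h z i j.

Let sbs i j : smooth_on D (bs i j) := smoothM oD (sb i) (smooth_conj oD (sb j)).
Let shs i j : smooth_on D (hs i j) :=
  smoothM oD (smooth_einv oD data) (hermitian_smooth hD i j).

Lemma smooth_dz m (c : V -> C) : smooth_on D c -> smooth_on D (dz m c).
Proof.
move=> sc k; have -> : dz m c = wirt (- ii) m c by apply/funext => y; exact: dzE.
exact: (Ck_wirt _ _ oD (sc k.+1)).
Qed.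

Lemma De_spray_holo p m : fibre_holo AF (De m (G p)).
Proof.
split; first exact: (bsmooth_bwirt oA).
move=> r z eta Az; rewrite (bwirtC oA _ _ _ _ (sG p) Az).
rewrite -[RHS](bwirt_cst (- ii) (rshift n m) 0 z eta).
apply: (bwirt_ext oA _ _ _ _ Az); last exact: (bsmooth_bwirt oA).
move=> z' eta' Az'; rewrite -(cb.1 z' eta' Az' p r) dzbE.
exact: esym (wirt_fibre ii r (G p) z' eta').
Qed.

(* The coefficients of T and V (see the header) as forms in [conj eta], for the
   Hermitian form [c]. *)
Definition defect (c : 'I_n -> 'I_n -> V -> C) m j z eta : C :=
  \sum_i dz m (c i j) z * eta 0 i - \sum_p De m (G p) z eta * c p j z.

Lemma defect_holo c m j : (forall i j, smooth_on D (c i j)) -> fibre_holo AF (defect c m j).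
Proof.
move=> sc.
have h1 : fibre_holo AF (fun z eta => \sum_i dz m (c i j) z * eta 0 i).
  apply: (fibre_holo_sum oA) => i; apply: (fibre_holoM oA); last exact: fibre_holo_eta.
  exact: (fibre_holo_base oA oD AD (smooth_dz m (sc i j))).
have h2 : fibre_holo AF (fun z eta => -1 * \sum_p De m (G p) z eta * c p j z).
  apply: (fibre_holoM oA); first exact: fibre_holo_cst.
  apply: (fibre_holo_sum oA) => p; apply: (fibre_holoM oA); first exact: De_spray_holo.
  exact: (fibre_holo_base oA oD AD (sc p j)).
have -> : defect c m j = fun z eta => \sum_i dz m (c i j) z * eta 0 i +
    -1 * \sum_p De m (G p) z eta * c p j z.
  by apply/funext => z; apply/funext => eta; rewrite mulN1r.
exact: (fibre_holoD oA h1 h2).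
Qed.

Lemma defectE c m z eta : (forall i j, smooth_on D (c i j)) -> AF z eta ->
  \sum_j defect c m j z eta * (eta 0 j)^* =
  Dz m (sform c) z eta - \sum_p De p (sform c) z eta * De m (G p) z eta.
Proof.
move=> sc Az; rewrite (Dz_sform oD oA AD sc m Az).
under [X in _ - X]eq_bigr do rewrite (De_sform oD oA AD sc _ Az) mulr_suml.
rewrite [X in _ - X]exchange_big [X in X - _]exchange_big -sumrB /=.
apply: eq_bigr => j _; rewrite /defect mulrBl !mulr_suml; congr (_ - _).
have alg (x1 x2 x3 : C) : x1 * x2 * x3 = x2 * x3 * x1 by ring.
by apply: eq_bigr => p _; exact: alg.
Qed.

(** The derivation d_m - C^p_m d/deta^p annihilates [L] by [weakly_kahler_energy];
    [bwirt_energy_randers] expresses this through its values on [EH] and [BB], and the common factor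
    alpha + rho cancels. *)
Lemma defect_relation m z eta : AF z eta ->
  rh z eta * (\sum_j defect hs m j z eta * (eta 0 j)^*) +
  (al z eta + rh z eta) * (\sum_j defect bs m j z eta * (eta 0 j)^*) = 0.
Proof.
move=> Az; rewrite (defectE m shs Az) (defectE m sbs Az) -EH_sform -BB_sform.
have WK := weakly_kahler_energy FA cb.2 m Az.
have rel c k := bwirt_energy_randers oD data c k Az.
have al0 := alphaC_gt0 oD data (AS Az); have rh0 := rhoC_gt0 Az.
have f0 : al z eta + rh z eta != 0 by rewrite gt_eqF// addr_gt0.
apply: (mulfI f0); rewrite mulr0.
have X1 := rel (- ii) (lshift n m).
have X2 : al z eta * rh z eta * \sum_p De p (energy F) z eta * De m (G p) z eta =
    (al z eta + rh z eta) * (rh z eta * (\sum_p De p (EH h u W) z eta * De m (G p) z eta) +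
     (al z eta + rh z eta) * \sum_p De p (BB h u W) z eta * De m (G p) z eta).
  rewrite !mulr_sumr -big_split mulr_sumr; apply: eq_bigr => p _ /=.
  rewrite mulrA rel; move: (al z eta + rh z eta) (rh z eta) (De p (EH h u W) z eta).
  by move: (De p (BB h u W) z eta) (De m (G p) z eta) => x1 x2 x3 x4 x5; ring.
have alg (x1 x2 y1 y2 y3 y4 : C) : x2 * y1 + x1 * y2 = x2 * y3 + x1 * y4 ->
    x1 * (x2 * (y3 - y1) + x1 * (y4 - y2)) = 0.
  move=> E; have -> : x1 * (x2 * (y3 - y1) + x1 * (y4 - y2)) =
    x1 * ((x2 * y3 + x1 * y4) - (x2 * y1 + x1 * y2)) by ring.
  by rewrite E subrr mulr0.
by move: X1; rewrite WK X2 => /(mulfI f0); exact: alg.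
Qed.

Let lf (c : 'I_n -> C) (w : 'I_n -> C) : C := \sum_j c j * w j.

Let cubic_sum (p t v q w : 'I_n -> C) :
  \sum_i \sum_j \sum_k (p i * (t j * t k + 2 * (t j * v k)) - q i * (v j * v k)) * w i * w j * w k =
  lf p w * (lf t w * lf t w + 2 * (lf t w * lf v w)) - lf q w * (lf v w * lf v w).
Proof.
have tri (x y y' : 'I_n -> C) : \sum_i \sum_j \sum_k x i * (y j * y' k) * w i * w j * w k =
    lf x w * (lf y w * lf y' w).
  rewrite mulr_suml; apply: eq_bigr => i _; rewrite mulr_suml mulr_sumr; apply: eq_bigr => j _.
  rewrite !mulr_sumr; apply: eq_bigr => k _.
  by move: (x i) (y j) (y' k) (w i) (w j) (w k) => *; ring.
rewrite mulrDr [lf p w * (2 * _)]mulrCA -!tri mulr_sumr -big_split -sumrB.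
apply: eq_bigr => i _; rewrite mulr_sumr -big_split -sumrB; apply: eq_bigr => j _.
rewrite mulr_sumr -big_split -sumrB; apply: eq_bigr => k _ /=.
move: (p i) (t j) (t k) (v j) (v k) (q i) (w i) (w j) (w k) => *; ring.
Qed.

Let pc j z eta : C := beta z eta * (b j z)^*.
Let ec j z eta : C := \sum_i hs i j z * eta 0 i.

Let pc_holo j : fibre_holo AF (pc j).
Proof.
apply: (fibre_holoM oA); last first.
  exact: (fibre_holo_base oA oD AD (smooth_conj oD (sb j))).
apply: (fibre_holo_sum oA) => i; apply: (fibre_holoM oA); last exact: fibre_holo_eta.
exact: (fibre_holo_base oA oD AD (sb i)).
Qed.

Let ec_holo j : fibre_holo AF (ec j).
Proof.
apply: (fibre_holo_sum oA) => i; apply: (fibre_holoM oA); last exact: fibre_holo_eta.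
exact: (fibre_holo_base oA oD AD (shs i j)).
Qed.

(** Each factor is linear in [w], with coefficients holomorphic along the fibres. At [w] = conj eta
    the identity follows from [defect_relation]; [polar3] then frees [w]. *)
Lemma defect_cubic m w z eta : AF z eta ->
  lf (fun j => pc j z eta) w * (lf (fun j => defect hs m j z eta) w * lf (fun j => defect hs m j z eta) w +
    2 * (lf (fun j => defect hs m j z eta) w * lf (fun j => defect bs m j z eta) w)) =
  lf (fun j => ec j z eta) w * (lf (fun j => defect bs m j z eta) w * lf (fun j => defect bs m j z eta) w).
Proof.
move=> Az; apply/eqP; rewrite -subr_eq0; apply/eqP; rewrite -cubic_sum.
pose c i j k z eta := pc i z eta * (defect hs m j z eta * defect hs m k z eta +
  2 * (defect hs m j z eta * defect bs m k z eta)) -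
  ec i z eta * (defect bs m j z eta * defect bs m k z eta).
have ht j := defect_holo m j shs; have hv j := defect_holo m j sbs.
apply: (polar3 oA (c := c)) Az => [i j k|z' eta' Az'].
  have -> : c i j k = fun z eta => pc i z eta * (defect hs m j z eta * defect hs m k z eta +
      2 * (defect hs m j z eta * defect bs m k z eta)) +
      -1 * (ec i z eta * (defect bs m j z eta * defect bs m k z eta)).
    by apply/funext => z'; apply/funext => eta'; rewrite mulN1r.
  apply: (fibre_holoD oA); last first.
    apply: (fibre_holoM oA); first exact: fibre_holo_cst.
    by apply: (fibre_holoM oA) => //; exact: (fibre_holoM oA).
  apply: (fibre_holoM oA) => //; apply: (fibre_holoD oA); first exact: (fibre_holoM oA).
  by apply: (fibre_holoM oA); [exact: fibre_holo_cst|exact: (fibre_holoM oA)].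
rewrite (cubic_sum _ _ _ _ (fun j => (eta' 0 j)^*)).
have -> : lf (fun j => pc j z' eta') (fun j => (eta' 0 j)^*) = rh z' eta' * rh z' eta'.
  rewrite rhoC_sqr /BB {2}betaE conjC_sum mulr_sumr; apply: eq_bigr => j _.
  by rewrite (conjCM (b j z')) mulrA.
have -> : lf (fun j => ec j z' eta') (fun j => (eta' 0 j)^*) =
    al z' eta' * al z' eta' - rh z' eta' * rh z' eta'.
  rewrite rhoC_sqr (alphaC_sqr oD data _ Az'.1) addrK EH_sform [RHS]exchange_big.
  by apply: eq_bigr => j _; rewrite mulr_suml.
have := defect_relation m Az'; rewrite -/(lf _ _) -/(lf _ _).
(* With r, a, x, y for rho, alpha, T, V, the cofactor r x + r y - a y is the relation with alpha
   replaced by -alpha; the product involves only the squares of alpha and rho. *)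
have alg (r a x y : C) : r * x + (a + r) * y = 0 ->
    r * r * (x * x + 2 * (x * y)) - (a * a - r * r) * (y * y) = 0.
  move=> E; have -> : r * r * (x * x + 2 * (x * y)) - (a * a - r * r) * (y * y) =
    (r * x + (a + r) * y) * (r * x + r * y - a * y) by ring.
  by rewrite E mul0r.
exact: alg.
Qed.

(* A vector in the kernel of beta; unless [eta] lies in a proper subspace, the
   plane spanned by its conjugate and [conj eta] separates the factors of
   [defect_cubic]. *)
Definition ker_vec k l z : V := \row_j (b k z * (l == j)%:R - b l z * (k == j)%:R).

(** [b k z] times the [EH]-product of [eta] with [ker_vec]; this product is the number [E1] that
    [plane_algebra] requires to be nonzero. *)
Definition gen_fun k l z eta : C :=
  b k z * \sum_j ec j z eta * (ker_vec k l z 0 j)^*.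

(** An open region rather than a point, because the equations T = V = 0 obtained on it are still to
    be polarized and differentiated. *)
Definition generic k l z eta : Prop := AF z eta /\ gen_fun k l z eta != 0.

Lemma beta_ker_vec k l z : \sum_j b j z * ker_vec k l z 0 j = 0.
Proof.
have E j : b j z * ker_vec k l z 0 j = b k z * (b j z * (l == j)%:R) - b l z * (b j z * (k == j)%:R).
  by rewrite mxE; move: (b j z) (b k z) (b l z) ((l == j)%:R) ((k == j)%:R) => *; ring.
under eq_bigr do rewrite E.
rewrite sumrB -!mulr_sumr (sum_delta (fun j => b j z)) (sum_delta (fun j => b j z)).
by rewrite mulrC subrr.
Qed.

Lemma bsmooth_gen_fun k l : bsmooth AF (gen_fun k l).
Proof.
have sB (c : V -> C) : smooth_on D c -> bsmooth AF (fun z _ => c z).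
  exact: (bsmooth_base oA oD AD).
have sv j : smooth_on D (fun z => ker_vec k l z 0 j).
  have s1 i (x : C) := smoothM oD (sb i) (smooth_cst D x).
  have s2 := smoothM oD (smooth_cst D (-1)) (s1 l (k == j)%:R).
  move=> q; apply: (Ck_ext oD _ (CkD oD (s1 k (l == j)%:R q) (s2 q))) => z _.
  by rewrite mxE mulN1r.
apply: (bsmoothM oA (sB _ (sb k))); apply: (bsmooth_sum oA) => j.
exact: (bsmoothM oA (ec_holo j).1 (bsmooth_conj oA (sB _ (sv j)))).
Qed.

Lemma open_generic k l : open (Defs.total (generic k l)).
Proof.
apply: (@open_neq0 _ _ (Defs.total AF) (flat (gen_fun k l)) oA) => p Ap.
exact: (Ck_cont (bsmooth_gen_fun k l 0) Ap).
Qed.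

Lemma zermelo_W_neq0 z : D z -> W z != 0.
Proof.
move=> zD; apply/eqP => W0; have := zermelo_W_gt0 data zD; rewrite W0.
have -> : herm_norm h z 0 = 0.
  rewrite /herm_norm (_ : hform _ _ = 0) ?sqrtr0// hformE big1// => i _.
  by rewrite big1// => j _; rewrite mxE mulr0 mul0r.
by rewrite ltxx.
Qed.

(** [beta] at [W] is ||W||_h^2 / eps; so [W] gives a direction off the zeros of beta over every
    point. *)
Lemma beta_W z : D z -> beta z (W z) != 0.
Proof.
move=> zD; have -> : beta z (W z) = e z * hform (h z) (W z).
  rewrite betaE mulr_sumr; apply: eq_bigr => i _; rewrite /bcoef /zermelo_low !mulr_suml mulr_sumr.
  apply: eq_bigr => j _; move: (h z i j) ((W z 0 j)^*) (e z) (W z 0 i) => *; ring.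
rewrite mulf_neq0 ?(einv_neq0 data zD)// gt_eqF//.
exact: (hermitian_posdef hD zD (zermelo_W_neq0 zD)).
Qed.

Lemma bcoef_neq0 z : D z -> exists k, b k z != 0.
Proof.
move=> zD; apply/not_existsP => b0; have := beta_W zD; rewrite betaE big1 ?eqxx// => i _.
by have /negP/negPn/eqP -> := b0 i; rewrite mul0r.
Qed.

Lemma generic_point z : D z -> exists k l eta, generic k l z eta.
Proof.
move=> zD; have [k bk] := bcoef_neq0 zD.
have [l lk] : exists l : 'I_n, l != k.
  have n_gt0 : (0 < n)%N := ltnW n_gt1.
  have [->|] := eqVneq k (Ordinal n_gt0); first by exists (Ordinal n_gt1).
  by move=> ?; exists (Ordinal n_gt0); rewrite eq_sym.
pose x := ker_vec k l z.
have x0 : x != 0.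
  apply/eqP => /rowP /(_ l); rewrite !mxE eqxx eq_sym (negbTE lk) mulr0 subr0 mulr1.
  by apply/eqP.
have eN0 := einv_neq0 data zD.
(* The kernel of beta is the [h]-orthogonal complement of [W]: beta sees only the summand [W], and
   the product with [x] sees only [x]. *)
exists k, l, (W z + x); split; first split => //.
  rewrite betaE; under eq_bigr do rewrite mxE mulrDr.
  by rewrite big_split /= beta_ker_vec addr0 -betaE beta_W.
rewrite mulf_neq0//.
have -> : \sum_j ec j z (W z + x) * (x 0 j)^* = e z * (sesqui (h z) (W z) x + hform (h z) x).
  have sE (v : V) : sesqui (h z) v x = \sum_j \sum_i h z i j * v 0 i * (x 0 j)^*.
    exact: exchange_big.
  rewrite -[hform (h z) x]/(sesqui (h z) x x) !sE -big_split mulr_sumr; apply: eq_bigr => j _.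
  rewrite -big_split mulr_suml mulr_sumr; apply: eq_bigr => i _ /=.
  by rewrite mxE /hs; move: (e z) (h z i j) (W z 0 i) (x 0 i) ((x 0 j)^*) => *; ring.
have -> : sesqui (h z) (W z) x = 0.
  apply/eqP; rewrite -conjc_eq0 (sesqui_conj _ _ (hermitian_sym hD zD)); apply/eqP.
  have bx : \sum_j b j z * x 0 j = 0 := beta_ker_vec k l z.
  apply: (mulfI eN0); rewrite mulr0 -[RHS]bx mulr_sumr.
  apply: eq_bigr => i _; rewrite /bcoef /zermelo_low !mulr_suml mulr_sumr.
  have alg (x1 x2 x3 x4 : C) : x1 * (x2 * x4 * x3) = x2 * x3 * x1 * x4 by ring.
  by apply: eq_bigr => j _; exact: alg.
by rewrite add0r mulf_neq0// gt_eqF//; exact: (hermitian_posdef hD zD x0).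
Qed.

Lemma defect_zero k l m z eta : generic k l z eta ->
  \sum_j defect hs m j z eta * (eta 0 j)^* = 0 /\
  \sum_j defect bs m j z eta * (eta 0 j)^* = 0.
Proof.
move=> [Az g0].
pose w1 j := (ker_vec k l z 0 j)^*; pose w2 j := (eta 0 j)^*.
have lin c s t : lf c (fun j => s * w1 j + t * w2 j) = s * lf c w1 + t * lf c w2.
  rewrite /lf !mulr_sumr -big_split; apply: eq_bigr => j _ /=.
  by move: (c j) (w1 j) (w2 j) => *; ring.
have P1 : lf (fun j => pc j z eta) w1 = 0.
  have -> : lf (fun j => pc j z eta) w1 = beta z eta * (\sum_j b j z * ker_vec k l z 0 j)^*.
    rewrite conjC_sum mulr_sumr; apply: eq_bigr => j _.
    by rewrite (conjCM (b j z)) mulrA.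
  by rewrite beta_ker_vec conjc0 mulr0.
have P2 : lf (fun j => pc j z eta) w2 != 0.
  have -> : lf (fun j => pc j z eta) w2 = beta z eta * (beta z eta)^*.
    rewrite {2}betaE conjC_sum mulr_sumr; apply: eq_bigr => j _.
    by rewrite (conjCM (b j z)) mulrA.
  by rewrite mulf_neq0 ?conjc_eq0 ?Az.2.
have E1 : lf (fun j => ec j z eta) w1 != 0.
  by move: g0; rewrite /gen_fun mulf_eq0 negb_or => /andP[].
apply: (plane_algebra P2 E1 (E2 := lf (fun j => ec j z eta) w2)
  (T1 := lf (fun j => defect hs m j z eta) w1)
  (V1 := lf (fun j => defect bs m j z eta) w1)) => s t.
have := defect_cubic m (fun j => s * w1 j + t * w2 j) Az.
by rewrite !lin P1 mulr0 add0r.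
Qed.

Lemma fibre_holo_generic k l f : fibre_holo AF f -> fibre_holo (generic k l) f.
Proof.
move=> [sf hf]; split; first by apply: bsmooth_sub sf => z eta [].
by move=> r z eta [Az _]; exact: hf.
Qed.

(** T = 0 on an open region, so [polar1] removes conj eta and every coefficient [defect hs m j]
    vanishes. This is a linear system with matrix [h z]; the term in [dz m e] comes from the factor
    [e] of [hs]. *)
Lemma De_spray_generic k l m p z eta : generic k l z eta ->
  De m (G p) z eta = \sum_i Gam p i m z * eta 0 i + dz m e z / e z * eta 0 p.
Proof.
move=> gz; have Az := gz.1; have zD : D z := Az.1.
have eN0 := einv_neq0 data zD.
have d0 j : defect hs m j z eta = 0.
  apply: (polar1 (@open_generic k l) (c := defect hs m)) gz => [j'|z' eta' g'].
    by apply: fibre_holo_generic; exact: defect_holo.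
  exact: (defect_zero m g').1.
have dhs i j : dz m (hs i j) z = dz m e z * h z i j + e z * \sum_p h z p j * Gam p i m z.
  rewrite (lower_christoffel hD i m j zD) !dzE.
  rewrite (wirtM _ _ (smooth_dd (smooth_einv oD data) zD)
    (smooth_dd (hermitian_smooth hD i j) zD)).
  by [].
pose x p := \sum_i Gam p i m z * eta 0 i + dz m e z / e z * eta 0 p.
have E : (\row_p x p) *m h z = (\row_p De m (G p) z eta) *m h z.
  apply/rowP => j; rewrite !mxE; apply: (mulfI eN0).
  under eq_bigr do rewrite mxE; under [in RHS]eq_bigr do rewrite mxE.
  transitivity (\sum_i dz m (hs i j) z * eta 0 i); last first.
    move: (d0 j) => /eqP; rewrite subr_eq0 => /eqP ->; rewrite mulr_sumr.
    by apply: eq_bigr => q _; exact: mulrCA.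
  transitivity (\sum_i (dz m e z * h z i j * eta 0 i +
      \sum_p e z * (h z p j * Gam p i m z * eta 0 i))); last first.
    apply: eq_bigr => i _; rewrite dhs mulrDl; congr (_ + _).
    by rewrite -mulr_sumr -mulr_suml mulrA.
  rewrite big_split exchange_big -big_split mulr_sumr; apply: eq_bigr => q _ /=.
  rewrite -mulr_sumr /x.
  have -> : \sum_i h z q j * Gam q i m z * eta 0 i = h z q j * \sum_i Gam q i m z * eta 0 i.
    by rewrite mulr_sumr; apply: eq_bigr => i _; rewrite mulrA.
  move: (\sum_i _) (dz m e z) (h z q j) (eta 0 q) => x1 x2 x3 x4.
  by field.
have U := posdef_unitmx (hermitian_posdef hD zD).
have := congr1 (fun M => (M *m invmx (h z)) 0 p) E.
by rewrite !mulmxK// !mxE => <-.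
Qed.

(* Compare the two expressions of the gradient of the spray: the one above and
   the derivative of its Euler relation. *)
Lemma einv_parallel m z : D z -> dz m e z = 0.
Proof.
move=> zD; have [k [l [eta gz]]] := generic_point zD.
have og := @open_generic k l.
pose sg m z := dz m e z / e z.
have Az := gz.1; have [p0 ep0] := rV_neq0 (AS Az).2.
have eN0 := einv_neq0 data zD.
have gD z' eta' : generic k l z' eta' -> D z' by move=> [[]].
have sGam p i q : bsmooth (generic k l) (fun z _ => Gam p i q z).
  by apply: bsmooth_sub (bsmooth_christoffel oD hD p i q) => z' eta' [/AS].
have ssg q : bsmooth (generic k l) (fun z _ => sg q z).
  apply: (bsmooth_base og oD gD); apply: (smoothM oD (smooth_dz q (smooth_einv oD data))).
  by move=> r; apply: (CkV oD _ (smooth_einv oD data r)) => y /(einv_neq0 data).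
have sGg p : bsmooth (generic k l) (G p) by apply: bsmooth_sub (sG p) => z' eta' [].
pose lin p q z eta := \sum_i Gam p i q z * eta 0 i.
have slin p q : bsmooth (generic k l) (lin p q).
  by apply: (bsmooth_sum og) => i; exact: (bsmoothM og (sGam p i q) (bsmooth_eta _ i)).
pose st z eta := \sum_q sg q z * eta 0 q.
have sst : bsmooth (generic k l) st.
  by apply: (bsmooth_sum og) => i; exact: (bsmoothM og (ssg i) (bsmooth_eta _ i)).
have DG p q : De q (G p) z eta = lin p q z eta + sg q z * eta 0 p.
  exact: De_spray_generic gz.
have eul p z' eta' : generic k l z' eta' ->
    \sum_q lin p q z' eta' * eta' 0 q + st z' eta' * eta' 0 p = 2 * G p z' eta'.
  move=> g'; rewrite -(euler_spray FA p g'.1) mulr_suml -big_split; apply: eq_bigr => q _ /=.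
  rewrite (De_spray_generic q p g') /sg /lin mulrDl.
  by rewrite [_ * eta' 0 p * eta' 0 q]mulrAC.
(* Differentiate [eul] along eta^q. The connection terms on both sides are equal by the Kaehler
   symmetry, and the terms in [sg] leave this identity. *)
have key q p : sg q z * eta 0 p = st z eta * (q == p)%:R.
  have sl2 q' : bsmooth (generic k l) (fun z eta => lin p q' z eta * eta 0 q').
    exact: (bsmoothM og (slin p q') (bsmooth_eta _ q')).
  have s2 := bsmoothM og sst (bsmooth_eta _ p).
  have := bwirt_ext og (- ii) (rshift n q) (eul p) (bsmoothD og (bsmooth_sum og _ sl2) s2) gz.
  rewrite (bwirtM _ _ (bsmooth_cst _ 2) (sGg p) gz) bwirt_cst mul0r add0r DG.
  rewrite (bwirtD _ _ (bsmooth_sum og _ sl2) s2 gz) (bwirtM _ _ sst (bsmooth_eta _ p) gz).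
  rewrite De_eta (De_linear og q ssg gz) (bwirt_sum og _ _ _ sl2 gz).
  have -> : \sum_q' De q (fun z eta => lin p q' z eta * eta 0 q') z eta = 2 * lin p q z eta.
    transitivity (\sum_q' (Gam p q q' z * eta 0 q' + lin p q' z eta * (q == q')%:R)).
      apply: eq_bigr => q' _; rewrite (bwirtM _ _ (slin p q') (bsmooth_eta _ q') gz) De_eta.
      by rewrite (De_linear og q (fun i => sGam p i q') gz).
    rewrite big_split /= (sum_delta (fun q' => lin p q' z eta)).
    have -> : \sum_q' Gam p q q' z * eta 0 q' = lin p q z eta.
      by apply: eq_bigr => i _; rewrite (christoffel_kahler kh _ _ _ zD).
    by rewrite mulr_natl mulr2n.
  have alg (x1 x2 x3 : C) : 2 * x1 + (x2 + x3) = 2 * (x1 + x2) -> x2 = x3.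
    move=> E; apply: (addrI (2 * x1 + x2)); rewrite -addrA -[in RHS]addrA E.
    ring.
  exact: alg.
(* In the trace [q = p] of [key] the left side sums to [st] and the right side to [n] times [st]. *)
have st0 : st z eta = 0.
  have E : st z eta = st z eta *+ n.
    have sum_eq (x : 'I_n -> C) c : (forall q, x q = c) -> \sum_q x q = c *+ n.
      by move=> xc; under eq_bigr do rewrite xc; rewrite sumr_const card_ord.
    apply: sum_eq => q; apply: etrans (key q q) _.
    by rewrite eqxx; exact: mulr1.
  apply/eqP; have : st z eta *+ n.-1 = 0.
    apply: (addrI (st z eta)); rewrite addr0 -mulrS prednK//; exact: ltnW.
  have n1 : (n.-1 == 0)%N = false by case: (n) n_gt1 => [//|[]].
  by move/eqP; rewrite mulrn_eq0 n1.
have := key m p0; rewrite st0 mul0r => /eqP; rewrite mulf_eq0 (negbTE ep0) orbF.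
by rewrite /sg mulf_eq0 invr_eq0 (negbTE eN0) orbF => /eqP.
Qed.

(** With [einv_parallel] the fibre derivative of the spray is linear in [eta] with the coefficients
    of [h]; V = 0 becomes a sesquilinear form with coefficients depending on [z] only, and
    [sesquilinear_zero] applies. *)
Lemma parallel_bcoef i j m z : D z ->
  dz m (fun z => b i z * (b j z)^*) z = \sum_p Gam p i m z * (b p z * (b j z)^*).
Proof.
move=> zD; have [k [l [eta gz]]] := generic_point zD.
have og := @open_generic k l.
apply/eqP; rewrite -subr_eq0; apply/eqP.
apply: (@sesquilinear_zero _ _ (generic k l z)
  (fun i j => dz m (bs i j) z - \sum_p Gam p i m z * bs p j z) eta) => //.
  exact: (total_open_fibre og).
move=> y gy; have := (defect_zero m gy).2.
move=> E; apply: etrans _ E; rewrite exchange_big /=; apply: eq_bigr => j' _.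
rewrite -mulr_suml; apply: (congr1 (fun x => x * _)); rewrite /defect.
under eq_bigr do rewrite mulrBl.
rewrite sumrB; apply: (congr1 (fun x => _ - x)).
under eq_bigr do rewrite mulr_suml.
rewrite exchange_big /=; apply: eq_bigr => p _.
rewrite (De_spray_generic m p gy) (einv_parallel m zD) mul0r mul0r addr0 mulr_suml.
by apply: eq_bigr => i' _; exact: mulrAC.
Qed.

End RandersBerwald.

(** * Navigation metrics *)

Section Constant.
Context {R : realType} {n : nat}.
Local Notation C := R[i].
Local Notation V := 'rV[C]_n.
Implicit Types (z : V).

(** The mean value theorem on segments makes [g] locally constant, so its level set and the
    complement of that set in [D] are both open. *)
Lemma constant_on_connected (D : set V) (g : V -> R) : open D -> connected D -> D !=set0 ->
  smooth_on D (fun z => (g z)%:C) ->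
  (forall v z, D z -> ddir v (fun z => (g z)%:C) z = 0) ->
  exists c, forall z, D z -> g z = c.
Proof.
move=> oD cD [z0 Dz0] sg dg0.
have loc z : D z -> exists2 d : R, 0 < d & forall y, vabs1 (y - z) < d -> D y /\ g y = g z.
  move=> zD; have [d d0 hd] := (open_vabs1P D).1 oD z zD.
  exists d => // y yz; split; first exact: hd.
  have near t : `|t| <= `|1 : R| -> D (z + t%:C *: (y - z)).
    rewrite normr1 => t1; apply: hd; rewrite addrC addKr vabs1Z.
    by apply: le_lt_trans yz; rewrite ler_piMl// vabs1_ge0.
  have [t t1] := @rdir_MVT _ _ (y - z) g z 1
    (fun t t1 => (Ck_der (y - z) (sg 1%N) (near t t1)).1).
  Transparent ddir.
  have -> : rdir (y - z) g (z + t%:C *: (y - z)) = 0.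
    exact: (congr1 (@complex.Re R) (dg0 (y - z) _ (near t t1))).
  Opaque ddir.
  rewrite mulr0 => /eqP; rewrite subr_eq0 => /eqP <-.
  by rewrite scale1r addrC subrK.
pose B := [set z | D z /\ g z = g z0].
have oB : open B.
  apply/open_vabs1P => z [/loc [d d0 hd] gz]; exists d => // y /hd [Dy gy].
  by split => //; rewrite gy.
have oB' : open [set z | D z /\ g z != g z0].
  apply/open_vabs1P => z [/loc [d d0 hd] gz]; exists d => // y /hd [Dy gy].
  by split => //; rewrite gy.
have BD : B = D.
  apply: cD; first by exists z0.
    by exists B => //; apply/seteqP; split => [z [zD gz]|z []].
  exists (~` [set z | D z /\ g z != g z0]); first exact: open_closedC.
  apply/seteqP; split => [z [zD gz]|z [zD /= nz]]; first by split => // -[_]; rewrite gz eqxx.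
  by split => //; apply/eqP; apply: contra_notT nz.
by exists (g z0) => z; rewrite -BD => -[].
Qed.

End Constant.

(** * The common connection of the three metrics *)

Section FlatConnections.
Context {R : realType} {n : nat}.
Local Notation C := R[i].
Local Notation V := 'rV[C]_n.
Implicit Types (z eta : V).
Variables (D : set V) (h : V -> 'M[C]_n) (u : V -> R) (W : V -> V).
Hypotheses (n_gt1 : (1 < n)%N) (oD : open D) (data : zermelo_data D h u W).
Let hD := zermelo_hermitian data.
Local Notation AF := (beta_neq0 D h u W).
Local Notation a := (zermelo_a h u W).
Local Notation F := (zermelo_randers h u W).
Local Notation b := (bcoef h u W).
Local Notation e := (einv h u W).
Local Notation al := (alphaC h u W).
Local Notation rh := (rhoC h u W).
Local Notation Gam := (christoffel h).
Hypotheses (kh : kahler D h) (cb : complex_berwald AF F).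
Let oA : open (Defs.total AF) := open_AF oD data.
Let oS := open_slit oD.
Let AS := @AF_slit R n D h u W.
Let SD z eta : slit D z eta -> D z := fun Az => Az.1.
Let FA := randers_finsler_region oD data.
Let aD := a_hermitian oD data.
Let Fa := herm_finsler_region oD aD.

Lemma parallel_sform (c : 'I_n -> 'I_n -> V -> C) : (forall i j, smooth_on D (c i j)) ->
  (forall i j m z, D z -> dz m (c i j) z = \sum_p Gam p i m z * c p j z) ->
  forall m z eta, slit D z eta -> Dz m (sform c) z eta =
    \sum_p De p (sform c) z eta * \sum_l Gam p l m z * eta 0 l.
Proof.
move=> sc pc m z eta S; rewrite (Dz_sform oD oS SD sc m S) /sform.
under [in RHS]eq_bigr do rewrite (De_sform oD oS SD sc _ S) mulr_sumr.
rewrite [RHS]exchange_big /=; apply: eq_bigr => i _.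
under [in RHS]eq_bigr do rewrite mulr_suml.
rewrite [RHS]exchange_big /=; apply: eq_bigr => j _.
rewrite (pc i j m z S.1) !mulr_suml; apply: eq_bigr => p _.
by move: (Gam p i m z) (c p j z) (eta 0 i) ((eta 0 j)^*) => *; ring.
Qed.

Let sb i : smooth_on D (b i) := smooth_bcoef oD data i.

Let parallel_BB m z eta : slit D z eta -> Dz m (BB h u W) z eta =
    \sum_p De p (BB h u W) z eta * \sum_l Gam p l m z * eta 0 l.
Proof.
rewrite BB_sform; apply: parallel_sform => [i j|i j k y Dy].
  exact: (smoothM oD (sb i) (smooth_conj oD (sb j))).
exact: (parallel_bcoef n_gt1 oD data kh cb).
Qed.

Let parallel_EH m z eta : slit D z eta -> Dz m (EH h u W) z eta =
    \sum_p De p (EH h u W) z eta * \sum_l Gam p l m z * eta 0 l.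
Proof.
have se := smooth_einv oD data; have sh := hermitian_smooth hD.
rewrite EH_sform; apply: parallel_sform => [i j|i j k y Dy].
  exact: (smoothM oD se (sh i j)).
have := einv_parallel n_gt1 oD data kh cb k Dy; rewrite !dzE => e0.
rewrite (wirtM _ _ (smooth_dd se Dy) (smooth_dd (sh i j) Dy)) e0 mul0r add0r -dzE.
rewrite -(lower_christoffel hD i k j Dy) mulr_sumr; apply: eq_bigr => p _.
by move: (Gam p i k y) (e y) (h y p j) => *; ring.
Qed.

Lemma nonlin_a i j z eta : slit D z eta ->
  nonlin_conn (herm_norm a) i j z eta = \sum_l Gam i l j z * eta 0 l.
Proof.
apply: (nonlin_of_parallel Fa (bsmooth_christoffel oD hD)) => m y x S.
have E y' x' : slit D y' x' -> EH h u W y' x' + BB h u W y' x' = energy (herm_norm a) y' x'.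
  by move=> [Dy' _]; rewrite (energy_herm _ (hermitian_posdef aD Dy')) hform_a.
have sE := bsmooth_EH oD data; have sB := bsmooth_BB oD data.
rewrite -(bwirt_ext oS _ _ E (bsmoothD oS sE sB) S).
under eq_bigr do rewrite -(bwirt_ext oS _ _ E (bsmoothD oS sE sB) S) (bwirtD _ _ sE sB S) mulrDl.
by rewrite big_split (bwirtD _ _ sE sB S) (parallel_EH m S) (parallel_BB m S).
Qed.

(** [bwirt_energy_randers] writes base and fibre derivatives of [L] by one and the same combination,
    so parallelism of [EH] and [BB] passes to [L]. *)
Lemma nonlin_randers i j z eta : AF z eta ->
  nonlin_conn F i j z eta = \sum_l Gam i l j z * eta 0 l.
Proof.
have sG i' l' j' : bsmooth AF (fun z _ => Gam i' l' j' z).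
  exact: bsmooth_sub AS (bsmooth_christoffel oD hD i' l' j').
apply: (nonlin_of_parallel FA sG) => m y x Ay.
have al0 := alphaC_gt0 oD data (AS Ay); have rh0 := rhoC_gt0 Ay.
have ar0 : al y x * rh y x != 0 by rewrite mulf_neq0// gt_eqF.
have rel c k := bwirt_energy_randers oD data c k Ay.
apply: (mulfI ar0); rewrite rel (parallel_EH m (AS Ay)) (parallel_BB m (AS Ay)).
rewrite !mulr_sumr -big_split mulr_sumr; apply: eq_bigr => p _ /=.
have alg (f r x1 x2 x3 x4 a1 : C) : a1 * r * x4 = f * (r * x1 + f * x2) ->
    f * (r * (x1 * x3) + f * (x2 * x3)) = a1 * r * (x4 * x3).
  by move=> E; rewrite (mulrA (a1 * r)) E; ring.
exact: alg (rel _ _).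
Qed.

Lemma zermelo_eps_constant : connected D -> D !=set0 ->
  exists c : R, forall z, D z -> zermelo_eps h u W z = c.
Proof.
move=> cD D0; have se := smooth_eps oD data.
have dze k z : D z -> dz k (fun z => (zermelo_eps h u W z)%:C) z = 0.
  move=> zD.
  have -> : (fun z => (zermelo_eps h u W z)%:C) = fun z => (e z)^-1.
    by apply/funext => y; rewrite /einv invrK.
  rewrite dzE (wirtV _ _ (einv_neq0 data zD) (smooth_dd (smooth_einv oD data) zD)) -dzE.
  by rewrite (einv_parallel n_gt1 oD data kh cb) // mul0r oppr0.
apply: (constant_on_connected oD cD D0 se) => v z zD.
rewrite (ddirE _ oD (se 1%N) zD) big1// => k _; rewrite (dze k z zD) mul0r add0r.
(* Since eps is real, its antiholomorphic derivatives are conjugates of the holomorphic ones. *)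
have -> : (fun z => (zermelo_eps h u W z)%:C) = fun z => ((zermelo_eps h u W z)%:C : C)^*.
  by apply/funext => y; rewrite conjc_real.
by rewrite (dzb_conj k se zD) (dze k z zD) conjc0 mul0r.
Qed.

End FlatConnections.

#[local] Opaque theta hol_curv.

Section ZermeloNavigation.
Context {R : realType} {n : nat}.
Local Notation C := R[i].
Local Notation V := 'rV[C]_n.
Implicit Types (z eta : V).

(** Both torsion vectors vanish for weakly Kaehler metrics, which reduces the definition to sprays
    equal up to a multiple of [eta]. *)
Lemma proj_related_kahler (A1 A2 : V -> set V) (F1 F2 : V -> V -> R) (P : V -> V -> C) :
  finsler_region A1 F1 -> finsler_region A2 F2 -> weakly_kahler A1 F1 -> weakly_kahler A2 F2 ->
  bsmooth (fun z => A1 z `&` A2 z) P ->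
  (forall z eta, A1 z eta -> A2 z eta -> forall i,
    spray F2 i z eta = spray F1 i z eta + P z eta * eta 0 i) ->
  proj_related A1 F1 A2 F2.
Proof.
move=> R1 R2 /(weakly_kahler_thetaP R1) w1 /(weakly_kahler_thetaP R2) w2 sP E.
exists P; split => // z eta [Az1 Az2] i.
by rewrite (w1 z eta Az1 i) (w2 z eta Az2 i) subrr mulr0 addr0 E.
Qed.

Variables (D : set V) (h : V -> 'M[C]_n) (u : V -> R) (W : V -> V).
Hypotheses (n_gt1 : (1 < n)%N) (oD : open D) (data : zermelo_data D h u W).
Let n_gt0 : (0 < n)%N := ltnW n_gt1.
Let hD := zermelo_hermitian data.
Local Notation AF := (beta_neq0 D h u W).
Local Notation a := (zermelo_a h u W).
Local Notation F := (zermelo_randers h u W).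
Local Notation b := (bcoef h u W).
Local Notation Gam := (christoffel h).
Let oA : open (Defs.total AF) := open_AF oD data.
Let oS := open_slit oD.
Let AS := @AF_slit R n D h u W.
Let FA := randers_finsler_region oD data.
Let aD := a_hermitian oD data.
Let Fa := herm_finsler_region oD aD.
Let Fh := herm_finsler_region oD hD.
Let sGh := bsmooth_christoffel oD hD.

Lemma minkowski_flat_region (F0 : V -> V -> R) : complex_finsler D F0 ->
  locally_minkowski D F0 ->
  exists Gam0 : 'I_n -> 'I_n -> 'I_n -> V -> C,
  [/\ forall i l j, holomorphic_on D (Gam0 i l j),
    forall i l j z, D z -> Gam0 i l j z = Gam0 i j l z,
    forall i z eta, slit D z eta ->
      spray F0 i z eta = 2^-1 * \sum_j \sum_l Gam0 i l j z * eta 0 l * eta 0 j,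
    generalized_berwald (slit D) F0 & weakly_kahler (slit D) F0].
Proof.
move=> cF mk; have [Gam0 [hG sG nG]] := minkowski_global n_gt0 oD cF mk.
have FS := finsler_slit_region oD (@subset_refl _ D) cF.
have bG i l j : bsmooth (slit D) (fun z _ => Gam0 i l j z).
  by apply: (bsmooth_base oS oD _ (hG i l j).1) => z eta [].
exists Gam0; split => //.
- exact: spray_flat nG.
- exact: (flat_generalized_berwald FS bG nG).
- by apply: (flat_weakly_kahler FS bG nG) => z eta [zD _] i j k; exact: sG.
Qed.

Section Flat.
Hypotheses (kh : kahler D h) (cb : complex_berwald AF F).
Let Na := nonlin_a n_gt1 oD data kh cb.
Let NF := nonlin_randers n_gt1 oD data kh cb.
Let Nh := nonlin_herm oD hD.

Let sGF i l j : bsmooth AF (fun z _ => Gam i l j z) := bsmooth_sub AS (sGh i l j).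

Lemma spray_randers i z eta : AF z eta ->
  spray F i z eta = spray (herm_norm h) i z eta.
Proof. by move=> Az; rewrite (spray_flat NF i Az) (spray_flat Nh i (AS Az)). Qed.

Lemma spray_a i z eta : slit D z eta ->
  spray (herm_norm a) i z eta = spray (herm_norm h) i z eta.
Proof. by move=> S; rewrite (spray_flat Na i S) (spray_flat Nh i S). Qed.

Let wka : weakly_kahler (slit D) (herm_norm a).
Proof.
apply: (flat_weakly_kahler Fa sGh Na) => z eta [zD _] i j k.
exact: (christoffel_kahler kh _ _ _ zD).
Qed.

Let wkh : weakly_kahler (slit D) (herm_norm h) := kahler_herm oD hD kh.

Lemma zermelo_proj_related :
  [/\ proj_related (slit D) (herm_norm h) (slit D) (herm_norm a),
      proj_related (slit D) (herm_norm h) AF F &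
      proj_related (slit D) (herm_norm a) AF F].
Proof.
have s0 (A : V -> set V) : bsmooth A (fun _ _ => 0) by exact: bsmooth_cst.
have add0 (x y : C) : x = x + 0 * y by rewrite mul0r addr0.
split.
- apply: (proj_related_kahler Fh Fa wkh wka (s0 _)) => z eta S _ i.
  exact: etrans (spray_a i S) (add0 _ _).
- apply: (proj_related_kahler Fh FA wkh cb.2 (s0 _)) => z eta _ Az i.
  exact: etrans (spray_randers i Az) (add0 _ _).
- apply: (proj_related_kahler Fa FA wka cb.2 (s0 _)) => z eta S Az i.
  exact: etrans (etrans (spray_randers i Az) (esym (spray_a i S))) (add0 _ _).
Qed.

Variables (F0 : V -> V -> R) (P : V -> V -> C).
Hypotheses (cF0 : complex_finsler D F0) (mk0 : locally_minkowski D F0).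
Hypotheses (sP : bsmooth AF P) (FP : forall z eta, AF z eta -> forall i,
  spray F0 i z eta = spray F i z eta + P z eta * eta 0 i).
Let FS := finsler_slit_region oD (@subset_refl _ D) cF0.

Lemma christoffel_proj : exists (Gam0 : 'I_n -> 'I_n -> 'I_n -> V -> C) (f : 'I_n -> V -> C),
  [/\ forall i l j, holomorphic_on D (Gam0 i l j),
    forall i, smooth_on D (f i),
    forall p i m z, D z ->
      Gam0 p i m z - Gam p i m z = f i z * (m == p)%:R + f m z * (i == p)%:R,
    forall i z eta, slit D z eta ->
      spray F0 i z eta = 2^-1 * \sum_j \sum_l Gam0 i l j z * eta 0 l * eta 0 j &
    weakly_kahler (slit D) F0].
Proof.
have [Gam0 [hG0 symG0 spG0 _ wk0]] := minkowski_flat_region cF0 mk0.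
pose K i l j z := Gam0 i l j z - Gam i l j z.
have sK i l j : smooth_on D (K i l j).
  have sG := smooth_christoffel n_gt1 oD hD i l j.
  by move=> k; exact: (CkD oD ((hG0 i l j).1 k) (CkN oD (sG k))).
have AD z eta : AF z eta -> D z by case.
have bK i l j : bsmooth AF (fun z _ => K i l j z) := bsmooth_base oA oD AD (sK i l j).
have A0 z eta : AF z eta -> eta != 0 by move=> /AS[].
have symK i l j z eta : AF z eta -> K i l j z = K i j l z.
  move=> /AD zD.
  have E1 := symG0 i l j z zD; have E2 := christoffel_kahler kh i l j zD.
  have alg (x y x' y' : C) : x = x' -> y = y' -> x - y = x' - y' by move=> -> ->.
  exact: alg E1 E2.
have KP i z eta : AF z eta ->
    2^-1 * \sum_j \sum_l K i l j z * eta 0 l * eta 0 j = P z eta * eta 0 i.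
  move=> Az; apply: (addrI (spray F i z eta)); rewrite -FP// spG0; last exact: AS.
  rewrite (spray_flat NF i Az) -mulrDr -big_split; congr (_ * _); apply: eq_bigr => j _.
  rewrite -big_split; apply: eq_bigr => l _ /=.
  by rewrite /K; move: (Gam0 i l j z) (Gam i l j z) (eta 0 l) (eta 0 j) => *; ring.
exists Gam0, (proj_factor K); split => //.
- move=> i; apply: (smoothM oD (smooth_cst D _)); apply: (smooth_sum _ oD) => j.
  exact: sK.
- move=> p i m z zD.
  (* The identity is free of [eta], so one direction over each [z] suffices, and [W z] is available
     by [beta_W]. *)
  have Az : AF z (W z) by split; [exact: zD|exact: (beta_W data zD)].
  exact: (proj_coefficients oA A0 bK sP symK KP p i m Az).
Qed.

Lemma zermelo_curvature_zero :
  [/\ forall z eta, AF z eta -> hol_curv F z eta = 0,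
      forall z eta, slit D z eta -> hol_curv (herm_norm a) z eta = 0 &
      forall z eta, slit D z eta -> hol_curv (herm_norm h) z eta = 0].
Proof.
have [Gam0 [f [hG0 sf G0f _ _]]] := christoffel_proj.
have par i j m z := @parallel_bcoef R n D h u W n_gt1 oD data kh cb i j m z.
have dG z : D z -> forall p i m r, dzb r (Gam p i m) z = 0.
  move=> zD p i m r.
  exact: (curvature_zero n_gt1 oD hD kh (smooth_bcoef oD data) par hG0 sf G0f _ _ _ _ zD
    (bcoef_neq0 data zD)).
split=> z eta S.
- exact: (flat_hol_curv FA sGF NF S (dG z S.1)).
- exact: (flat_hol_curv Fa sGh Na S (dG z S.1)).
- exact: (flat_hol_curv Fh sGh Nh S (dG z S.1)).
Qed.

(** The factor [P] lives where beta is nonzero. Its linear form with coefficients [f] makes sense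
    for every [eta] and relates the sprays of [F0] and [h] on the whole slit bundle. *)
Lemma herm_loc_proj_flat : loc_proj_flat D (slit D) (herm_norm h).
Proof.
have [Gam0 [f [_ sf G0f spG0 wk0]]] := christoffel_proj.
exists F0; split => //.
have bf i : bsmooth (slit D) (fun z _ => f i z).
  by apply: (bsmooth_base oS oD _ (sf i)) => z eta [].
have bP : bsmooth (slit D) (fun z eta => \sum_i f i z * eta 0 i).
  by apply: (bsmooth_sum oS) => i; exact: (bsmoothM oS (bf i) (bsmooth_eta _ i)).
apply: (proj_related_kahler Fh FS wkh wk0 (bsmooth_sub (fun z eta => @proj1 _ _) bP)).
move=> z eta S _ i; rewrite spG0// (spray_flat Nh i S).
apply/eqP; rewrite addrC -subr_eq -mulrBr -sumrB; apply/eqP.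
transitivity (2^-1 * \sum_j \sum_l
    (eta 0 l * eta 0 j * f l z * (j == i)%:R + eta 0 l * eta 0 j * f j z * (l == i)%:R)).
  congr (_ * _); apply: eq_bigr => j _; rewrite -sumrB; apply: eq_bigr => l _.
  have := G0f i l j z S.1.
  move: (Gam0 i l j z) (Gam i l j z) (f l z) (f j z) (eta 0 l) (eta 0 j).
  move: ((j == i)%:R) ((l == i)%:R) => d1 d2 x1 x2 x3 x4 x5 x6 E.
  have -> : x1 * x5 * x6 - x2 * x5 * x6 = (x1 - x2) * (x5 * x6) by ring.
  by rewrite E; ring.
pose S1 := \sum_i0 f i0 z * eta 0 i0.
have X1 : \sum_j \sum_l eta 0 l * eta 0 j * f l z * (j == i)%:R = S1 * eta 0 i.
  rewrite -(sum_delta (fun j => S1 * eta 0 j) i); apply: eq_bigr => j _.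
  rewrite -mulr_suml eq_sym; congr (_ * _); rewrite mulr_suml; apply: eq_bigr => l _.
  by move: (eta 0 l) (eta 0 j) (f l z) => *; ring.
have X2 : \sum_j \sum_l eta 0 l * eta 0 j * f j z * (l == i)%:R = S1 * eta 0 i.
  rewrite mulr_suml; apply: eq_bigr => j _.
  rewrite -(sum_delta (fun l => f j z * eta 0 j * eta 0 l) i); apply: eq_bigr => l _.
  by rewrite eq_sym; move: (eta 0 l) (eta 0 j) (f j z) ((i == l)%:R) => *; ring.
under eq_bigr do rewrite big_split.
rewrite big_split /= X1 X2.
have two0 : 2 != 0 :> C by rewrite pnatr_eq0.
by move: (S1 * eta 0 i) => x; field.
Qed.

End Flat.

Lemma flat_zermelo_berwald : kahler D h -> loc_proj_flat D AF F ->
  complex_berwald AF F /\ exists F0 P, [/\ complex_finsler D F0, locally_minkowski D F0,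
    bsmooth AF P & forall z eta, AF z eta -> forall i,
    spray F0 i z eta = spray F i z eta + P z eta * eta 0 i].
Proof.
move=> kh [F0 [cF mk pr]].
have [_ [_ _ _ gb0 wk0]] := minkowski_flat_region cF mk.
have FS := finsler_slit_region oD (@subset_refl _ D) cF.
have [cb [P sP E]] := proj_related_berwald FA FS gb0 wk0 AS pr.
by split => //; exists F0, P.
Qed.

(** Projective flatness makes [h] complex Berwald, hence Kaehler. Together with the Berwald property
    of [F] this gives [F] the spray of [h], so the relation of [h] with [F0] restricts to [F]. *)
Lemma flat_herm_zermelo : loc_proj_flat D (slit D) (herm_norm h) -> complex_berwald AF F ->
  [/\ kahler D h, loc_proj_flat D AF F & exists F0 P, [/\ complex_finsler D F0,
    locally_minkowski D F0, bsmooth AF P & forall z eta, AF z eta -> forall i,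
    spray F0 i z eta = spray F i z eta + P z eta * eta 0 i]].
Proof.
move=> [F0 [cF mk pr]] cb.
have [_ [_ _ _ gb0 wk0]] := minkowski_flat_region cF mk.
have FS := finsler_slit_region oD (@subset_refl _ D) cF.
have [[_ wkh] [P sP E]] := proj_related_berwald Fh FS gb0 wk0 (fun z eta S => S) pr.
have kh := herm_weakly_kahler oD hD n_gt0 wkh.
have sP' : bsmooth AF P := bsmooth_sub AS sP.
have E' z eta : AF z eta -> forall i, spray F0 i z eta = spray F i z eta + P z eta * eta 0 i.
  by move=> Az i; rewrite (spray_randers kh cb i Az) E//; exact: AS.
split => //; last by exists F0, P.
exists F0; split => //.
apply: (proj_related_kahler FA FS cb.2 wk0 (bsmooth_sub (fun z eta => @proj1 _ _) sP')).
by move=> z eta Az _; exact: E'.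
Qed.

End ZermeloNavigation.

Theorem theorem4p13 (R : realType) (n : nat) (n_ge2 : (2 <= n)%N)
    (D : set 'rV[R[i]]_n) (D_open : open D) (D_neq0 : D !=set0)
    (D_conn : connected D)
    (h : 'rV[R[i]]_n -> 'M[R[i]]_n) (u : 'rV[R[i]]_n -> R)
    (W : 'rV[R[i]]_n -> 'rV[R[i]]_n) (data : zermelo_data D h u W) :
  let F := zermelo_randers h u W in
  let AF := beta_neq0 D h u W in
  let a := zermelo_a h u W in
  let S1 := kahler D h /\ loc_proj_flat D AF F in
  let S2 := loc_proj_flat D (slit D) (herm_norm h) /\ complex_berwald AF F in
  (S1 <-> S2) /\
  (S1 \/ S2 ->
    [/\ exists c : R, forall z, D z -> zermelo_eps h u W z = c,
        proj_related (slit D) (herm_norm h) (slit D) (herm_norm a),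
        proj_related (slit D) (herm_norm h) AF F &
        proj_related (slit D) (herm_norm a) AF F] /\
    [/\ forall z eta, AF z eta -> hol_curv F z eta = 0,
        forall z eta, slit D z eta -> hol_curv (herm_norm a) z eta = 0 &
        forall z eta, slit D z eta -> hol_curv (herm_norm h) z eta = 0]).
Proof.
move=> F AF a S1 S2.
have S12 : S1 -> S2.
  move=> [kh pf]; have [cb [F0 [P [cF mk sP E]]]] := flat_zermelo_berwald n_ge2 D_open data kh pf.
  by split => //; exact: (herm_loc_proj_flat n_ge2 D_open data kh cb cF mk sP E).
split; first split=> // -[ph cb].
  by have [] := flat_herm_zermelo n_ge2 D_open data ph cb.
move=> S; have [ph cb] : S2 by case: S.
have [kh _ [F0 [P [cF mk sP E]]]] := flat_herm_zermelo n_ge2 D_open data ph cb.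
have [r1 r2 r3] := zermelo_proj_related n_ge2 D_open data kh cb.
split; last exact: (zermelo_curvature_zero n_ge2 D_open data kh cb cF mk sP E).
split; [exact: (zermelo_eps_constant n_ge2 D_open data kh cb D_conn D_neq0)|..].
- exact: r1.
- exact: r2.
- exact: r3.
Qed.
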